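(* For each pair of nonnegative integers $\alpha$ and $\beta$, let $D(\alpha,\beta)$ be the least nonnegative integer such that every $d$-polytope with no more than $d+1+\alpha$ vertices and no more than $d+1+\beta$ facets is a join of a simplex and a polytope of dimension at most $D(\alpha,\beta)$. Then $D(\alpha,\beta)$ exists (is finite). Equivalently, there is an integer $D(\alpha,\beta)$ such that every $d$-polytope with $d>D(\alpha,\beta)$ either is a pyramid, or has more than $d+1+\alpha$ vertices, or has more than $d+1+\beta$ facets. Moreover, \[ f(\alpha,\beta)\leq D(\alpha,\beta)\leq \min\{F(\alpha,\beta),F(\beta,\alpha)\},\] where for nonnegative integers $x,y$ \[F(x,y)=\begin{cases}0 & \text{if } x=0 \text{ or } y=0,\\ 3x+y-2 & \text{if } 1\leq x\leq 5,\\ \binom{x}{2}+y+3 & \text{if } x\geq 5,\end{cases}\] and \[f(x,y)=\begin{cases}0 & \text{if } x=0 \text{ or } y=0,\\ x+y & \text{if } x=1 \text{ or } y=1,\\ x+2y-1 & \text{if } x\geq y>1,\\ 2x+y-1 & \text{if } y\geq x>1.\end{cases}\] (Cases are read in order, so the first applicable case is used.)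
   Context: A $d$-polytope is a convex polytope of dimension $d$. A polytope is a pyramid if all of its vertices but one lie on a common hyperplane (equivalently, it is the convex hull of a facet and a point outside its affine hull). The join of polytopes $P\subset\mathbb{R}^p$ and $Q\subset \mathbb{R}^q$ is (up to combinatorial equivalence) the convex hull of $P\times\{0\}\times\{0\}$ and $\{0\}\times Q\times\{1\}$ in $\mathbb{R}^{p+q+1}$, of dimension $\dim P+\dim Q+1$; the join of a $k$-simplex and a polytope $Q$ is a $(k+1)$-fold iterated pyramid over $Q$. A $0$-dimensional polytope is a point and the join with a simplex is again a simplex. *)

(* Defs.v *)
(* MathComp / MathComp-Analysis *)
From HB Require Import structures.
From mathcomp Require Export all_boot all_order all_algebra.
From mathcomp Require Export boolp classical_sets functions cardinality reals.
From mathcomp Require Export convex.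

Set Implicit Arguments.
Unset Strict Implicit.
Unset Printing Implicit Defensive.

Import Order.TTheory GRing.Theory Num.Theory.

Local Open Scope classical_set_scope.
Local Open Scope ring_scope.

Definition conv_hull (R : realType) (n : nat) (A : set 'rV[R]_n)
  : set 'rV[R]_n := smallest (@convex_set R 'rV[R]_n) A.

Definition affine_set (R : realType) (n : nat) (A : set 'rV[R]_n) : Prop :=
  forall (x y : 'rV[R]_n) (t : R), A x -> A y -> A (t *: x + (1 - t) *: y).

Definition aff_hull (R : realType) (n : nat) (A : set 'rV[R]_n)
  : set 'rV[R]_n := smallest (@affine_set R n) A.

(* The dimension of a set is that of its affine hull; the empty set has
   dimension -1. *)
Definition has_dim (R : realType) (n : nat) (A : set 'rV[R]_n) (d : int)
  : Prop :=
  (A = set0 /\ d = -1) \/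
  exists (x : 'rV[R]_n) (U : {vspace 'rV[R]_n}),
    aff_hull A = [set x + u | u in [set` U]] /\ d = (\dim U)%:Z.

Definition polytope (R : realType) (n : nat) (P : set 'rV[R]_n) : Prop :=
  exists s : seq 'rV[R]_n, P = conv_hull [set` s].

(* d is a natural number, so a d-polytope is nonempty; the ambient space may
   have dimension larger than d. *)
Definition dpolytope (R : realType) (n d : nat) (P : set 'rV[R]_n) : Prop :=
  polytope P /\ has_dim P d%:Z.

Definition dotp (R : realType) (n : nat) (x : 'rV[R]_n) (c : 'cV[R]_n) : R :=
  (x *m c) 0 0.

(* Since c = 0 is allowed, the empty set and P itself are faces of P. *)
Definition face (R : realType) (n : nat) (P F : set 'rV[R]_n) : Prop :=
  exists (c : 'cV[R]_n) (b : R),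
    (forall x, P x -> dotp x c <= b) /\ F = P `&` [set x | dotp x c = b].

Definition faces (R : realType) (n : nat) (P : set 'rV[R]_n)
  : set (set 'rV[R]_n) := [set F | face P F].

Definition vertices (R : realType) (n : nat) (P : set 'rV[R]_n)
  : set 'rV[R]_n := [set v | face P [set v]].

(* The empty set is the unique facet of a point, so that a d-simplex has d + 1
   facets for every d >= 0. *)
Definition facets (R : realType) (n : nat) (P : set 'rV[R]_n)
  : set (set 'rV[R]_n) :=
  [set F | face P F /\ exists d : int, has_dim P d /\ has_dim F (d - 1)].

Definition comb_equiv (R : realType) (m n : nat)
    (P : set 'rV[R]_m) (Q : set 'rV[R]_n) : Prop :=
  exists phi : set 'rV[R]_m -> set 'rV[R]_n,
    set_bij (faces P) (faces Q) phi /\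
    forall F G, faces P F -> faces P G -> (F `<=` G <-> phi F `<=` phi G).

Definition affinely_independent (R : realType) (n : nat) (s : seq 'rV[R]_n)
  : bool := if s is x :: s' then free [seq y - x | y <- s'] else true.

(* The empty set is the (-1)-simplex. *)
Definition simplex (R : realType) (n : nat) (S : set 'rV[R]_n) : Prop :=
  exists s : seq 'rV[R]_n, affinely_independent s /\ S = conv_hull [set` s].

Definition join (R : realType) (p q : nat)
    (P : set 'rV[R]_p) (Q : set 'rV[R]_q) : set 'rV[R]_(p + q + 1) :=
  conv_hull ([set row_mx (row_mx x 0) 0 | x in P] `|`
             [set row_mx (row_mx 0 y) (const_mx 1) | y in Q]).

(* All vertices but one lie on a hyperplane; the hyperplane has to miss the
   remaining vertex because P need not be full-dimensional. *)
Definition pyramid (R : realType) (n : nat) (P : set 'rV[R]_n) : Prop :=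
  exists (v : 'rV[R]_n) (c : 'cV[R]_n) (b : R),
    [/\ vertices P v, c != 0, dotp v c <> b &
        forall w, vertices P w -> w <> v -> dotp w c = b].

(* The simplex S may be empty, in which case P is equivalent to Q itself. *)
Definition join_bound (R : realType) (alpha beta D : nat) : Prop :=
  forall (n d : nat) (P : set 'rV[R]_n),
    dpolytope d P ->
    (vertices P #<= `I_(d + 1 + alpha)%N)%card ->
    (facets P #<= `I_(d + 1 + beta)%N)%card ->
    exists (p q e : nat) (S : set 'rV[R]_p) (Q : set 'rV[R]_q),
      [/\ simplex S, dpolytope e Q, (e <= D)%N & comb_equiv P (join S Q)].

Definition pyramid_bound (R : realType) (alpha beta D : nat) : Prop :=
  forall (n d : nat) (P : set 'rV[R]_n),
    dpolytope d P -> (D < d)%N ->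
    [\/ pyramid P,
        ~ (vertices P #<= `I_(d + 1 + alpha)%N)%card |
        ~ (facets P #<= `I_(d + 1 + beta)%N)%card].

Local Close Scope ring_scope.
Local Open Scope nat_scope.

Definition upper_fun (x y : nat) : nat :=
  if (x == 0) || (y == 0) then 0
  else if (1 <= x <= 5) then 3 * x + y - 2
  else 'C(x, 2) + y + 3.

Definition lower_fun (x y : nat) : nat :=
  if (x == 0) || (y == 0) then 0
  else if (x == 1) || (y == 1) then x + y
  else if (y <= x) then x + 2 * y - 1
  else 2 * x + y - 1.

(* Main.v *)
Require Import Defs.
From mathcomp Require Import all_boot all_order all_algebra reals.
From mathcomp Require Import interval_inference lra zify.

(* Encode a polytope with N vertices by the matrix [hom V] whose rows are the
   vertices with a coordinate 1 appended.  A nonnegative vector in its column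
   space is a supporting affine functional, its zero set is a face, and the
   minimal supports ([circuit]) are the complements of the facets.  The left
   kernel L of [hom V] (the Gale dual) has dimension alpha = N - (d + 1).

   For the upper bound, let P not be a pyramid, and call vertices v and w
   neighbours in the Gale diagram ([nbrs]) if some affine dependence is positive
   exactly on v and w (P has no edge vw).  Choose v with the fewest neighbours, let
   X be the set of neighbours, k = #|X|, and pass to the vertex figure at v: in the
   Gale diagram, delete v and contract X.  It is an iterated pyramid; let Y be
   its set of apexes.  There are at least two facets missing v and exactly one
   facet containing v and missing a given y in Y.  Moreover #|Y| <= 3k, because
   the y having a neighbour outside X number at most 2k, and the others are
   neighbours of every x in X, hence linearly independent in the span of X.
   Induction gives 2N < #facets + 5 alpha, that is d + 2 <= beta + 3 alpha, and
   the same counting for the right kernel of the slack matrix gives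
   d + 2 <= alpha + 3 beta.  These bounds are at least as strong as the ones
   claimed.

   The lower bound is attained by joins of squares with one prism over a simplex,
   and by the dual polytopes. *)

Set Implicit Arguments.
Unset Strict Implicit.
Unset Printing Implicit Defensive.
Import Order.TTheory GRing.Theory Num.Theory.
Local Open Scope ring_scope.

(** The induction runs over pairs of a row space and an index set [U], not over polytopes: passing
    to the vertex figure would change both the ambient space and the list of vertices, whereas
    deleting and contracting in the Gale diagram shrinks only [U] and the row space. The elements of
    X have to go because they are exactly what would violate the two-positive-coordinates condition
    once v is removed. Choosing v with fewest neighbours is what turns having no neighbour outside X
    into having X as neighbour set; such y are then all neighbours of one single x in X, and the
    neighbours of a single element are independent.

    The bound with the roles of vertices and facets exchanged would need the polar polytope.
    Instead, all geometry is put into a nonnegative matrix whose columns generate the nonnegative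
    part of their span; by Farkas' lemma this property is invariant under transposition, so the same
    counting theorem applies to both kernels. *)

Lemma mx_neq0 (R : nmodType) m n (A : 'M[R]_(m, n)) :
  A != 0 -> exists i j, A i j != 0.
Proof.
move=> A0; suff /existsP[i /existsP[j ij]] : [exists i, exists j, A i j != 0].
  by exists i, j.
apply: contraNT A0 => /existsPn h; apply/eqP/matrixP=> i j.
by have /existsPn/(_ j) := h i; rewrite negbK => /eqP ->; rewrite mxE.
Qed.

(** Induction on the rows. Suppose the functional [y] separating [b] from the later rows is negative
    on the top row [a0]. Subtracting multiples of [a0] moves [b] and the later rows into the kernel
    of [y], and induction applies again. A combination found there gives [a0] a nonnegative
    coefficient because [c] and [e] are negative; a separating functional is corrected by a multiple
    of [y] so as to vanish on [a0]. *)
Lemma farkas (R : realFieldType) (N a : nat) (A : 'M[R]_(N, a)) (b : 'rV[R]_a) :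
  (exists x : 'rV[R]_N, (forall i, 0 <= x 0 i) /\ x *m A = b) \/
  (exists y : 'cV[R]_a, (forall i, 0 <= (A *m y) i 0) /\ (b *m y) 0 0 < 0).
Proof.
elim: N A b => [|N IH] A b.
  have [->|b0] := eqVneq b 0.
    by left; exists 0; split=> [i|]; rewrite ?mul0mx // mxE.
  right; exists (- b^T); split=> [[]//|].
  rewrite mulmxN mxE oppr_lt0 mxE.
  have [j0 [i]] := mx_neq0 b0; rewrite ord1 => bi.
  rewrite (bigD1 i) //= mxE ltr_wpDr //; last first.
    by rewrite lt_neqAle eq_sym mulf_neq0 //= -expr2 sqr_ge0.
  by apply: sumr_ge0 => j _; rewrite mxE -expr2 sqr_ge0.
move: A; rewrite -[N.+1]/(1 + N)%N => A.
have /= := IH (dsubmx A) b; set a0 := usubmx A; set A1 := dsubmx A.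
have AE : A = col_mx a0 A1 by rewrite vsubmxK.
case=> [[x [x0 xA]]|[y [y0 yb]]].
  left; exists (row_mx 0 x); split=> [i|].
    by rewrite mxE; case: split_ordP => j _; rewrite ?mxE.
  by rewrite AE mul_row_col mul0mx add0r.
have [c0|c0] := leP 0 ((a0 *m y) 0 0).
  right; exists y; split=> // i; rewrite AE mul_col_mx mxE.
  by case: split_ordP => j _ //; rewrite ord1.
set c := (a0 *m y) 0 0 in c0.
have cE : a0 *m y = c%:M by rewrite [LHS]mx11_scalar.
set e := (b *m y) 0 0 in yb.
have eE : b *m y = e%:M by rewrite [LHS]mx11_scalar.
have [[x [x0 xA]]|[z [z0 zb]]] :=
    IH (A1 - c^-1 *: (A1 *m y *m a0)) (b - (e / c) *: a0).
  left; exists (row_mx (e / c - c^-1 * (x *m (A1 *m y)) 0 0)%:M x).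
  split=> [i|].
    rewrite mxE; case: split_ordP => j _; last exact: x0.
    rewrite ord1 mxE eqxx mulr1n subr_ge0.
    apply: (@le_trans _ _ 0); last by rewrite ltW // nmulr_rgt0 // invr_lt0.
    rewrite nmulr_rle0 ?invr_lt0 // mxE sumr_ge0 // => k _.
    by rewrite mulr_ge0.
  rewrite AE mul_row_col mul_scalar_mx.
  have -> : b = x *m (A1 - c^-1 *: (A1 *m y *m a0)) + (e / c) *: a0.
    by rewrite xA subrK.
  rewrite mulmxBr -scalemxAr !mulmxA.
  set t := (_ *m y) 0 0; have -> : x *m A1 *m y = t%:M by rewrite [LHS]mx11_scalar.
  rewrite mul_scalar_mx scalerBl scalerA.
  by rewrite [RHS]addrC [in RHS]addrCA [RHS]addrC addrC addrCA.
right; set s := (a0 *m z) 0 0.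
have sE : a0 *m z = s%:M by rewrite [LHS]mx11_scalar.
exists (z - (s / c) *: y); split=> [i|].
  rewrite AE mul_col_mx mxE; case: split_ordP => j _.
    rewrite mulmxBr -scalemxAr cE sE ord1 !mxE eqxx !mulr1n mulfVK ?subrr //.
    by rewrite lt_eqF.
  have := z0 j; rewrite mulmxBl -scalemxAl -!mulmxA sE mul_mx_scalar.
  by rewrite mulmxBr -!scalemxAr scalerA mulrC.
move: zb; rewrite mulmxBl -scalemxAl mulmxBr -scalemxAr sE eE !mxE eqxx !mulr1n.
by congr (_ < _); rewrite mulrAC [s / c * e]mulrAC [e * s]mulrC.
Qed.

Definition nonneg (R : realFieldType) k (u : 'cV[R]_k) : Prop := forall i, 0 <= u i 0.

(** * Circuits of a linear subspace *)

Section Cone.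
Variables (R : realFieldType) (N : nat).
Implicit Types (u w : 'cV[R]_N) (L : 'M[R]_N) (C U X : {set 'I_N}) (psi phi : 'rV[R]_N).

Definition supp u : {set 'I_N} := [set i | u i 0 != 0].

(** The ratio test of linear programming: [t] is the largest step from [u] along [w] that stays
    nonnegative. The second hypothesis makes it positive. *)
Lemma perturb u w : (forall i, 0 <= u i 0) ->
  (forall i, u i 0 = 0 -> 0 <= w i 0) -> (exists i, w i 0 < 0) ->
  exists t, [/\ 0 < t, forall i, 0 <= (u + t *: w) i 0 &
    exists i, [/\ w i 0 < 0, u i 0 != 0 & (u + t *: w) i 0 = 0]].
Proof.
move=> u0 uw [i0 wi0].
pose r i := u i 0 / - w i 0.
have [i wi imin] := @arg_minP _ _ _ i0 (fun i => w i 0 < 0) r wi0.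
have ui : u i 0 != 0.
  by apply/eqP=> /uw; rewrite leNgt wi.
have rp : 0 < r i by rewrite divr_gt0 ?oppr_gt0 // lt_neqAle eq_sym ui u0.
have rE j : w j 0 < 0 -> u j 0 + r j * w j 0 = 0.
  by move=> wj; rewrite /r invrN mulrN mulNr mulfVK ?subrr // lt_eqF.
exists (r i); split=> // [j|]; last by exists i; rewrite !mxE rE.
rewrite !mxE; have [wj|wj] := ltP (w j 0) 0.
  rewrite -(rE j wj) lerD2l ler_nM2r //; exact: imin.
by rewrite addr_ge0 // mulr_ge0 // ltW.
Qed.

Definition possupp L C : bool := (C != set0) &&
  `[< exists u, [/\ L *m u = 0, forall i, 0 <= u i 0 & supp u = C] >].

Definition circuit L C : bool := minset (possupp L) C.

Lemma possuppI L u : L *m u = 0 -> (forall i, 0 <= u i 0) -> u != 0 ->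
  possupp L (supp u).
Proof.
move=> Lu u0 un0; apply/andP; split; last by apply/asboolP; exists u.
apply: contra un0 => /eqP s0; apply/eqP/colP=> i; rewrite mxE.
by apply/eqP; have := in_set0 i; rewrite -s0 inE => /negbFE.
Qed.

Lemma possuppP L C : possupp L C -> C != set0 /\
  exists u, [/\ L *m u = 0, forall i, 0 <= u i 0 & supp u = C].
Proof. by case/andP=> ? /asboolP. Qed.

Lemma circuitP L C : circuit L C -> exists u, [/\ L *m u = 0, forall i, 0 <= u i 0,
   supp u = C, u != 0 & forall w, L *m w = 0 -> (forall i, 0 <= w i 0) -> w != 0 ->
     supp w \subset C -> supp w = C].
Proof.
case/minsetP=> /possuppP [C0 [u [Lu u0 su]]] min; exists u; split=> //.
  apply: contra C0 => /eqP u00; rewrite -su u00.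
  by apply/eqP/setP=> i; rewrite !inE mxE eqxx.
by move=> w Lw w0 wn0 wC; apply: min => //; exact: possuppI.
Qed.

(** The ratio test in the direction [- w]. This is the reduction step of the decompositions into
    circuits. *)
Lemma supp_sub_scaled L u w : (forall i, 0 <= u i 0) -> (forall i, 0 <= w i 0) ->
  w != 0 -> supp w \subset supp u -> L *m u = 0 -> L *m w = 0 ->
  exists t, [/\ 0 < t, forall i, 0 <= (u - t *: w) i 0, L *m (u - t *: w) = 0 &
     exists i, [/\ i \in supp w & supp (u - t *: w) \subset supp u :\ i]].
Proof.
move=> u0 w0 wn0 swu Lu Lw.
have [i [j0]] := mx_neq0 wn0; rewrite ord1 => wi.
have wu j : u j 0 = 0 -> w j 0 = 0.
  move=> uj; have := subsetP swu j; rewrite !inE uj eqxx.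
  by case: eqVneq => // _ /(_ isT).
have [j||t [t0 tu [j [wj uj tj]]]] := @perturb u (- w) u0.
- by move=> /wu; rewrite mxE => ->; rewrite oppr0.
- by exists i; rewrite mxE oppr_lt0 lt_neqAle eq_sym wi w0.
exists t; rewrite -scalerN; split=> //.
  by rewrite mulmxDr -scalemxAr mulmxN Lu Lw oppr0 scaler0 addr0.
exists j; split.
  by rewrite inE; apply/eqP=> wj0; rewrite mxE wj0 oppr0 ltxx in wj.
apply/subsetP=> l; rewrite !inE => ul; apply/andP; split.
  by apply: contraNneq ul => ->; rewrite tj.
by apply: contraNneq ul => ul; rewrite !mxE ul wu // oppr0 mulr0 addr0.
Qed.

(** A circuit inside [supp u] that avoids v is subtracted from [u]: the support shrinks while the
    coordinate at v is unchanged. *)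
Lemma circuit_through L u v : L *m u = 0 -> (forall i, 0 <= u i 0) ->
  v \in supp u -> exists C, [/\ circuit L C, C \subset supp u & v \in C].
Proof.
have [n] := ubnP #|supp u|; elim: n u => // n IH u /ltnSE un Lu u0 vu.
have un0 : u != 0.
  by apply: contraTneq vu => ->; rewrite inE mxE eqxx.
have [C CL Cu] := minset_exists (possuppI Lu u0 un0).
have [vC|vC] := boolP (v \in C); first by exists C.
have [w [Lw w0 sw wn0 _]] := circuitP CL.
have swu : supp w \subset supp u by rewrite sw.
have [t [t0 tu Lt [i [iw su]]]] := supp_sub_scaled u0 w0 wn0 swu Lu Lw.
have iu := subsetP swu _ iw.
have [|//|//||C' [C'L C'u vC']] := IH (u - t *: w).
- apply: leq_trans un; rewrite (cardsD1 i (supp u)) iu ltnS.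
  exact: subset_leq_card.
- have : v \notin supp w by rewrite sw.
  by rewrite !inE negbK in vu * => /eqP wv; rewrite !mxE wv mulr0 subr0.
exists C'; split=> //; apply: subset_trans C'u (subset_trans su _).
exact: subsetDl.
Qed.

End Cone.

(** * Gale diagrams and vertex figures *)

Section Gale.
Variables (R : realFieldType) (N : nat).
Implicit Types (u : 'cV[R]_N) (L : 'M[R]_N) (C U X : {set 'I_N}) (phi : 'rV[R]_N).

Definition positives U phi : {set 'I_N} := [set i in U | 0 < phi 0 i].

(* The first clause says that every element of U is a vertex of the polytope with
   Gale dual L, the second one that no element of U is the apex of a pyramid. *)
Definition gale L U : Prop :=
  (forall phi, (phi <= L)%MS -> phi != 0 -> (1 < #|positives U phi|)%N) /\
  (forall i, i \in U -> exists2 phi : 'rV[R]_N, (phi <= L)%MS & phi 0 i != 0).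

Definition circuits L U : {set {set 'I_N}} :=
  [set C : {set 'I_N} | (C \subset U) && circuit L C].

Definition nbrs L U v : {set 'I_N} := [set w in U | (w != v) &&
  `[< exists2 phi : 'rV[R]_N, (phi <= L)%MS & positives U phi = [set v; w] >]].

Lemma orthoP L u : (forall phi, (phi <= L)%MS -> phi *m u = 0) <-> L *m u = 0.
Proof.
split=> [Lu|Lu phi /submxP[D ->]]; last by rewrite -mulmxA Lu mulmx0.
by apply/row_matrixP=> i; rewrite row_mul row0 Lu // row_sub.
Qed.

Lemma dotE phi u : (phi *m u) 0 0 = \sum_i phi 0 i * u i 0.
Proof. by rewrite mxE. Qed.

(** In terms of P, some facet contains W and misses v. Farkas' lemma leaves one alternative: a
    combination of the rows of [L] that is negative at v and nonpositive on the rest of U outside W,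
    hence positive on at most one element of U. *)
Lemma circuit_avoid L U v (W : {set 'I_N}) : gale L U -> v \in U ->
  v \notin W -> (#|W| <= 1)%N ->
  exists C, [/\ C \in circuits L U, v \in C & [disjoint C & W]].
Proof.
move=> [gL _] vU vW W1; pose S := U :\: (v |: W).
pose A := \matrix_(i, j) if i \in S then L j i else 0.
have [[x [x0 xA]]|[y [y0 yb]]] := farkas A (- (col v L)^T).
  pose u : 'cV[R]_N := delta_mx v 0 + \col_i if i \in S then x 0 i else 0.
  have vS : v \notin S by rewrite !inE eqxx.
  have u0 i : 0 <= u i 0.
    by rewrite !mxE addr_ge0 ?ler0n //; case: ifP.
  have Lu : L *m u = 0.
    rewrite mulmxDr -colE; apply/colP=> i; have /rowP/(_ i) := xA.
    rewrite !mxE => /eqP; rewrite -addr_eq0 => /eqP E; rewrite -[RHS]E addrC.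
    congr (_ + _); apply: eq_bigr => j _; rewrite !mxE.
    by case: ifP; rewrite ?mulr0 // mulrC.
  have vu : v \in supp u by rewrite inE !mxE !eqxx (negPf vS) addr0 oner_eq0.
  have su : supp u \subset U :\: W.
    apply/subsetP=> i; rewrite !inE !mxE.
    have [->|iv] := eqVneq i v; first by rewrite vU vW.
    by rewrite add0r; case: ifP; rewrite ?eqxx // !inE (negPf iv) => ->.
  have [C [CL Cu vC]] := circuit_through Lu u0 vu.
  have CUW := subset_trans Cu su; exists C; split=> //.
    by rewrite inE CL (subset_trans CUW) // subsetDl.
  by move: CUW; rewrite subsetD => /andP[].
pose phi := - (y^T *m L^T^T).
have phiE i : phi 0 i = - \sum_j L j i * y j 0.
  by rewrite !mxE; congr (- _); apply: eq_bigr => j _; rewrite !mxE mulrC.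
have phiL : (phi <= L)%MS by rewrite /phi trmxK -mulNmx submxMl.
have phiS i : i \in S -> phi 0 i <= 0.
  move=> iS; rewrite phiE oppr_le0; have := y0 i; rewrite mxE.
  by congr (_ <= _); apply: eq_bigr => j _; rewrite mxE iS.
have phiv : phi 0 v < 0.
  rewrite phiE; move: yb; rewrite mxE -sumrN; congr (_ < _).
  by apply: eq_bigr => j _; rewrite !mxE mulNr.
have phi0 : phi != 0.
  by apply: contraTneq phiv => ->; rewrite mxE ltxx.
have := gL _ phiL phi0; rewrite ltnNge; case/negP.
apply: leq_trans W1; apply/subset_leq_card/subsetP=> i; rewrite inE => /andP[iU ip].
apply: contraLR ip => iW; rewrite -leNgt.
have [->|iv] := eqVneq i v; first exact: ltW.
by apply: phiS; rewrite !inE (negPf iv) (negPf iW) iU.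
Qed.

(** A circuit C1 through v is not just [[set v]], as v is not an apex. A circuit through v that
    avoids another element w of C1 is a second one. *)
Lemma circuits_through2 L U v : gale L U -> v \in U ->
  (1 < #|[set C in circuits L U | v \in C]|)%N.
Proof.
move=> gLU vU.
have [||C1 [C1L vC1 _]] := @circuit_avoid L U v set0 gLU vU; rewrite ?inE ?cards0 //.
have [w wC1 wv] : exists2 w, w \in C1 & w != v.
  apply/exists_inP; apply: contraT => /exists_inPn C1v.
  have C1E : C1 = [set v].
    apply/setP=> i; rewrite inE; apply/idP/eqP=> [iC|-> //].
    by apply/eqP; have := C1v i iC; rewrite negbK.
  move: C1L; rewrite inE => /andP[_ /circuitP[u [Lu _ su _ _]]].
  have [phi phiL phiv] := gLU.2 v vU.
  have : (phi *m u) 0 0 = 0 by rewrite (orthoP L u).2 // mxE.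
  rewrite dotE (bigD1 v) //= big1 ?addr0 => [/eqP|i iv].
    rewrite mulf_eq0 (negPf phiv) /= => uv.
    by have := set11 v; rewrite -C1E -su inE uv.
  have : i \notin supp u by rewrite su C1E inE.
  by rewrite inE negbK => /eqP->; rewrite mulr0.
have [||C2 [C2L vC2 C2w]] := @circuit_avoid L U v [set w] gLU vU.
- by rewrite inE eq_sym.
- by rewrite cards1.
have wC2 : w \notin C2 by move: C2w; rewrite disjoint_sym disjoints1.
have C12 : C1 != C2 by apply: contraNneq wC2 => <-.
apply: (@leq_trans #|[set C1; C2]|); first by rewrite cards2 C12.
by apply/subset_leq_card/subsetP=> C /set2P[]->; rewrite inE ?C1L ?C2L.
Qed.

Lemma nbrs_sym L U v w : v \in U -> w \in nbrs L U v -> v \in nbrs L U w.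
Proof.
move=> vU; rewrite !inE => /and3P[wU wv /asboolP[phi phiL p]].
rewrite vU eq_sym wv; apply/asboolP; exists phi => //.
by rewrite p setUC.
Qed.

Lemma positives_le1 phi : phi != 0 -> (#|positives setT phi| <= 1)%N ->
  exists i, forall j, j != i -> phi 0 j <= 0.
Proof.
move=> phi0; rewrite leq_eqVlt ltnS leqn0 => /orP[/cards1P[i iE]|].
  by exists i => j; rewrite -in_set1 -iE inE in_setT leNgt.
rewrite cards_eq0 => /eqP e0; have [_ [i _]] := mx_neq0 phi0.
exists i => j _; rewrite leNgt; apply/negP=> pj.
by have := in_set0 j; rewrite -e0 inE in_setT pj.
Qed.

Lemma positives_pair U phi v w : v \in U -> w \in U -> positives U phi = [set v; w] ->
  [/\ 0 < phi 0 v, 0 < phi 0 w &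
      forall i, i \in U -> i != v -> i != w -> phi 0 i <= 0].
Proof.
move=> vU wU p.
have iE i : i \in U -> (0 < phi 0 i) = (i == v) || (i == w).
  by move=> iU; have := in_set2 i v w; rewrite -p inE iU.
split=> [||i iU iv iw]; rewrite ?iE ?eqxx ?orbT //.
by rewrite leNgt iE // negb_or iv.
Qed.

Lemma nbrs_elim L U v (s : seq 'I_N) : gale L U -> v \in U ->
  {subset s <= nbrs L U v} ->
  exists psi : 'I_N -> 'rV[R]_N, forall x, x \in nbrs L U v ->
   [/\ (psi x <= L)%MS, 0 < psi x 0 x, 0 < psi x 0 v,
     forall i, i \in U -> i != v -> i != x -> psi x 0 i <= 0 &
     forall z, z \in s -> z != x -> psi x 0 z = 0].
Proof.
move=> gLU vU; elim: s => [_|z0 s IH sX].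
  suff /choice[psi] : forall x, exists p : 'rV[R]_N, x \in nbrs L U v ->
     [/\ (p <= L)%MS, 0 < p 0 x, 0 < p 0 v &
     forall i, i \in U -> i != v -> i != x -> p 0 i <= 0].
    by move=> psiP; exists psi => x /psiP[].
  move=> x.
  have [|] := boolP (x \in nbrs L U v); last by exists 0.
  rewrite inE => /and3P[xU xv /asboolP[phi phiL /(positives_pair vU xU)[]]].
  by exists phi.
have [|psi psiP] := IH; first by move=> z zs; apply: sX; rewrite inE zs orbT.
have z0X : z0 \in nbrs L U v by apply: sX; rewrite inE eqxx.
have [z0L z0z z0v z0U z0s] := psiP z0 z0X.
have z0U' : z0 \in U by move: z0X; rewrite inE => /andP[].
have z0v' : z0 != v by move: z0X; rewrite inE => /and3P[].
exists (fun x => if x == z0 then psi z0 else psi x - (psi x 0 z0 / psi z0 0 z0) *: psi z0).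
move=> x xX; have [->|xz] := eqVneq x z0.
  split=> // z; rewrite inE => /predU1P[->|]; first by rewrite eqxx.
  exact: z0s.
have [xL xx xv xU' xs] := psiP x xX.
have xU : x \in U by move: xX; rewrite inE => /andP[].
set p := psi x - _.
have pL : (p <= L)%MS by rewrite addmx_sub // eqmx_opp scalemx_sub.
(* The coefficient is nonpositive, so a nonnegative multiple of [psi z0] is added: v can only gain,
   the other coordinates stay nonpositive, and x is the only one whose sign is in danger. *)
have c0 : psi x 0 z0 / psi z0 0 z0 <= 0.
  by rewrite pmulr_lle0 ?invr_gt0 // xU' // eq_sym.
have pv : 0 < p 0 v by rewrite !mxE subr_gt0 (le_lt_trans _ xv) // mulr_le0_ge0 // ltW.
have pU i : i \in U -> i != v -> i != x -> p 0 i <= 0.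
  move=> iU iv ix; rewrite !mxE; have [->|iz] := eqVneq i z0.
    by rewrite mulfVK ?subrr // gt_eqF.
  by rewrite subr_le0 (le_trans (xU' _ iU iv ix)) // mulr_le0 // z0U.
split=> //.
  rewrite ltNge; apply/negP => px.
  have p0 : p != 0 by apply: contraTneq pv => ->; rewrite mxE ltxx.
  have := gLU.1 _ pL p0; rewrite ltnNge => /negP; apply.
  rewrite -(cards1 v); apply/subset_leq_card/subsetP=> i.
  rewrite !inE => /andP[iU]; apply: contraLR => iv; rewrite -leNgt.
  by have [->|] := eqVneq i x; [|exact: pU].
move=> z; rewrite inE => /predU1P[->|zs] zx; rewrite !mxE.
  by rewrite mulfVK ?subrr // gt_eqF.
have [->|zz] := eqVneq z z0; first by rewrite mulfVK ?subrr // gt_eqF.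
by rewrite (xs z) // (z0s z) // mulr0 subrr.
Qed.

(** Dual to the coordinates in X, which are therefore linearly independent on the row space of [L].
    The sign condition makes lifted vectors nonnegative in [circuit_lift]. *)
Definition dual_basis L U v (psi : 'I_N -> 'rV[R]_N) : Prop :=
  forall x, x \in nbrs L U v ->
   [/\ (psi x <= L)%MS, forall z, z \in nbrs L U v -> psi x 0 z = (z == x)%:R &
     forall i, i \in U -> i != v -> i \notin nbrs L U v -> psi x 0 i <= 0].

(* Gaussian elimination on the functionals witnessing the neighbours of v: a
   pivot cannot lose its sign, since then v would be the only positive coordinate. *)
Lemma nbrs_dual L U v : gale L U -> v \in U -> exists psi, dual_basis L U v psi.
Proof.
move=> gLU vU; have [|psi psiP] := @nbrs_elim L U v (enum (nbrs L U v)) gLU vU.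
  by move=> z; rewrite mem_enum.
exists (fun x => (psi x 0 x)^-1 *: psi x) => x xX.
have [xL xx xv xU xs] := psiP x xX; split=> [|z zX|i iU iv iX].
- exact: scalemx_sub.
- rewrite mxE; have [->|zx] := eqVneq z x; first by rewrite mulVf // gt_eqF.
  by rewrite (xs z) ?mulr0 // mem_enum.
- rewrite mxE pmulr_rle0 ?invr_gt0 // xU //.
  by apply: contraNneq iX => ->.
Qed.

Lemma dot_nonpos phi u C : (forall i, 0 <= u i 0) -> supp u = C ->
  (forall i, i \in C -> phi 0 i <= 0) ->
  (phi *m u) 0 0 <= 0 /\
  ((phi *m u) 0 0 != 0) = [exists i in C, phi 0 i != 0].
Proof.
move=> u0 su phiC.
have t0 i : 0 <= - (phi 0 i * u i 0).
  rewrite oppr_ge0; have [iC|] := boolP (i \in C).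
    by rewrite mulr_le0_ge0 // phiC.
  by rewrite -su inE negbK => /eqP ->; rewrite mulr0.
have E : (phi *m u) 0 0 = - \sum_i - (phi 0 i * u i 0).
  by rewrite dotE sumrN opprK.
rewrite E oppr_le0 sumr_ge0 //; split=> //; rewrite oppr_eq0 psumr_neq0 //.
apply/hasP/exists_inP => [[i _]|[i iC phii]]; last first.
  exists i; rewrite ?mem_index_enum //= lt_neqAle t0 eq_sym oppr_eq0 mulf_neq0 //.
  by move: iC; rewrite -su inE.
rewrite /= lt_neqAle eq_sym oppr_eq0 mulf_eq0 negb_or => /andP[/andP[a b] _].
by exists i => //; rewrite -su inE.
Qed.

(** * Contraction of the neighbours of v: the vertex figure *)

Section Contract.
Variables (L : 'M[R]_N) (U : {set 'I_N}) (v : 'I_N) (psi : 'I_N -> 'rV[R]_N).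
Hypotheses (gLU : gale L U) (vU : v \in U) (psiP : dual_basis L U v psi).
Let X := nbrs L U v.

Definition coord_mx (Z : {set 'I_N}) : 'M[R]_(N, #|Z|) :=
  \matrix_(i, j) (i == enum_val j)%:R.

Lemma coord_mxE phi Z j : (phi *m coord_mx Z) 0 j = phi 0 (enum_val j).
Proof.
rewrite mxE (bigD1 (enum_val j)) //= mxE eqxx mulr1 big1 ?addr0 // => i ij.
by rewrite mxE (negPf ij) mulr0.
Qed.

(** Only X is contracted here; v is deleted by leaving it out of the index set [W], so that all
    matrices keep the size N. *)
Definition contract : 'M[R]_N := (L :&: kermx (coord_mx X))%MS.

Lemma sub_contract phi : (phi <= contract)%MS =
  (phi <= L)%MS && [forall x in X, phi 0 x == 0].
Proof.
rewrite sub_capmx; congr (_ && _); apply/sub_kermxP/forall_inP => [p0 x xX|p0].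
  by rewrite -(enum_rankK_in xX xX) -coord_mxE p0 mxE.
by apply/rowP=> j; rewrite coord_mxE mxE; apply/eqP/p0/enum_valP.
Qed.

Lemma sub_contractE phi : (phi <= L)%MS ->
  (phi - \sum_(x in X) phi 0 x *: psi x <= contract)%MS.
Proof.
move=> pL; rewrite sub_contract; apply/andP; split.
  rewrite addmx_sub // eqmx_opp summx_sub // => x xX.
  by case: (psiP xX) => xL _ _; rewrite scalemx_sub.
apply/forall_inP=> z zX; rewrite !mxE summxE (bigD1 z) //= big1 => [|x /andP[xX xz]].
  by rewrite mxE; case: (psiP zX) => _ -> // _; rewrite eqxx mulr1 addr0 subrr.
by rewrite mxE; case: (psiP xX) => _ -> // _; rewrite eq_sym (negPf xz) mulr0.
Qed.

(** Rank-nullity for the coordinates in X: [psi] shows that they map the row space of [L] onto a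
    space of dimension [#|X|]. *)
Lemma rank_contract : (\rank contract + #|X| <= \rank L)%N.
Proof.
rewrite -(mxrank_mul_ker L (coord_mx X)) addnC leq_add2r.
pose B := \matrix_(j < #|X|) psi (enum_val j).
have rB : \rank (B *m coord_mx X) = #|X|.
  suff -> : B *m coord_mx X = 1%:M by rewrite mxrank1.
  apply/row_matrixP=> i; apply/rowP=> j.
  rewrite row_mul rowK coord_mxE; case: (psiP (enum_valP i)) => _ -> // => [_|].
    by rewrite !mxE (inj_eq enum_val_inj) eq_sym.
  exact: enum_valP.
rewrite -[X in (X <= _)%N]rB; apply: mxrankS; apply: submxMr; apply/row_subP=> i.
rewrite rowK.
by case: (psiP (enum_valP i)).
Qed.

Let W := U :\: (v |: X).

Let WP i : i \in W -> [/\ i \in U, i != v & i \notin X].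
Proof. by rewrite in_setD in_setU1 negb_or => /andP[/andP[-> ->] ->]. Qed.

(** The support of the only vector in the kernel of [L] that agrees outside X with a given [u] of
    support C in the kernel of the contraction: its coordinate at x is minus the product of [psi x]
    and [u]. *)
Definition lift_supp C := C :|: [set x in X | [exists w in C, psi x 0 w != 0]].

Lemma in_lift_supp C i : (i \in lift_supp C) =
  (i \in C) || (i \in X) && [exists w in C, psi i 0 w != 0].
Proof. by rewrite in_setU; congr (_ || _); rewrite [LHS]inE. Qed.

(** Facets of the vertex figure come from facets through v. The lift [q] of [u] is nonnegative
    because [psi x] is nonpositive on W. For minimality, erase the X-coordinates of a vector [p]
    with support inside the lift: the result [p'] lies in the kernel of the contraction, so its
    support is all of C, and [p] is recovered from [p']. *)
Lemma circuit_lift C : C \subset W -> circuit contract C -> circuit L (lift_supp C).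
Proof.
move=> CW CL; have [u [Lu u0 su un0 umin]] := circuitP CL.
have CX i : i \in C -> i \notin X by move/(subsetP CW)/WP=> [].
have psiC x i : x \in X -> i \in C -> psi x 0 i <= 0.
  by move=> xX /(subsetP CW)/WP[iU iv iX]; case: (psiP xX) => _ _; apply.
pose q : 'cV[R]_N := u - \sum_(x in X) (psi x *m u) 0 0 *: delta_mx x 0.
have qE i : q i 0 = if i \in X then - (psi i *m u) 0 0 else u i 0.
  rewrite !mxE summxE; case: ifP => iX.
    rewrite (bigD1 i) //= big1 => [|x /andP[_ xi]]; last first.
      by rewrite !mxE eq_sym (negPf xi) mulr0.
    have : i \notin supp u by rewrite su; apply: contraL iX => /CX.
    rewrite inE negbK => /eqP->.
    by rewrite !mxE !eqxx mulr1 addr0 sub0r.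
  rewrite big1 ?subr0 // => x xX; rewrite !mxE.
  by case: eqVneq iX xX => [->->|] //; rewrite mulr0.
have q0 i : 0 <= q i 0.
  rewrite qE; case: ifP => // iX; rewrite oppr_ge0.
  by case: (@dot_nonpos (psi i) u C) => // j; exact: psiC.
have Lq : L *m q = 0.
  apply/orthoP=> phi pL; have := (orthoP contract u).2 Lu _ (sub_contractE pL).
  rewrite mulmxBl mulmxBr mulmx_suml mulmx_sumr => E; rewrite -[RHS]E; congr (_ - _).
  apply: eq_bigr => x _; rewrite -scalemxAl -scalemxAr -colE.
  rewrite [psi x *m u]mx11_scalar; apply/rowP=> j; rewrite ord1 !mxE eqxx mulr1n.
  by rewrite mulrC.
have sq : supp q = lift_supp C.
  apply/setP=> i; rewrite [LHS]inE in_lift_supp qE; case: ifP => iX.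
    have -> : (i \in C) = false by apply: contraTF iX => /CX.
    rewrite oppr_eq0 /=.
    by case: (@dot_nonpos (psi i) u C) => // j; exact: psiC.
  by rewrite orbF -su inE.
apply/minsetP; split.
  rewrite -sq; apply: possuppI => //; apply: contraNneq un0 => q00.
  apply/eqP/colP=> i; rewrite mxE; apply/eqP; apply: contraT => ui.
  have iC : i \in C by rewrite -su inE.
  by have := qE i; rewrite (negPf (CX _ iC)) q00 mxE => ui0; rewrite -ui0 eqxx in ui.
move=> B /possuppP[B0 [p [Lp p0 sp]]] BC.
pose p' : 'cV[R]_N := \col_i if i \in C then p i 0 else 0.
have pE : p = p' + \sum_(x in X) p x 0 *: delta_mx x 0.
  apply/colP=> i; rewrite !mxE summxE; case: ifP => iC.
    rewrite big1 ?addr0 // => x xX; rewrite !mxE.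
    by case: eqVneq (CX _ iC) xX => [->/negPf->|] //; rewrite mulr0.
  rewrite add0r; have [iX|iX] := boolP (i \in X).
    rewrite (bigD1 i) //= big1 => [|x /andP[_ xi]]; last first.
      by rewrite !mxE eq_sym (negPf xi) mulr0.
    by rewrite !mxE !eqxx mulr1 addr0.
  rewrite big1 => [|x xX].
    have : i \notin supp p.
      by rewrite sp; apply/negP=> /(subsetP BC); rewrite in_lift_supp iC (negPf iX).
    by rewrite inE negbK => /eqP.
  by rewrite !mxE; case: eqVneq iX xX => [->/negPf->|] //; rewrite mulr0.
have dotp' phi : (phi *m p) 0 0 = (phi *m p') 0 0 + \sum_(x in X) p x 0 * phi 0 x.
  rewrite {1}pE mulmxDr mulmx_sumr mxE summxE; congr (_ + _).
  by apply: eq_bigr => x _; rewrite -scalemxAr -colE !mxE.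
have p'0 i : 0 <= p' i 0 by rewrite mxE; case: ifP.
have Lp' : contract *m p' = 0.
  apply/orthoP=> phi; rewrite sub_contract => /andP[pL /forall_inP pX].
  apply/rowP=> j; rewrite ord1; have := dotp' phi.
  rewrite (orthoP L p).2 // mxE big1 ?addr0 => [<-|x /pX/eqP->].
    by [].
  by rewrite mulr0.
have psip x : x \in X -> p x 0 = - (psi x *m p') 0 0.
  move=> xX; have := dotp' (psi x); case: (psiP xX) => xL xX' _.
  rewrite (orthoP L p).2 // mxE (bigD1 x) //= big1 => [|z /andP[zX zx]]; last first.
    by rewrite xX' // (negPf zx) mulr0.
  by rewrite xX' // eqxx mulr1 addr0 => /eqP; rewrite addrC eq_sym addr_eq0 => /eqP.
have p'n0 : p' != 0.
  apply: contra B0 => /eqP p'00; rewrite -sp; apply/eqP/setP=> i; rewrite !inE.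
  apply/negbF/eqP; rewrite pE p'00 add0r summxE big1 // => x xX.
  by rewrite psip // p'00 mulmx0 [in X in - X]mxE oppr0 scale0r mxE.
have sp' : supp p' = C.
  apply: umin => //; apply/subsetP=> i; rewrite inE mxE.
  by case: ifP; rewrite ?eqxx.
apply/eqP; rewrite eqEsubset BC; apply/subsetP=> i; rewrite -sp in_lift_supp => /orP[iC|].
  have : i \in supp p' by rewrite sp'.
  by rewrite !inE mxE iC.
case/andP=> iX h; rewrite inE psip // oppr_eq0.
by case: (@dot_nonpos (psi i) p' C) => // [j|_ -> //]; exact: psiC.
Qed.

(** The set Y of apexes of the vertex figure: y is a zero vector of the contracted Gale diagram,
    that is, it lies in the span of X in the original one. *)
Definition spanned : {set 'I_N} := [set y in W | `[< forall phi, (phi <= contract)%MS -> phi 0 y = 0 >]].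

Lemma coord_spanned y phi : (forall phi, (phi <= contract)%MS -> phi 0 y = 0) ->
  (phi <= L)%MS -> phi 0 y = \sum_(x in X) phi 0 x * psi x 0 y.
Proof.
move=> yY pL; have := yY _ (sub_contractE pL).
rewrite !mxE summxE => /eqP; rewrite subr_eq0 => /eqP->.
by apply: eq_bigr => x _; rewrite mxE.
Qed.

Lemma spannedP y : y \in spanned -> y \in W /\ (forall phi, (phi <= contract)%MS -> phi 0 y = 0).
Proof. by rewrite inE => /andP[yW /asboolP]. Qed.

Lemma circuit_spanned y : y \in spanned -> circuit contract [set y].
Proof.
case/spannedP=> yW y0; apply/minsetP; split; last first.
  by move=> B /possuppP[B0 _]; rewrite subset1 (negPf B0) orbF => /eqP.
have -> : [set y] = supp (delta_mx y 0 : 'cV[R]_N).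
  apply/setP=> i; rewrite !inE !mxE eqxx andbT.
  by case: eqVneq; rewrite ?oner_eq0 ?eqxx.
apply: possuppI => [|i|].
- by apply/orthoP=> phi pL; rewrite -colE; apply/rowP=> i; rewrite !mxE y0.
- by rewrite mxE ler0n.
- by apply/eqP=> /colP/(_ y)/eqP; rewrite !mxE !eqxx oner_eq0.
Qed.

(** A dependence [phi] vanishing on X and on Y has at least two positive coordinates in U. If only
    one of them, w, were left after deleting v, [phi] would be positive exactly on v and w, so w
    would belong to X. *)
Lemma gale_contract : gale contract (W :\: spanned).
Proof.
split=> [phi pL pn0|i]; last first.
  rewrite inE => /andP[iY iW]; move: iY; rewrite inE iW /= => /asboolPn h.
  apply: contrapT => nh; apply: h => phi pL; apply/eqP; apply: contraT => pi.
  by case: nh; exists phi.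
have := pL; rewrite sub_contract => /andP[pL1 /forall_inP pX].
rewrite ltnNge; apply/negP => le1.
have P2 := gLU.1 _ pL1 pn0.
have PW : positives U phi \subset v |: positives (W :\: spanned) phi.
  apply/subsetP=> i; rewrite inE => /andP[iU pi]; rewrite in_setU1 inE pi andbT.
  case: eqVneq => //= iv; have iW : i \in W.
    rewrite in_setD in_setU1 (negPf iv) iU andbT /=.
    by apply: contraL pi => /pX/eqP->; rewrite ltxx.
  rewrite inE iW andbT; apply: contraL pi => /spannedP[_ ->//]; by rewrite ltxx.
have [w PE] : exists w, positives (W :\: spanned) phi = [set w].
  apply/cards1P; rewrite eqn_leq le1 lt0n; apply/negP=> /eqP c0.
  move: P2; rewrite ltnNge => /negP; apply.
  by rewrite (leq_trans (subset_leq_card PW)) // cardsU1 c0 addn0 leq_b1.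
have PE2 : positives U phi = [set v; w].
  apply/eqP; rewrite eqEcard -PE PW /= (leq_trans _ P2) // PE cards2.
  by case: eqP.
have : w \in positives (W :\: spanned) phi by rewrite PE inE.
rewrite inE => /andP[/setDP[/WP[wU wv wX] _] _].
by case/negP: wX; rewrite inE wU wv; apply/asboolP; exists phi.
Qed.

(** The 2 counts circuits through v. The others are lifts, which avoid v: of the singletons of Y and
    of the circuits inside W minus Y. Lifting is injective because removing X undoes it. *)
Lemma card_circuits_contract :
  (2 + #|spanned| + #|circuits contract (W :\: spanned)| <= #|circuits L U|)%N.
Proof.
have -> : #|circuits L U| = (#|[set C in circuits L U | v \in C]| +
   #|[set C in circuits L U | v \notin C]|)%N.
  rewrite -(cardsID [set C : {set 'I_N} | v \in C]); congr (_ + _)%N.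
    by congr #|pred_of_set _|; apply/setP=> C; rewrite !inE.
  by congr #|pred_of_set _|; apply/setP=> C; rewrite !inE andbC.
rewrite -addnA leq_add ?circuits_through2 //.
pose D := [set [set y] | y in spanned] :|: circuits contract (W :\: spanned).
have -> : (#|spanned| + #|circuits contract (W :\: spanned)| = #|D|)%N.
  rewrite cardsU disjoint_setI0 ?cards0 ?subn0 ?card_imset //; first exact: set1_inj.
  rewrite -setI_eq0; apply/eqP/setP=> C; rewrite !inE; apply/negP.
  case/andP=> /imsetP[y yY ->] /andP[]; rewrite sub1set inE yY //.
have DP C : C \in D -> C \subset W /\ circuit contract C.
  rewrite in_setU => /orP[/imsetP[y yY ->]|].
    by rewrite sub1set circuit_spanned //; case: (spannedP yY).
  rewrite inE => /andP[CW ->]; split=> //; apply: subset_trans CW _.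
  exact: subsetDl.
rewrite -(card_in_imset (f := lift_supp) (D := D)); last first.
  have K C : C \in D -> lift_supp C :\: X = C.
    case/DP=> CW _; apply/setP=> i; rewrite in_setD in_lift_supp.
    have [iC|iC] := boolP (i \in C); first by case/WP: (subsetP CW _ iC) => _ _ ->.
    by case: (i \in X).
  by move=> C1 C2 /K {2}<- /K {2}<- ->.
apply/subset_leq_card/subsetP=> _ /imsetP[C /DP[CW CL] ->].
rewrite inE [X in X && _]inE circuit_lift // andbT.
have vW : v \notin W by rewrite in_setD in_setU1 eqxx.
have vX : v \notin X by rewrite inE eqxx andbF.
apply/andP; split; last first.
  by rewrite in_lift_supp negb_or (negPf vX) andbT; apply: contra vW => /(subsetP CW).
apply/subsetP=> i; rewrite in_lift_supp => /orP[/(subsetP CW)/WP[]//|].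
by case/andP; rewrite inE => /andP[].
Qed.

End Contract.
End Gale.

(** * Counting circuits *)

Lemma card_bigcup_le (I T : finType) (P : {set I}) (F : I -> {set T}) m :
  (forall i, i \in P -> #|F i| <= m)%N -> (#|\bigcup_(i in P) F i| <= m * #|P|)%N.
Proof.
move=> Fm; apply: (@leq_trans (\sum_(i in P) #|F i|)%N).
  elim/big_rec2: _ => [|i a b _ ab]; first by rewrite cards0.
  by rewrite cardsU (leq_trans (leq_subr _ _)) // leq_add2l.
by rewrite mulnC -sum_nat_const leq_sum.
Qed.

Section Count.
Variables (R : realFieldType) (N : nat).
Implicit Types (L : 'M[R]_N) (U X T : {set 'I_N}) (phi : 'rV[R]_N).

(** The elements of T are independent, being neighbours of z, and lie in the span of X: the identity
    matrix of size [#|T|] factors through dimension [#|X|]. *)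
Lemma card_nbrs_spanned L U v z T (psi : 'I_N -> 'rV[R]_N) :
  gale L U -> v \in U -> dual_basis L U v psi -> z \in U ->
  T \subset nbrs L U z ->
  (forall t phi, t \in T -> (phi <= L)%MS ->
     phi 0 t = \sum_(x in nbrs L U v) phi 0 x * psi x 0 t) ->
  (#|T| <= #|nbrs L U v|)%N.
Proof.
move=> gLU vU psiP zU Tz TX; set X := nbrs L U v in TX *.
have [chi chiP] := nbrs_dual gLU zU.
pose A := \matrix_(i < #|T|, j < #|X|) chi (enum_val i) 0 (enum_val j).
pose B := \matrix_(j < #|X|, k < #|T|) psi (enum_val j) 0 (enum_val k).
have AB : A *m B = 1%:M.
  apply/matrixP=> i k; rewrite !mxE.
  have [iz kz] := (subsetP Tz _ (enum_valP i), subsetP Tz _ (enum_valP k)).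
  have [cL cz _] := chiP _ iz.
  rewrite -(inj_eq enum_val_inj) eq_sym -cz // (TX _ _ (enum_valP k) cL).
  by rewrite [RHS]big_enum_val; apply: eq_bigr => j _; rewrite !mxE.
by rewrite -(mxrank1 R #|T|) -AB (leq_trans (mxrankM_maxl _ _)) // rank_leq_col.
Qed.

Lemma card_spanned L U v psi : gale L U -> v \in U -> dual_basis L U v psi ->
  L != 0 ->
  (forall w, w \in U -> #|nbrs L U v| <= #|nbrs L U w|)%N ->
  (#|spanned L U v| < 3 * #|nbrs L U v| + (contract L U v != 0)%R)%N.
Proof.
move=> gLU vU psiP Ln0 vmin; set X := nbrs L U v in vmin *.
(* If X is empty, so is Y, and the contraction is all of [L]; the claim reads 0 < 0 + 1. *)
have [X0|[x0 x0X]] := set_0Vmem X.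
  have Y0 : spanned L U v = set0.
    apply/setP=> y; rewrite [RHS]inE; apply/negP=> /spannedP[yW y0].
    have [phi pL /eqP[]] := gLU.2 y (subsetP (subsetDl _ _) _ yW).
    rewrite (coord_spanned psiP y0) // big1 // => x.
    by rewrite [nbrs _ _ _]X0 inE.
  have -> : contract L U v != 0.
    suff LE : (L <= contract L U v)%MS.
      by apply: contraNneq Ln0 => c0; rewrite c0 submx0 in LE.
    apply/row_subP=> i; rewrite sub_contract row_sub /=.
    by apply/forall_inP=> x; rewrite [nbrs _ _ _]X0 inE.
  by rewrite Y0 cards0 addn1.
pose Y := spanned L U v.
have YU y : y \in Y -> [/\ y \in U, y != v & y \notin X].
  by case/spannedP; rewrite in_setD in_setU1 negb_or => /andP[/andP[-> ->] ->].
have YE y phi : y \in Y -> (phi <= L)%MS ->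
    phi 0 y = \sum_(x in X) phi 0 x * psi x 0 y.
  by case/spannedP=> _ y0 pL; exact: coord_spanned.
(* The y whose expansion over X involves x; all coefficients of such expansions are nonpositive. *)
pose D x := [set y in Y | psi x 0 y != 0].
pose A := \bigcup_(x in [set x in X | #|D x| <= 2]%N) D x.
pose B := [set y in Y | nbrs L U y == X].
have YAB : Y \subset A :|: B.
  apply/subsetP=> y yY; rewrite in_setU; have [yU yv yX] := YU y yY.
  have [yB|yB] := boolP (y \in B); first by rewrite orbT.
  rewrite orbF.
  have [w wy wX] : exists2 w, w \in nbrs L U y & w \notin X.
    apply/exists_inP; apply: contraNT yB => /exists_inPn yX'.
    rewrite inE yY eqEcard vmin // andbT; apply/subsetP=> w /yX'.
    by rewrite negbK.
  have wU : w \in U by move: wy; rewrite inE => /andP[].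
  have [phi pL pyw] : exists2 phi : 'rV[R]_N, (phi <= L)%MS & positives U phi = [set y; w].
    by move: wy; rewrite inE => /and3P[_ _ /asboolP].
  have [py pw pU] := positives_pair yU wU pyw.
  have pX x : x \in X -> phi 0 x <= 0.
    move=> xX; apply: pU; first by move: xX; rewrite inE => /andP[].
      by apply: contraNneq yX => <-.
    by apply: contraNneq wX => <-.
  have psiY x y' : x \in X -> y' \in Y -> psi x 0 y' <= 0.
    by move=> xX /YU[y'U y'v y'X]; case: (psiP x xX) => _ _; apply.
  (* The positive number [phi 0 y] is a sum of products of nonpositive numbers, so some product is
     nonzero. For that x, [phi] is positive on all of [D x], which therefore lies in the two-element
     set of positive coordinates. *)
  have [x xX /andP[px py0]] : exists2 x, x \in X & (phi 0 x < 0) && (psi x 0 y != 0).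
    apply/exists_inP; apply: contraLR py => /exists_inPn h.
    rewrite -leNgt (YE _ _ yY pL) big1 // => x xX.
    have := h x xX; rewrite negb_and negbK -leNgt => /orP[px|/eqP->]; last first.
      by rewrite mulr0.
    by have /eqP -> : phi 0 x == 0; rewrite ?mul0r // eq_le px pX.
  apply/bigcupP; exists x; last by rewrite inE yY.
  rewrite [in X in is_true X]inE xX /=.
  have <- : #|positives U phi| = 2%N.
    by rewrite pyw cards2; move: wy; rewrite inE eq_sym => /and3P[_ ->].
  apply/subset_leq_card/subsetP=> y'; rewrite inE => /andP[y'Y py'].
  have [y'U _ _] := YU y' y'Y.
  rewrite inE y'U /= (YE _ _ y'Y pL) (bigD1 x) //=.
  rewrite ltr_pwDl //; first by rewrite nmulr_lgt0 // lt_neqAle py' psiY.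
  by rewrite sumr_ge0 // => x' /andP[x'X _]; rewrite mulr_le0 ?pX ?psiY.
have cA : (#|A| <= 2 * #|X|)%N.
  apply: leq_trans (_ : 2 * #|[set x in X | #|D x| <= 2]| <= _)%N.
    by apply: card_bigcup_le => x; rewrite inE => /andP[].
  by rewrite leq_mul2l /= subset_leq_card //; apply/subsetP=> x; rewrite inE => /andP[].
have x0U : x0 \in U by move: x0X; rewrite inE => /andP[].
have Bx0 : B \subset nbrs L U x0.
  apply/subsetP=> y; rewrite inE => /andP[/YU[yU _ _] /eqP yX].
  by apply: nbrs_sym => //; rewrite yX.
have cB : (#|B| < #|X| + (contract L U v != 0)%R)%N.
  have [c0|_] := eqVneq (contract L U v) 0; last first.
    rewrite addn1 ltnS; apply: (card_nbrs_spanned gLU vU psiP x0U Bx0).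
    by move=> y phi; rewrite inE => /andP[yY _]; exact: YE.
  (* If the contraction is zero, v also lies in the span of X. It is a neighbour of [x0] outside B,
     so it can be adjoined to B, and this saves one. *)
  have vB : v \notin B by rewrite inE; apply/negP => /andP[/YU[_ /eqP]].
  have -> : (#|B|.+1 = #|v |: B|)%N by rewrite cardsU1 vB.
  rewrite addn0; apply: (card_nbrs_spanned gLU vU psiP x0U).
    apply/subsetP=> y /setU1P[->|/(subsetP Bx0)//]; exact: nbrs_sym.
  move=> y phi _ pL; apply: (coord_spanned psiP) => // phi'.
  by rewrite c0 submx0 => /eqP->; rewrite mxE.
have : (#|Y| <= #|A| + #|B|)%N.
  apply: leq_trans (subset_leq_card YAB) _.
  by rewrite cardsU leq_subr.
rewrite -/Y; lia.
Qed.

(** With k the number of neighbours of v, a step removes 1 + k + [#|Y|] elements, at least k from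
    the rank and at least 2 + [#|Y|] circuits. The inequality survives if 2k + [#|Y|] is at most 5k,
    whence 5 = 2 + 3. The extra unit for [L != 0] is paid by the sharper bound on [#|Y|] at the step
    where the contraction becomes zero. *)
Theorem card_circuits_ge L U : gale L U ->
  (2 * #|U| + (L != 0)%R <= #|circuits L U| + 5 * \rank L)%N.
Proof.
have [n] := ubnP #|U|; elim: n L U => // n IH L U /ltnSE Un gLU.
have [L0|Ln0] := eqVneq L 0.
  rewrite addn0 (_ : #|U| = 0)%N //; apply/eqP; rewrite cards_eq0; apply/eqP/setP=> i.
  rewrite inE; apply/negP=> /gLU.2[phi]; rewrite L0 submx0 => /eqP->.
  by rewrite mxE eqxx.
have [v0 v0U] : exists v, v \in U.
  have [i [j Lij]] := mx_neq0 Ln0.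
  have Li : row i L != 0 by apply: contraNneq Lij => /rowP/(_ j); rewrite !mxE => ->.
  have := gLU.1 _ (row_sub i L) Li; case: (set_0Vmem (positives U (row i L))).
    by move=> ->; rewrite cards0.
  by case=> v; rewrite inE => /andP[vU _] _; exists v.
have [v vU vmin] := @arg_minnP _ v0 (mem U) (fun w => #|nbrs L U w|) v0U.
have [psi psiP] := nbrs_dual gLU vU.
have cY := card_spanned gLU vU psiP Ln0 vmin.
have cC := card_circuits_contract gLU vU psiP.
have rC := rank_contract psiP.
set U' := _ :\: spanned L U v in cC.
have cU : (#|U| = 1 + #|nbrs L U v| + #|spanned L U v| + #|U'|)%N.
  have XU : v |: nbrs L U v \subset U.
    by apply/subsetP=> i /setU1P[->//|]; rewrite inE => /andP[].
  have YW : spanned L U v \subset U :\: (v |: nbrs L U v).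
    by apply/subsetP=> y /spannedP[].
  have vX : v \notin nbrs L U v by rewrite inE eqxx andbF.
  have := cardsID (v |: nbrs L U v) U; rewrite (setIidPr XU) cardsU1 vX.
  have := cardsID (spanned L U v) (U :\: (v |: nbrs L U v)).
  by rewrite (setIidPr YW) -/U'; lia.
have := IH (contract L U v) U'; rewrite -/U'.
have lt : (#|U'| < n)%N by lia.
have gC : gale (contract L U v) U' by apply: gale_contract.
move=> /(_ lt gC).
by rewrite cU; move: cC cY rC; rewrite -/U'; case: (contract L U v != 0); lia.
Qed.

End Count.

(** * Slack matrices and duality *)

Section Slack.
Variable R : realFieldType.

(** The columns generate the cone of nonnegative vectors of the column space. For nonnegative [M]
    this is the property of slack matrices that does not mention a polytope. *)
Definition generates N f (M : 'M[R]_(N, f)) : Prop := forall z,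
  nonneg (M *m z) -> exists2 z', nonneg z' & M *m z = M *m z'.

Lemma kermx_ortho N p (A : 'M[R]_(N, p)) (u : 'cV[R]_N) :
  kermx A *m u = 0 <-> exists w, u = A *m w.
Proof.
split=> [Au|[w ->]]; last by rewrite mulmxA mulmx_ker mul0mx.
suff /submxP[w wE] : (u^T <= A^T)%MS.
  by exists w^T; rewrite -[u]trmxK wE trmx_mul trmxK.
rewrite submxE; apply/eqP/trmx_inj; rewrite trmx_mul trmxK trmx0.
have : (((cokermx A^T)^T <= kermx A)%MS).
  by apply/sub_kermxP/trmx_inj; rewrite trmx_mul trmxK mulmx_coker trmx0.
by case/submxP=> D ->; rewrite -mulmxA Au mulmx0.
Qed.

Lemma mul_ge0 N f (M : 'M[R]_(N, f)) (z : 'cV[R]_f) :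
  (forall i j, 0 <= M i j) -> nonneg z -> nonneg (M *m z).
Proof. by move=> M0 z0 i; rewrite mxE sumr_ge0 // => j _; rewrite mulr_ge0. Qed.

(** Polytope duality in matrix form. If the combination [y^T *m M] of rows were not a nonnegative
    one, Farkas' lemma would give [z] with [M *m z] nonnegative and negative product with [y^T];
    replacing [z] by a nonnegative [z'] contradicts the nonnegativity of [M^T *m y]. *)
Lemma generates_tr N f (M : 'M[R]_(N, f)) : (forall i j, 0 <= M i j) ->
  generates M -> generates M^T.
Proof.
move=> M0 gM y y0.
have [[x [x0 xM]]|[z [z0 zb]]] := farkas M (y^T *m M).
  by exists x^T => [i|]; rewrite ?mxE // -trmx_mul xM trmx_mul trmxK.
have [z' z'0 zE] := gM z z0; move: zb; rewrite -mulmxA zE mulmxA ltNge.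
have -> : (y^T *m M *m z') 0 0 = \sum_j (M^T *m y) j 0 * z' j 0.
  by rewrite mxE; apply: eq_bigr => j _; rewrite -[y^T *m M]trmxK trmx_mul trmxK mxE.
by rewrite sumr_ge0 // => j _; rewrite mulr_ge0.
Qed.

(** Every circuit is the support of a column: the circuit vector is a nonnegative combination of
    columns, any column really used has its support inside the circuit, and minimality gives
    equality. *)
Lemma card_circuits_generates N f (M : 'M[R]_(N, f)) : (forall i j, 0 <= M i j) ->
  generates M -> (#|circuits (kermx M) setT| <= f)%N.
Proof.
move=> M0 gM; rewrite -[f in (_ <= f)%N]card_ord -cardsT.
apply: leq_trans (leq_imset_card (fun j => supp (col j M)) _).
apply/subset_leq_card/subsetP=> C; rewrite inE => /andP[_ /circuitP].
case=> u [/kermx_ortho[w uE] u0 su un0 umin].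
have [z z0 zE] : exists2 z, nonneg z & M *m w = M *m z by apply: gM; rewrite -uE.
have [i [j0]] := mx_neq0 un0; rewrite ord1 => ui.
have uz k : u k 0 = \sum_j M k j * z j 0 by rewrite uE zE mxE.
have [j Mz] : exists j, M i j * z j 0 != 0.
  apply/existsP; apply: contraNT ui => /existsPn h; rewrite uz big1 // => j _.
  by apply/eqP; have := h j; rewrite negbK.
have zj : 0 < z j 0.
  by rewrite lt_neqAle z0 andbT eq_sym; apply: contraNneq Mz => ->; rewrite mulr0.
have Mij : M i j != 0 by apply: contraNneq Mz => ->; rewrite mul0r.
apply/imsetP; exists j; rewrite ?inE //; apply/esym/umin.
- by apply/kermx_ortho; exists (delta_mx j 0); rewrite -colE.
- by move=> k; rewrite mxE.
- by apply: contraNneq Mij => /colP/(_ i); rewrite !mxE => ->.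
- rewrite -su; apply/subsetP=> k; rewrite !inE mxE => Mkj; rewrite uz.
  rewrite psumr_neq0 => [|l _]; last exact: mulr_ge0.
  apply/hasP; exists j; rewrite ?mem_index_enum //= mulr_gt0 //.
  by rewrite lt_neqAle eq_sym Mkj M0.
Qed.

(** The slack matrix, with one column for each facet. Every nonnegative vector in the kernel is a
    nonnegative combination of columns, by subtracting circuits until its support is empty. *)
Lemma circuit_matrix N (L : 'M[R]_N) :
  exists M : 'M[R]_(N, #|circuits L setT|),
  [/\ forall i j, 0 <= M i j, L *m M = 0, forall j, supp (col j M) = enum_val j &
      forall u, nonneg u -> L *m u = 0 -> exists2 z, nonneg z & u = M *m z].
Proof.
have [c cP] : exists c : 'I_#|circuits L setT| -> 'cV[R]_N, forall j,
    [/\ L *m c j = 0, nonneg (c j), supp (c j) = enum_val j & c j != 0].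
  suff /choice[c cP] : forall j : 'I_#|circuits L setT|, exists u : 'cV[R]_N,
      [/\ L *m u = 0, nonneg u, supp u = enum_val j & u != 0] by exists c.
  move=> j; have := enum_valP j; rewrite inE => /andP[_ /circuitP[u [Lu u0 su un0 _]]].
  by exists u.
exists (\matrix_(i, j) c j i 0); set M := \matrix_(i, j) _.
have cM j : col j M = c j by apply/colP=> i; rewrite !mxE.
split=> [i j||j|]; first by rewrite mxE; case: (cP j).
- apply/trmx_inj/row_matrixP=> j; rewrite -tr_col trmx0 row0.
  by rewrite colE -mulmxA -colE cM; case: (cP j) => -> *; rewrite trmx0.
- by rewrite cM; case: (cP j).
move=> u; have [k] := ubnP #|supp u|; elim: k u => // k IH u /ltnSE uk u0 Lu.
have [->|un0] := eqVneq u 0.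
  by exists 0; rewrite ?mulmx0 // => i; rewrite mxE.
have [i [j0]] := mx_neq0 un0; rewrite ord1 => ui.
have iu : i \in supp u by rewrite inE.
have [C [CL Cu _]] := circuit_through Lu u0 iu.
have CL' : C \in circuits L setT by rewrite inE subsetT.
pose j := enum_rank_in CL' C; have jE : enum_val j = C by rewrite enum_rankK_in.
have [Lc c0 sc cn0] := cP j; rewrite jE in sc.
have scu : supp (c j) \subset supp u by rewrite sc.
have [t [t0 ut Lut [l [lc lu]]]] := supp_sub_scaled u0 c0 cn0 scu Lu Lc.
have [|z z0 zE] := IH (u - t *: c j) _ ut Lut.
  apply: leq_trans uk; rewrite (cardsD1 l (supp u)) (subsetP scu) // ltnS.
  exact: subset_leq_card.
exists (z + t *: delta_mx j 0) => [i'|].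
  by rewrite !mxE addr_ge0 // mulr_ge0 ?ler0n // ltW.
by rewrite mulmxDr -zE -scalemxAr -colE cM subrK.
Qed.

(** * The dual polytope, as the transposed slack matrix *)

Section Dual.
Variables (N p : nat) (A : 'M[R]_(N, p)).
Hypotheses (A_pos : exists w : 'cV[R]_p, forall i, 0 < (A *m w) i 0)
  (gA : gale (kermx A) setT).
Let f := #|circuits (kermx A) setT|.
Variable M : 'M[R]_(N, f).
Hypotheses (M0 : forall i j, 0 <= M i j) (LM : kermx A *m M = 0)
  (sM : forall j, supp (col j M) = enum_val j)
  (Mgen : forall u, nonneg u -> kermx A *m u = 0 -> exists2 z, nonneg z & u = M *m z).

(** The column space of [A] contains a strictly positive vector, so each of its vectors is a
    difference of two nonnegative ones; [t] exceeds all the ratios that have to be compensated. *)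
Lemma slack_col (w : 'cV[R]_p) : exists z, A *m w = M *m z.
Proof.
have [w1 w1p] := A_pos.
pose t := \sum_i `|(A *m w) i 0| / (A *m w1) i 0.
have t0 : 0 <= t by rewrite sumr_ge0 // => i _; rewrite divr_ge0 // ltW.
have [||z z0 zE] := Mgen (u := A *m (w + t *: w1)).
- move=> i; rewrite mulmxDr -scalemxAr mxE [X in _ + X]mxE -lerBlDl sub0r.
  apply: (@le_trans _ _ `|(A *m w) i 0|); first by rewrite -normrN ler_norm.
  rewrite -ler_pdivrMr // /t (bigD1 i) //= lerDl sumr_ge0 // => j _.
  by rewrite divr_ge0 // ltW.
- by rewrite mulmxA mulmx_ker mul0mx.
have [||z1 z10 z1E] := Mgen (u := A *m w1).
- by move=> i; apply: ltW.
- by rewrite mulmxA mulmx_ker mul0mx.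
exists (z - t *: z1); rewrite mulmxBr -scalemxAr -z1E -zE mulmxDr -scalemxAr.
by rewrite addrK.
Qed.

Lemma slack_eqmx : (M^T :=: A^T)%MS.
Proof.
apply/eqmxP/andP; split.
  apply/row_subP=> j; rewrite -tr_col.
  have [|w ->] := (kermx_ortho A (col j M)).1.
    by rewrite colE mulmxA LM mul0mx.
  by rewrite trmx_mul submxMl.
apply/row_subP=> j; rewrite -tr_col colE.
by have [z ->] := slack_col (delta_mx j 0); rewrite trmx_mul submxMl.
Qed.

Lemma slack_generates : generates M.
Proof.
move=> z z0; apply: Mgen z0 _.
by rewrite mulmxA LM mul0mx.
Qed.

Lemma slack_col_neq0 j : exists i, M i j != 0.
Proof.
have := enum_valP j; rewrite inE => /andP[_ /minsetP[/possuppP[/set0Pn[i]]]].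
by rewrite -sM !inE mxE; exists i.
Qed.

Lemma slack_col_sub j k : supp (col k M) \subset supp (col j M) -> k = j.
Proof.
rewrite !sM => kj; apply: enum_val_inj.
have := enum_valP j; rewrite inE => /andP[_ /minsetP[_]]; apply=> //.
by have := enum_valP k; rewrite inE => /andP[_ /minsetP[]].
Qed.

Lemma slack_ker (phi : 'rV[R]_N) : phi *m M = 0 -> (phi <= kermx A)%MS.
Proof.
move=> pM; apply/sub_kermxP/trmx_inj; rewrite trmx_mul trmx0.
have /submxP[D ->] : (A^T <= M^T)%MS by rewrite slack_eqmx.
by rewrite -mulmxA -trmx_mul pM trmx0 mulmx0.
Qed.

Lemma pos_uniq (psi : 'rV[R]_N) i : (psi <= kermx A)%MS ->
  (forall j, j != i -> psi 0 j <= 0) -> psi = 0.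
Proof.
move=> pL pi; apply/eqP; apply: contraT => pn0.
have := gA.1 _ pL pn0; rewrite ltnNge => /negP[].
rewrite -(cards1 i); apply/subset_leq_card/subsetP=> j; rewrite !inE /=.
by apply: contraTT => /pi; rewrite leNgt.
Qed.

(** For the first clause, suppose only column j has a positive coefficient in a relation between
    columns. Any other column occurring in it has its support inside that of column j, contradicting
    the minimality of circuits. The second clause says that if the dual had apex j, the polytope
    itself would have an apex. *)
Lemma gale_slack : gale (kermx M^T) setT.
Proof.
split=> [phi /sub_kermxP pM pn0|j _].
  have pM' i : \sum_j M i j * phi 0 j = 0.
    have /rowP/(_ i) := pM; rewrite !mxE => E; rewrite -[RHS]E.
    by apply: eq_bigr => j _; rewrite mxE mulrC.
  rewrite ltnNge; apply/negP => le1.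
  have [j jP] := positives_le1 pn0 le1.
  have pk k : k != j -> phi 0 k = 0.
    move=> kj; apply/eqP; apply: contraNT kj => pk0; apply/eqP/slack_col_sub.
    apply/subsetP=> i; rewrite !inE !mxE; apply: contraNN => /eqP Mij.
    have := pM' i; rewrite (bigD1 j) //= Mij mul0r add0r => /eqP.
    rewrite -oppr_eq0 -sumrN psumr_eq0 => [/allP/(_ k (mem_index_enum _))|l lj].
      have [->|kj] := eqVneq k j; first by rewrite Mij.
      by rewrite /= oppr_eq0 mulf_eq0 (negPf pk0) orbF.
    by rewrite oppr_ge0 mulr_ge0_le0 // jP.
  have [i Mij] := slack_col_neq0 j.
  have := pM' i; rewrite (bigD1 j) //= big1 => [/eqP|k kj]; last by rewrite pk ?mulr0.
  rewrite addr0 mulf_eq0 (negPf Mij) => /eqP pj.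
  case/eqP: pn0; apply/rowP=> k; rewrite mxE.
  by have [->|/pk] := eqVneq k j.
apply: contrapT => nphi.
(* Otherwise the unit vector at j is a combination of rows of [M], even a nonnegative one; so some
   row [i0] is nonzero at j only. *)
have [|y yE] := (kermx_ortho M^T (delta_mx j 0)).1.
  apply/orthoP=> phi pL; apply/rowP=> k; rewrite -colE !mxE.
  by apply/eqP; apply: contraT => pj; case: nphi; exists phi.
have gMt := generates_tr M0 slack_generates.
have [|z z0 zE] := gMt y; first by rewrite -yE => k; rewrite mxE ler0n.
rewrite zE in yE; have {}yE k : \sum_i M i k * z i 0 = (k == j)%:R.
  have /colP/(_ k) := yE; rewrite !mxE eqxx andbT => ->.
  by apply: eq_bigr => i _; rewrite mxE.
have [i0 Mi0] : exists i, M i j * z i 0 != 0.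
  apply/existsP; apply: contraT => /existsPn h; have /eqP := yE j.
  rewrite big1 => [|i _]; first by rewrite eqxx eq_sym oner_eq0.
  by apply/eqP; have := h i; rewrite negbK.
have Mi0j : 0 < M i0 j.
  by rewrite lt_neqAle M0 andbT eq_sym; apply: contraNneq Mi0 => ->; rewrite mul0r.
have zi0 : z i0 0 != 0.
  by apply: contraNneq Mi0 => ->; rewrite mulr0.
have Mi0k k : k != j -> M i0 k = 0.
  move=> kj; have /eqP := yE k; rewrite (negPf kj) psumr_eq0 => [|i _]; last first.
    exact: mulr_ge0.
  move/allP/(_ i0 (mem_index_enum _)); rewrite /= mulf_eq0 (negPf zi0) orbF.
  by move/eqP.
(* Row i minus s times row [i0] vanishes at j and is nonnegative, hence a nonnegative combination
   [z'] of rows. The resulting dependence can be positive only at i, so it is zero; yet its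
   coordinate at [i0] is at most [- s]. *)
have Mij i : i != i0 -> M i j = 0.
  move=> ii0; apply/eqP; apply: contraT => Mij.
  pose s := M i j / M i0 j.
  have s0 : 0 < s by rewrite divr_gt0 // lt_neqAle eq_sym Mij M0.
  have [k|z' z'0 z'E] := gMt (delta_mx i 0 - s *: delta_mx i0 0).
    rewrite mulmxBr -scalemxAr -!colE !mxE.
    have [->|kj] := eqVneq k j; first by rewrite /s mulfVK ?subrr // gt_eqF.
    by rewrite Mi0k // mulr0 subr0.
  pose psi := (delta_mx i 0 - s *: delta_mx i0 0 - z')^T.
  have psi0 : psi = 0.
    apply: (@pos_uniq _ i); last first.
      move=> l li; rewrite !mxE (negPf li) /= sub0r -opprD oppr_le0.
      by rewrite addr_ge0 // mulr_ge0 ?ler0n // ltW.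
    apply: slack_ker; apply/trmx_inj; rewrite trmx_mul trmxK trmx0 mulmxBr z'E.
    by rewrite subrr.
  have /rowP/(_ i0) := psi0.
  rewrite !mxE !eqxx [i0 == i]eq_sym (negPf ii0) /= sub0r mulr1.
  move=> /eqP; rewrite -opprD oppr_eq0 gt_eqF // ltr_pwDl //.
(* Column j is now nonzero only at [i0], so every dependence vanishes at [i0], which would be an
   apex. *)
have [phi pL] := gA.2 i0 (in_setT _); case/eqP.
have : (phi *m M) 0 j = 0.
  by case/submxP: pL => D ->; rewrite -mulmxA LM mulmx0 mxE.
rewrite mxE (bigD1 i0) //= big1 => [/eqP|i /Mij ->]; last by rewrite mulr0.
by rewrite addr0 mulf_eq0 (gt_eqF Mi0j) orbF => /eqP.
Qed.

End Dual.

Theorem gale_bounds N p (A : 'M[R]_(N, p)) :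
  (exists w : 'cV[R]_p, forall i, 0 < (A *m w) i 0) -> gale (kermx A) setT -> (0 < N)%N ->
  exists a b, [/\ N = (\rank A + a)%N, #|circuits (kermx A) setT| = (\rank A + b)%N,
    (0 < a)%N && (0 < b)%N, (\rank A + 1 <= b + 3 * a)%N & (\rank A + 1 <= a + 3 * b)%N].
Proof.
move=> A_pos gA N0; have [M [M0 LM sM Mgen]] := circuit_matrix (kermx A).
have gM := gale_slack A_pos gA M0 LM sM Mgen.
have gMt := generates_tr M0 (slack_generates LM Mgen).
have rM : \rank M^T = \rank A by rewrite (slack_eqmx A_pos LM Mgen) mxrank_tr.
have ker_n0 k q (B : 'M[R]_(k, q)) : (0 < k)%N -> gale (kermx B) setT -> kermx B != 0.
  case: k B => // k B _ [_ /(_ ord0 (in_setT _))[phi pB]].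
  by apply: contraNneq => B0; move: pB; rewrite B0 submx0 => /eqP ->; rewrite mxE.
have f0 : (0 < #|circuits (kermx A) setT|)%N.
  have [w wp] := A_pos; have Aw0 : kermx A *m (A *m w) = 0 by rewrite mulmxA mulmx_ker mul0mx.
  have [|z z0] := Mgen _ _ Aw0; first by move=> i; apply: ltW.
  rewrite lt0n => wz; apply/negP=> /eqP fE; have := wp (Ordinal N0).
  rewrite wz mxE big1 ?ltxx // => j _; have := ltn_ord j; by rewrite [X in (_ < X)%N]fE.
have h1 := card_circuits_ge gA; have h2 := card_circuits_ge gM.
(* The rows of [M] bound the number of circuits on the dual side, so the second application of the
   counting theorem bounds N from below. *)
have le2 : (#|circuits (kermx M^T) setT| <= N)%N.
  by apply: card_circuits_generates => // i j; rewrite mxE.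
move: h1 h2; rewrite (ker_n0 _ _ _ N0 gA) (ker_n0 _ _ _ f0 gM) !cardsT !card_ord.
rewrite !mxrank_ker rM.
have rN := rank_leq_row A; have := rank_leq_row M^T; rewrite rM => rf.
have := ker_n0 _ _ _ N0 gA; have := ker_n0 _ _ _ f0 gM.
rewrite -!mxrank_eq0 !mxrank_ker rM => b0 a0 h1 h2.
exists (N - \rank A)%N, (#|circuits (kermx A) setT| - \rank A)%N.
by split; lia.
Qed.

End Slack.

(** * Convex hulls and dimension *)

Section Hull.
Variables (R : realType) (n : nat).
Implicit Types (x y : 'rV[R]_n) (c : 'cV[R]_n) (w : 'cV[R]_(n + 1)).

Definition hmg x : 'rV[R]_(n + 1) := row_mx x 1.

Lemma hmg_dot x c (b : 'M[R]_1) : (hmg x *m col_mx c b) 0 0 = dotp x c + b 0 0.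
Proof. by rewrite mul_row_col mul1mx mxE. Qed.

Section Rows.
Variable N : nat.
Implicit Types (V : 'M[R]_(N, n)) (Z : {set 'I_N}) (l : 'rV[R]_N).

Definition hom V : 'M[R]_(N, n + 1) := row_mx V (const_mx 1).

Lemma row_hom V i : row i (hom V) = hmg (row i V).
Proof.
rewrite row_row_mx; congr row_mx; apply/rowP=> j.
by rewrite !mxE ord1.
Qed.

Lemma homE V i w : (hom V *m w) i 0 = (hmg (row i V) *m w) 0 0.
Proof. by rewrite -row_hom -row_mul [RHS]mxE. Qed.

Lemma mul_homP V l x : l *m hom V = hmg x <->
  \sum_i l 0 i = 1 /\ \sum_i l 0 i *: row i V = x.
Proof.
rewrite mul_mx_row mulmx_sum_row.
have -> : l *m const_mx 1 = (\sum_i l 0 i)%:M :> 'M_1.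
  apply/rowP=> j; rewrite ord1 !mxE eqxx mulr1n; apply: eq_bigr => i _.
  by rewrite mxE mulr1.
split=> [/eq_row_mx[-> /(congr1 (fun A : 'M_1 => A 0 0))]|[-> ->]//].
by rewrite !mxE eqxx !mulr1n.
Qed.

(** The hull of the rows indexed by Z. Because of the appended coordinate 1, a single equation says
    both that the coefficients sum to 1 and that they represent x. *)
Definition cvx V Z : set 'rV[R]_n := [set x | exists l,
  [/\ forall i, 0 <= l 0 i, forall i, i \notin Z -> l 0 i = 0 & l *m hom V = hmg x]]%classic.

Lemma cvx_row V Z i : i \in Z -> cvx V Z (row i V).
Proof.
move=> iZ; exists (delta_mx 0 i); split=> [j|j jZ|].
- by rewrite mxE ler0n.
- by rewrite mxE eqxx; case: eqVneq jZ => // ->; rewrite iZ.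
- by rewrite -rowE row_hom.
Qed.

Lemma sub_cvx V Z1 Z2 : Z1 \subset Z2 -> (cvx V Z1 `<=` cvx V Z2)%classic.
Proof.
move=> Z12 x [l [l0 lZ lx]]; exists l; split=> // i iZ; apply: lZ.
by apply: contra iZ => /(subsetP Z12).
Qed.

Lemma convex_cvx V Z : convex_set (cvx V Z).
Proof.
move=> x y t; rewrite !in_setE => -[l [l0 lZ lx]] [k [k0 kZ ky]].
have t0 : 0 <= t%:num by [].
have t1 : 0 <= 1 - t%:num by rewrite subr_ge0.
exists (t%:num *: l + (1 - t%:num) *: k); split=> [i|i iZ|].
- by rewrite !mxE addr_ge0 // mulr_ge0.
- by rewrite !mxE lZ // kZ // !mulr0 addr0.
- rewrite mulmxDl -!scalemxAl lx ky /hmg !scale_row_mx add_row_mx -scalerDl.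
  by rewrite subrKC scale1r.
Qed.

Lemma convex_comb (A : set 'rV[R]_n) (s : seq 'I_N) V (l : 'I_N -> R) :
  convex_set A -> {in s, forall i, A (row i V)} -> (forall i, 0 <= l i) ->
  0 < \sum_(i <- s) l i ->
  A ((\sum_(i <- s) l i)^-1 *: \sum_(i <- s) l i *: row i V).
Proof.
move=> cA + l0; elim: s => [|i s IH] As; first by rewrite big_nil ltxx.
rewrite !big_cons; set S := \sum_(j <- s) _; set T := \sum_(j <- s) _ *: _ => lS.
have S0 : 0 <= S by rewrite sumr_ge0.
have Ai : A (row i V) by apply: As; rewrite inE eqxx.
have [S00|Sn0] := eqVneq S 0.
  have T0 : T = 0.
    move/eqP: S00; rewrite /S psumr_eq0 // => /allP h.
    rewrite /T big_seq big1 // => j /h /=/eqP ->.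
    by rewrite scale0r.
  rewrite T0 S00 !addr0 scalerA mulVf ?scale1r //.
  by move: lS; rewrite S00 addr0 => /gt_eqF/negbT.
have Sp : 0 < S by rewrite lt_neqAle eq_sym Sn0.
have AT : A (S^-1 *: T).
  by apply: IH => // j js; apply: As; rewrite inE js orbT.
have t0 : 0 <= l i / (l i + S) by rewrite divr_ge0 // ltW.
have t1 : l i / (l i + S) <= 1 by rewrite ler_pdivrMr // mul1r lerDl.
have := cA _ _ (Itv01 t0 t1) (mem_set Ai) (mem_set AT).
rewrite in_setE; congr (A _).
transitivity (l i / (l i + S) *: row i V + (1 - l i / (l i + S)) *: (S^-1 *: T)).
  by [].
rewrite scalerDr !scalerA; congr (_ *: _ + _ *: _).
  by rewrite mulrC.
have ne : l i + S != 0 by rewrite gt_eqF.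
by rewrite -{1}(divff ne) -mulrBl [l i + S]addrC addrK mulrAC divff // mul1r addrC.
Qed.

Lemma conv_hull_rows V Z (A : set 'rV[R]_n) :
  (forall x, A x <-> exists2 i, i \in Z & x = row i V) ->
  conv_hull A = cvx V Z.
Proof.
move=> AE; apply/seteqP; split.
  apply: smallest_sub; first exact: convex_cvx.
  by move=> x /AE[i iZ ->]; exact: cvx_row.
move=> x [l [l0 lZ /mul_homP[l1 lx]]] B [cB AB].
have E (T : nmodType) (F : 'I_N -> T) : (forall i, i \notin Z -> F i = 0) ->
    \sum_i F i = \sum_(i <- enum Z) F i.
  move=> F0; rewrite big_enum (bigID (mem Z)) /= [X in _ + X]big1 ?addr0 //.
have sl : \sum_(i <- enum Z) l 0 i = 1 by rewrite -E.
have := @convex_comb B (enum Z) V (fun i => l 0 i) cB.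
rewrite sl invr1 scale1r -E ?lx => [|i iZ]; last by rewrite lZ // scale0r.
apply; rewrite ?ltr01 // => i; rewrite mem_enum => iZ.
by apply: AB; apply/AE; exists i.
Qed.

(** Rows outside Z are zeroed, not dropped, so the index type is the same for all faces. The rank
    exceeds the dimension of the hull by one, also for the empty set. *)
Definition spn V Z : 'M[R]_(N, n + 1) :=
  \matrix_(i, j) if i \in Z then hom V i j else 0.

Definition rk V Z : nat := \rank (spn V Z).

Lemma mul_spn V Z w i : (spn V Z *m w) i 0 = if i \in Z then (hom V *m w) i 0 else 0.
Proof.
rewrite !mxE; case: ifP => iZ.
  by apply: eq_bigr => j _; rewrite mxE iZ.
by rewrite big1 // => j _; rewrite mxE iZ mul0r.
Qed.

Lemma sub_spnP V Z (y : 'rV[R]_(n + 1)) : (y <= spn V Z)%MS <->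
  exists2 l : 'rV[R]_N, (forall i, i \notin Z -> l 0 i = 0) & l *m hom V = y.
Proof.
have E l : l *m spn V Z = (\row_i if i \in Z then l 0 i else 0) *m hom V.
  apply/rowP=> j; rewrite !mxE; apply: eq_bigr => i _; rewrite !mxE.
  by case: ifP => _; rewrite ?mulr0 ?mul0r.
split=> [/submxP[l ->]|[l lZ <-]].
  by rewrite E; exists (\row_i if i \in Z then l 0 i else 0) => // i iZ;
    rewrite mxE (negPf iZ).
suff -> : l *m hom V = l *m spn V Z by apply: submxMl.
rewrite E; congr (_ *m _); apply/rowP=> i; rewrite mxE.
by case: ifP => // /negbT/lZ.
Qed.

Lemma row_sub_spn V Z i : i \in Z -> (hmg (row i V) <= spn V Z)%MS.
Proof.
move=> iZ; apply/sub_spnP; exists (delta_mx 0 i); last by rewrite -rowE row_hom.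
by move=> j jZ; rewrite mxE eqxx; case: eqVneq jZ => // ->; rewrite iZ.
Qed.

Lemma spn_subP m V Z (B : 'M[R]_(m, n + 1)) :
  reflect (forall i, i \in Z -> (hmg (row i V) <= B)%MS) (spn V Z <= B)%MS.
Proof.
apply: (iffP idP) => [ZB i iZ|ZB]; first exact: submx_trans (row_sub_spn V iZ) ZB.
apply/row_subP=> i; have [iZ|iZ] := boolP (i \in Z).
  rewrite (_ : row i _ = hmg (row i V)) ?ZB // -row_hom.
  by apply/rowP=> j; rewrite !mxE iZ.
rewrite (_ : row i _ = 0) ?sub0mx //.
by apply/rowP=> j; rewrite !mxE (negPf iZ).
Qed.

Lemma spnS V Z1 Z2 : Z1 \subset Z2 -> (spn V Z1 <= spn V Z2)%MS.
Proof. by move=> s; apply/spn_subP=> i /(subsetP s); exact: row_sub_spn. Qed.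

Lemma rkS V Z1 Z2 : Z1 \subset Z2 -> (rk V Z1 <= rk V Z2)%N.
Proof. by move=> s; apply/mxrankS/spnS. Qed.

Lemma spn0 V : spn V set0 = 0.
Proof. by apply/matrixP=> i j; rewrite !mxE inE. Qed.

Lemma spnT V : spn V setT = hom V.
Proof. by apply/matrixP=> i j; rewrite [LHS]mxE inE. Qed.

Lemma cvx_sub_spn V Z x : cvx V Z x -> (hmg x <= spn V Z)%MS.
Proof. by case=> l [_ lZ lx]; apply/sub_spnP; exists l. Qed.

(** Affine sets are only given as closed under two-point combinations. Each new term is added by
    taking the midpoint of two points with doubled displacements, which avoids dividing by partial
    sums that may vanish. *)
Lemma affine_comb (A : set 'rV[R]_n) (s : seq 'I_N) V (l : 'I_N -> R) x :
  affine_set A -> A x -> {in s, forall i, A (row i V)} ->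
  A (x + \sum_(i <- s) l i *: (row i V - x)).
Proof.
move=> aA Ax; elim: s => [|i s IH] As; first by rewrite big_nil addr0.
have Ai : A (row i V) by apply: As; rewrite inE eqxx.
have {IH} As' : A (x + \sum_(i <- s) l i *: (row i V - x)).
  by apply: IH => j js; apply: As; rewrite inE js orbT.
rewrite big_cons; set y := _ + _ in As' *.
have A2 : A (x + (2 * l i) *: (row i V - x)).
  have := aA _ _ (2 * l i) Ai Ax; congr (A _).
  by rewrite scalerBr scalerBl scale1r addrCA.
have A3 : A (x + 2%:R *: (y - x)).
  have := aA _ _ 2%:R As' Ax; congr (A _).
  by rewrite scalerBr scalerBl scale1r addrCA.
have := aA _ _ 2^-1 A2 A3; congr (A _).
have -> : 1 - 2^-1 = 2^-1 :> R by lra.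
rewrite -scalerDr addrACA scalerDr -mulr2n -scaler_nat scalerA mulVf ?scale1r ?pnatr_eq0 //.
rewrite -scalerA -scalerDr scalerA mulVf ?scale1r ?pnatr_eq0 //.
by rewrite /y [x + _]addrC addrK.
Qed.

Lemma aff_hull_cvx V Z :
  aff_hull (cvx V Z) = [set x | (hmg x <= spn V Z)%MS]%classic.
Proof.
apply/seteqP; split=> [|x /= /sub_spnP[l lZ /mul_homP[l1 lx]] A [aA cA]].
  apply: smallest_sub; last by move=> x; exact: cvx_sub_spn.
  move=> x y t /= xZ yZ.
  have -> : hmg (t *: x + (1 - t) *: y) = t *: hmg x + (1 - t) *: hmg y.
    by rewrite /hmg !scale_row_mx add_row_mx -scalerDl subrKC scale1r.
  by rewrite addmx_sub // scalemx_sub.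
have [i0 i0Z] : exists i, i \in Z.
  have [i _ li] : exists2 i, i \in setT & l 0 i != 0.
    apply/exists_inP; apply: contraT => /exists_inPn l0.
    move: l1; rewrite big1 => [/eqP|i _]; first by rewrite eq_sym oner_eq0.
    by apply/eqP; have := l0 i; rewrite inE negbK => ->.
  by exists i; apply: contraNT li => /lZ->.
have Ai i : i \in Z -> A (row i V) by move=> iZ; apply/cA/cvx_row.
have := @affine_comb A (enum Z) V (fun i => l 0 i) (row i0 V) aA (Ai _ i0Z).
have -> : row i0 V + \sum_(i <- enum Z) l 0 i *: (row i V - row i0 V) = x.
  rewrite big_enum /=.
  have -> : \sum_(i in Z) l 0 i *: (row i V - row i0 V) =
      \sum_i l 0 i *: (row i V - row i0 V).
    rewrite [RHS](bigID (mem Z)) /= [X in _ = _ + X]big1 ?addr0 // => i /lZ ->.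
    by rewrite scale0r.
  under eq_bigr do rewrite scalerBr.
  by rewrite sumrB -scaler_suml l1 lx scale1r subrKC.
by apply=> i; rewrite mem_enum; exact: Ai.
Qed.

Lemma mem_span_rows k (K : 'M[R]_(k, n)) (u : 'rV[R]_n) :
  (u \in <<[seq row i K | i <- enum 'I_k]>>%VS) = (u <= K)%MS.
Proof.
apply/idP/idP=> [/coord_span ->|/submxP[l ->]]; last first.
  rewrite mulmx_sum_row memv_suml // => i _; rewrite memvZ // memv_span //.
  by apply/mapP; exists i; rewrite ?mem_enum.
rewrite summx_sub // => i _; rewrite scalemx_sub //.
have /mapP[j _ ->] : [tuple of [seq row i K | i <- enum 'I_k]]`_i \in
   [seq row i K | i <- enum 'I_k] by rewrite mem_nth // size_tuple.
exact: row_sub.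
Qed.

Lemma cvx0 V Z : cvx V Z = classical_sets.set0 -> Z = set0.
Proof.
move=> c0; apply/setP=> i; rewrite inE; apply/negP=> /(cvx_row V).
by rewrite c0.
Qed.

Lemma hmgD x (u : 'rV[R]_n) : hmg (x + u) = hmg x + row_mx u 0.
Proof. by rewrite /hmg add_row_mx addr0. Qed.

Lemma rk_aff V Z x (U : {vspace 'rV[R]_n}) :
  aff_hull (cvx V Z) = [set x + u | u in [set` U]]%classic -> rk V Z = (\dim U).+1.
Proof.
rewrite aff_hull_cvx => aE.
have xZ : (hmg x <= spn V Z)%MS.
  have : [set x + u | u in [set` U]]%classic x by exists 0; rewrite /= ?mem0v ?addr0.
  by rewrite -aE.
have UE (u : 'rV[R]_n) : (u \in U) = (row_mx u 0 <= spn V Z)%MS.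
  have xu : (hmg (x + u) <= spn V Z)%MS = (row_mx u 0 <= spn V Z)%MS.
    rewrite hmgD; apply/idP/idP=> h; last exact: addmx_sub.
    by rewrite -[row_mx u 0](addKr (hmg x)) addmx_sub // eqmx_opp.
  rewrite -xu; apply/idP/idP=> [uU|h].
    have : [set x + u | u in [set` U]]%classic (x + u) by exists u.
    by rewrite -aE.
  have : [set x + u | u in [set` U]]%classic (x + u) by rewrite -aE.
  by case=> u' u'U /addrI <-.
pose B := \matrix_(i < \dim U) (vbasis U)`_i.
have fB : row_free B.
  rewrite -kermx_eq0; apply/rowV0P=> c /sub_kermxP; rewrite mulmx_sum_row => cB.
  have /freeP/(_ (fun i => c 0 i)) := basis_free (vbasisP U).
  move=> fU; apply/rowP=> i; rewrite mxE; apply: fU.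
  by rewrite -[RHS]cB; apply: eq_bigr => j _; rewrite rowK.
have E : (spn V Z :=: hmg x + row_mx B (0 : 'M_(_, 1)))%MS.
  apply/eqmxP; apply/andP; split; last first.
    rewrite addsmx_sub xZ /=; apply/row_subP=> i; rewrite row_row_mx row0 -UE rowK.
    by apply: vbasis_mem; rewrite mem_nth // size_tuple.
  apply/spn_subP=> i /(row_sub_spn V).
  rewrite -[row i V](subrKC x) hmgD => iZ.
  rewrite addmx_sub_adds //.
  have : row i V - x \in U.
    rewrite UE; move: iZ => h; rewrite -[row_mx _ 0](addKr (hmg x)) addmx_sub //.
    by rewrite eqmx_opp.
  move=> /coord_vbasis ->.
  set l := \row_j coord (vbasis U) j (row i V - x).
  have -> : \sum_(j < \dim U) coord (vbasis U) j (row i V - x) *: (vbasis U)`_j = l *m B.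
    by rewrite mulmx_sum_row; apply: eq_bigr => j _; rewrite mxE rowK.
  by apply/submxP; exists l; rewrite mul_mx_row mulmx0.
rewrite /rk E mxrank_disjoint_sum; last first.
  apply/eqP/rowV0P=> y; rewrite sub_capmx => /andP[/sub_rVP[a ->] /submxP[l]].
  rewrite mul_mx_row mulmx0 /hmg scale_row_mx => /eq_row_mx[_ /eqP].
  by rewrite scaler_eq0 oner_eq0 orbF => /eqP ->; rewrite !scale0r row_mx0.
rewrite rank_row_mx0 (eqnP fB) rank_rV.
have -> : hmg x != 0; last by rewrite add1n.
apply/eqP; rewrite -[RHS]row_mx0 => /eq_row_mx[_ /eqP]; by rewrite oner_eq0.
Qed.

Lemma has_dim_cvx V Z (d : int) : has_dim (cvx V Z) d <-> (rk V Z)%:Z = d + 1.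
Proof.
split=> [[[/cvx0 -> ->]|[x [U [/rk_aff -> ->]]]]|].
- by rewrite /rk spn0 mxrank0.
- by rewrite -addn1 PoszD.
have [Z0|[i iZ]] := set_0Vmem Z.
  rewrite Z0 /rk spn0 mxrank0 => d1; left; split; last by lia.
  apply/seteqP; split=> // x [l [_ l0 /mul_homP[]]].
  rewrite big1 => [/eqP|j _]; first by rewrite eq_sym oner_eq0.
  by rewrite l0 ?inE.
move=> rd; right; exists (row i V).
(* The directions of the affine hull: the u for which (u, 0) lies in the homogeneous span. *)
pose K := lsubmx (spn V Z :&: kermx (col_mx 0 1 : 'M_(n + 1, 1)))%MS.
have KE (u : 'rV[R]_n) : (u <= K)%MS = (row_mx u 0 <= spn V Z)%MS.
  set S := (spn V Z :&: _)%MS in K *.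
  have SE : S = row_mx K (0 : 'M_(_, 1)).
    have : S *m (col_mx 0 1 : 'M_(n + 1, 1)) = 0.
      by apply/sub_kermxP; exact: capmxSr.
    rewrite -[S]hsubmxK mul_row_col mulmx0 add0r mulmx1 -/K => ->.
    by [].
  transitivity (row_mx u (0 : 'M_1) <= S)%MS.
    rewrite SE; apply/submxP/submxP=> -[l lE]; exists l.
      by rewrite mul_mx_row mulmx0 lE.
    by move: lE; rewrite mul_mx_row => /eq_row_mx[].
  rewrite sub_capmx andbC (_ : (_ <= kermx _)%MS) //.
  by apply/sub_kermxP; rewrite mul_row_col mulmx0 mul0mx addr0.
have aE : aff_hull (cvx V Z) = [set row i V + u | u in
    [set` <<[seq row i K | i <- enum 'I_(n + 1)]>>%VS]]%classic.
  rewrite aff_hull_cvx; apply/seteqP; split=> [x /= xZ|_ /= [u + <-]].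
    exists (x - row i V); last by rewrite subrKC.
    rewrite /= mem_span_rows KE.
    rewrite -[row_mx _ 0](addKr (hmg (row i V))) -hmgD subrKC addmx_sub //.
    by rewrite eqmx_opp row_sub_spn.
  by rewrite mem_span_rows KE hmgD => uZ; rewrite addmx_sub // row_sub_spn.
exists <<[seq row i K | i <- enum 'I_(n + 1)]>>%VS; split=> //.
by move: rd; rewrite (rk_aff aE); lia.
Qed.

End Rows.
End Hull.

(** * The face lattice *)

Lemma card_le_image_finset (T : finType) (U : Type) (A : {set T}) (f : T -> U) m :
  {in A &, injective f} -> (f @` [set` A] #<= `I_m)%classic%card = (#|A| <= m)%N.
Proof.
move=> fI; rewrite -card_le_II; apply: card_le_eql.
have -> : (f @` [set` A] = range (fun i : 'I_#|A| => f (enum_val i)))%classic.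
  apply/seteqP; split=> [_ [x /= xA <-]|_ [i _ <-]]; last first.
    by exists (enum_val i) => //=; exact: enum_valP.
  by exists (enum_rank_in xA x); rewrite ?enum_rankK_in.
apply: card_eq_trans (card_esym card_II); apply: inj_card_eq => i j _ _ ij.
by apply/enum_val_inj/fI; rewrite ?enum_valP.
Qed.

Section Faces.
Variables (R : realType).

Section Fix.
Variables (n N : nat) (V : 'M[R]_(N, n)).
Implicit Types (x : 'rV[R]_n) (w : 'cV[R]_(n + 1)) (Z : {set 'I_N}).

Definition facial Z : Prop :=
  exists w, nonneg (hom V *m w) /\ Z = ~: supp (hom V *m w).

(** Since the index set [[set i]] itself is cut out, the rows are distinct as well as vertices. *)
Definition vertexial : Prop := forall i, facial [set i].

Definition facet_supps : {set {set 'I_N}} :=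
  [set Z | `[< facial Z >] && ((rk V Z).+1 == rk V setT)].

Lemma hmg_hom x w (l : 'rV[R]_N) : l *m hom V = hmg x ->
  (hmg x *m w) 0 0 = \sum_i l 0 i * (hom V *m w) i 0.
Proof. by move=> <-; rewrite -mulmxA mxE. Qed.

Lemma cvx_facial w : nonneg (hom V *m w) ->
  cvx V (~: supp (hom V *m w)) =
  (cvx V setT `&` [set x | (hmg x *m w) 0 0 = 0])%classic.
Proof.
move=> w0; apply/seteqP; split=> x.
  move=> xZ; split; first exact: sub_cvx xZ.
  case: xZ => l [l0 lZ lx]; rewrite /= (hmg_hom _ lx) big1 // => i _.
  have [iZ|] := boolP (i \in supp (hom V *m w)); last first.
    by rewrite inE negbK => /eqP->; rewrite mulr0.
  by rewrite lZ ?mul0r // inE iZ.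
case=> -[l [l0 lZ lx]] /=; rewrite (hmg_hom _ lx) => /eqP.
rewrite psumr_eq0 => [/allP h|i _]; last exact: mulr_ge0.
exists l; split=> // i; rewrite in_setC negbK inE => ui.
by have := h i (mem_index_enum _); rewrite /= mulf_eq0 (negPf ui) orbF => /eqP.
Qed.

Lemma face_cvx Z : facial Z -> face (cvx V setT) (cvx V Z).
Proof.
case=> w [w0 ->]; rewrite (cvx_facial w0).
exists (- usubmx w), (dsubmx w 0 0).
have wE x : (hmg x *m w) 0 0 = dsubmx w 0 0 - dotp x (- usubmx w).
  by rewrite -{1}[w]vsubmxK hmg_dot /dotp mulmxN [X in _ - X]mxE opprK addrC.
split=> [x [l [l0 lZ lx]]|].
  by rewrite -subr_ge0 -wE (hmg_hom _ lx) sumr_ge0 // => i _; rewrite mulr_ge0.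
apply/seteqP; split=> x [xP] /=.
  by rewrite wE => /eqP; rewrite subr_eq0 eq_sym => /eqP.
by rewrite wE => ->; rewrite subrr.
Qed.

Lemma faceP F : face (cvx V setT) F -> exists2 Z, facial Z & F = cvx V Z.
Proof.
case=> c [b [cb ->]]; pose w := col_mx (- c) b%:M.
have wE x : (hmg x *m w) 0 0 = b - dotp x c.
  by rewrite hmg_dot /dotp mulmxN !mxE eqxx mulr1n addrC.
have w0 : nonneg (hom V *m w).
  by move=> i; rewrite homE wE subr_ge0 cb //; apply: cvx_row; rewrite inE.
exists (~: supp (hom V *m w)); first by exists w.
rewrite (cvx_facial w0); apply/seteqP; split=> x [xP] /=; rewrite wE.
  by move=> ->; rewrite subrr.
by move=> /eqP; rewrite subr_eq0 eq_sym => /eqP.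
Qed.

Lemma facial_row Z i : facial Z -> cvx V Z (row i V) <-> i \in Z.
Proof.
case=> w [w0 ->]; split; last exact: cvx_row.
by rewrite (cvx_facial w0) => -[_ /=]; rewrite -homE !inE negbK => ->.
Qed.

Lemma facial_sub Z1 Z2 : facial Z2 -> (cvx V Z1 `<=` cvx V Z2)%classic <-> Z1 \subset Z2.
Proof.
move=> Z2f; split=> [s|]; last exact: sub_cvx.
by apply/subsetP=> i iZ; apply/(facial_row i Z2f)/s/cvx_row.
Qed.

Lemma facial_inj Z1 Z2 : facial Z1 -> facial Z2 -> cvx V Z1 = cvx V Z2 -> Z1 = Z2.
Proof.
move=> f1 f2 E; apply/eqP; rewrite eqEsubset; apply/andP.
by split; [apply/(facial_sub Z1 f2)|apply/(facial_sub Z2 f1)]; rewrite E.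
Qed.

Lemma cvx_set0 : cvx V set0 = classical_sets.set0.
Proof.
apply/seteqP; split=> // x [l [_ lZ /mul_homP[]]].
rewrite big1 => [/eqP|i _]; first by rewrite eq_sym oner_eq0.
by rewrite lZ ?inE.
Qed.

Lemma cvx_set1 i : cvx V [set i] = [set row i V]%classic.
Proof.
apply/seteqP; split=> [x|_ ->]; last by apply: cvx_row; rewrite inE.
case=> l [_ lZ /mul_homP[l1 lx]] /=.
have l0 j : j != i -> l 0 j = 0 by move=> ji; rewrite lZ // inE.
rewrite -lx (bigD1 i) //= big1 => [|j /l0 ->]; last by rewrite scale0r.
rewrite addr0; move: l1; rewrite (bigD1 i) //= big1 => [|j /l0 //].
by rewrite addr0 => ->; rewrite scale1r.
Qed.

Lemma facialT : facial setT.
Proof.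
exists 0; rewrite mulmx0; split=> [i|]; first by rewrite mxE.
by apply/setP=> i; rewrite !inE mxE eqxx.
Qed.

Lemma facial0 : facial set0.
Proof.
have E i : (hom V *m col_mx 0 1) i 0 = 1.
  by rewrite homE hmg_dot /dotp mulmx0 !mxE add0r.
exists (col_mx 0 1); split=> [i|]; first by rewrite E.
by apply/setP=> i; rewrite !inE E oner_eq0.
Qed.

Lemma vertices_cvx v : vertices (cvx V setT) v -> exists i, v = row i V.
Proof.
case/faceP=> Z _ E; have [Z0|[i iZ]] := set_0Vmem Z.
  by have : [set v]%classic v by []; rewrite E Z0 cvx_set0.
by exists i; have := cvx_row V iZ; rewrite -E.
Qed.

Lemma vertexial_vertex i : vertexial -> vertices (cvx V setT) (row i V).
Proof. by move=> Vv; rewrite /vertices /= -cvx_set1; exact: face_cvx. Qed.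

Lemma vertexial_inj : vertexial -> injective (fun i => row i V).
Proof.
move=> Vv i j ij; apply/esym/eqP; rewrite -in_set1; apply/(facial_row _ (Vv i)).
by rewrite -ij; apply: cvx_row; rewrite inE.
Qed.

Lemma card_vertices m : vertexial -> (vertices (cvx V setT) #<= `I_m)%card = (N <= m)%N.
Proof.
move=> Vv; rewrite -[X in (X <= m)%N]card_ord -cardsT.
have -> : vertices (cvx V setT) = ((fun i => row i V) @` [set` [set: 'I_N]%SET])%classic.
  apply/seteqP; split=> [v /vertices_cvx[i ->]|_ [i _ <-]]; last exact: vertexial_vertex.
  by exists i; rewrite //= inE.
by apply: card_le_image_finset; apply: in2W; exact: vertexial_inj.
Qed.

Lemma facets_cvxP F : facets (cvx V setT) F <->
  exists2 Z, Z \in facet_supps & F = cvx V Z.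
Proof.
split=> [[/faceP[Z Zf ->] [d [/has_dim_cvx dV /has_dim_cvx dZ]]]|[Z]].
  exists Z => //; rewrite inE; apply/andP; split; first exact/asboolP.
  by apply/eqP; lia.
rewrite inE => /andP[/asboolP Zf /eqP rZ] ->; split; first exact: face_cvx.
exists ((rk V setT)%:Z - 1); split; apply/has_dim_cvx; lia.
Qed.

Lemma card_facets m : (facets (cvx V setT) #<= `I_m)%card = (#|facet_supps| <= m)%N.
Proof.
have -> : facets (cvx V setT) = (cvx V @` [set` facet_supps])%classic.
  by apply/seteqP; split=> F; [case/facets_cvxP=> Z ? ->; exists Z |
    case=> Z ? <-; apply/facets_cvxP; exists Z].
apply: card_le_image_finset => Z1 Z2; rewrite !inE.
by move=> /andP[/asboolP ? _] /andP[/asboolP ? _]; exact: facial_inj.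
Qed.

Lemma cvx_polytope Z : polytope (cvx V Z).
Proof.
exists [seq row i V | i <- enum Z]; apply/esym/conv_hull_rows => x /=; split.
  by case/mapP=> i; rewrite mem_enum; exists i.
by case=> i iZ ->; apply/mapP; exists i; rewrite ?mem_enum.
Qed.

End Fix.

Lemma polytope_cvx n (P : set 'rV[R]_n) : polytope P ->
  exists N (V : 'M[R]_(N, n)), P = cvx V setT.
Proof.
case=> s ->; exists (size s), (\matrix_i s`_i); apply: conv_hull_rows => x /=.
split=> [xs|[i _ ->]]; last by rewrite rowK mem_nth.
have lt : (index x s < size s)%N by rewrite index_mem.
by exists (Ordinal lt); rewrite ?inE // rowK nth_index.
Qed.

(** Take a generating list of least length. By Farkas' lemma a point that is not exposed lies in the
    hull of the others and could be dropped. *)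
Lemma polytope_vertexial n (P : set 'rV[R]_n) : polytope P ->
  exists N (V : 'M[R]_(N, n)), vertexial V /\ P = cvx V setT.
Proof.
move=> /polytope_cvx[N0 [V0 PV0]].
pose Q N := `[< exists V : 'M[R]_(N, n), P = cvx V setT >].
have [|N /asboolP[V PV] Nmin] := @ex_minnP Q.
  by exists N0; apply/asboolP; exists V0.
exists N, V; split=> // i.
have [[l [l0 lA]]|[y [y0 yb]]] := farkas (spn V (~: [set i])) (hmg (row i V)).
  have iV : cvx V (~: [set i]) (row i V).
    exists (\row_j if j == i then 0 else l 0 j); split=> [j|j|].
    - by rewrite mxE; case: ifP.
    - by rewrite inE negbK inE mxE => ->.
    - rewrite -lA; apply/rowP=> k; rewrite !mxE; apply: eq_bigr => j _.
      by rewrite !mxE !inE; case: eqP => _; rewrite ?mul0r ?mulr0.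
  clear l l0 lA; case: N V PV Nmin i iV => [|N] V PV Nmin i iV; first by case: (i).
  suff /Nmin : Q N by rewrite ltnn.
  apply/asboolP; exists (row' i V).
  pose A := [set x | exists2 j, j \in ~: [set i] & x = row j V]%classic.
  transitivity (cvx V (~: [set i])).
    rewrite PV; apply/seteqP; split; last exact/sub_cvx/subsetT.
    rewrite -(@conv_hull_rows _ _ _ V setT [set x | exists2 j, j \in setT & x = row j V]%classic) //.
    apply: smallest_sub; first exact: convex_cvx.
    move=> x /= [j _ ->]; have [-> //|ji] := eqVneq j i.
    by apply: cvx_row; rewrite !inE.
  rewrite -(@conv_hull_rows _ _ _ V _ A) //; apply: conv_hull_rows => x.
  split=> [[j]|[j _ ->]].
    rewrite !inE eq_sym => ij ->; have [k ->] := unlift_some ij.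
    move=> _; exists k => //.
    by apply/rowP=> m; rewrite !mxE.
  exists (lift i j); first by rewrite !inE eq_sym neq_lift.
  by apply/rowP=> m; rewrite !mxE.
(* [b] is the negative value of the separating functional at point i; subtracting it as a constant
   gives 0 at i and positive values elsewhere. *)
set b := (_ *m y) 0 0 in yb; pose w := y - b *: col_mx 0 1.
have E j : (hom V *m w) j 0 = (hom V *m y) j 0 - b.
  rewrite /w mulmxBr -scalemxAr [LHS]mxE; congr (_ + _).
  rewrite [LHS]mxE [X in - X]mxE; congr (- _).
  by rewrite homE hmg_dot /dotp mulmx0 !mxE add0r mulr1.
have Ei : (hom V *m w) i 0 = 0 by rewrite E homE subrr.
have Ej j : j != i -> 0 < (hom V *m w) j 0.
  move=> ji; rewrite E subr_gt0 (lt_le_trans yb) //.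
  by have := y0 j; rewrite mul_spn !inE ji.
exists w; split=> [j|].
  by have [->|/Ej/ltW//] := eqVneq j i; rewrite Ei.
apply/setP=> j; rewrite !inE negbK; have [->|/Ej ej] := eqVneq j i.
  by rewrite Ei eqxx.
by rewrite gt_eqF.
Qed.

Lemma comb_equiv_facial N m n (V : 'M[R]_(N, m)) (V' : 'M[R]_(N, n)) :
  (forall Z, facial V Z <-> facial V' Z) -> comb_equiv (cvx V setT) (cvx V' setT).
Proof.
move=> VV'.
pose phi (F : set 'rV[R]_m) := cvx V' [set i | `[< F (row i V) >]].
have phiE Z : facial V Z -> phi (cvx V Z) = cvx V' Z.
  move=> Zf; congr cvx; apply/setP=> i; rewrite inE.
  by apply/asboolP/idP => [/(facial_row _ Zf)//|/(facial_row _ Zf)].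
exists phi; split; first split.
- by move=> F /faceP[Z Zf ->]; rewrite phiE //; apply/face_cvx/VV'.
- move=> F G; rewrite !in_setE => /faceP[Z Zf ->] /faceP[Y Yf ->].
  by rewrite !phiE // => /facial_inj -> //; apply/VV'.
- move=> F /faceP[Z Zf ->]; exists (cvx V Z); first by apply/face_cvx/VV'.
  by rewrite phiE //; apply/VV'.
- move=> F G /faceP[Z Zf ->] /faceP[Y Yf ->]; rewrite !phiE //.
  have Yf' : facial V' Y by apply/VV'.
  by split=> [/(facial_sub Z Yf)|/(facial_sub Z Yf')]; exact: sub_cvx.
Qed.

End Faces.

(** * Ranks of faces and the bound for polytopes that are not pyramids *)

Section Rank.
Variables (R : realType) (n N : nat) (V : 'M[R]_(N, n)).
Implicit Types (w : 'cV[R]_(n + 1)) (Z Y : {set 'I_N}).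

Lemma rk_sep Z Y : (rk V Z < rk V Y)%N ->
  exists w, (forall i, i \in Z -> (hom V *m w) i 0 = 0) /\
    exists2 i, i \in Y & (hom V *m w) i 0 != 0.
Proof.
move=> lt.
have : ~~ (spn V Y <= spn V Z)%MS.
  by apply: contraL lt => /mxrankS; rewrite -leqNgt.
rewrite submxE => nz.
have [i [k ki]] := mx_neq0 nz.
exists (col k (cokermx (spn V Z))).
have E Y' j : (spn V Y' *m cokermx (spn V Z)) j k =
    (spn V Y' *m col k (cokermx (spn V Z))) j 0.
  by rewrite !mxE; apply: eq_bigr => l _; rewrite !mxE.
split=> [j jZ|].
  by have := E Z j; rewrite mulmx_coker mxE mul_spn jZ.
move: ki; rewrite E mul_spn; case: ifP => [iY ki|]; last by rewrite eqxx.
by exists i.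
Qed.

Lemma rk_lt Z Y w i : Z \subset Y -> (forall j, j \in Z -> (hom V *m w) j 0 = 0) ->
  i \in Y -> (hom V *m w) i 0 != 0 -> (rk V Z < rk V Y)%N.
Proof.
move=> ZY wZ iY wi; apply: rank_ltmx; rewrite /ltmx spnS //=.
apply: contra wi => /(submx_trans (row_sub_spn V iY)) /submxP[D DE].
rewrite homE DE -mulmxA; have -> : spn V Z *m w = 0.
  by apply/colP=> j; rewrite mul_spn [RHS]mxE; case: ifP => // jZ; exact: wZ.
by rewrite mulmx0 mxE.
Qed.

Lemma rkU1 Z i : (rk V (i |: Z) <= (rk V Z).+1)%N.
Proof.
have : (spn V (i |: Z) <= hmg (row i V) + spn V Z)%MS.
  apply/spn_subP=> j /setU1P[->|jZ]; first exact: addsmxSl.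
  exact: submx_trans (row_sub_spn V jZ) (addsmxSr _ _).
move/mxrankS/leq_trans; apply; apply: leq_trans (mxrank_adds_leqif _ _).1 _.
by rewrite -[(rk V Z).+1]add1n leq_add2r rank_leq_row.
Qed.

Lemma facial_rk_lt Z Y : facial V Z -> Z \proper Y -> (rk V Z < rk V Y)%N.
Proof.
case=> w [w0 ->] /properP[ZY [i iY]]; rewrite !inE negbK => wi.
by apply: (rk_lt ZY _ iY wi) => j; rewrite !inE negbK => /eqP.
Qed.

(** A face of a face is a face: adding a large multiple [K] of the functional that exposes Z makes
    all points outside Z positive. *)
Lemma facial_in Z w : facial V Z -> (forall i, i \in Z -> 0 <= (hom V *m w) i 0) ->
  facial V [set i in Z | (hom V *m w) i 0 == 0].
Proof.
case=> wZ [wZ0 ->] w0; set Z0 := ~: _ in w0 *.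
pose K := 1 + \sum_i `|(hom V *m w) i 0| / (hom V *m wZ) i 0.
have E i : (hom V *m (w + K *: wZ)) i 0 = (hom V *m w) i 0 + K * (hom V *m wZ) i 0.
  by rewrite mulmxDr -scalemxAr mxE [X in _ + X]mxE.
have EZ i : i \in Z0 -> (hom V *m (w + K *: wZ)) i 0 = (hom V *m w) i 0.
  by rewrite E !inE negbK => /eqP ->; rewrite mulr0 addr0.
have EnZ i : i \notin Z0 -> 0 < (hom V *m (w + K *: wZ)) i 0.
  rewrite !inE negbK E => wi; have wp : 0 < (hom V *m wZ) i 0.
    by rewrite lt_neqAle eq_sym wi wZ0.
  rewrite -ltrBlDl sub0r; apply: (@le_lt_trans _ _ `|(hom V *m w) i 0|).
    by rewrite -normrN ler_norm.
  rewrite -ltr_pdivrMr // /K ltr_pwDl // (bigD1 i) //= lerDl sumr_ge0 // => j _.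
  by rewrite divr_ge0.
exists (w + K *: wZ); split=> [i|].
  by have [iZ|/EnZ/ltW //] := boolP (i \in Z0); rewrite EZ // w0.
apply/setP=> i; rewrite in_set [RHS]in_setC [in RHS]inE negbK.
have [iZ|iZ] := boolP (i \in Z0); first by rewrite EZ.
by rewrite (gt_eqF (EnZ _ iZ)).
Qed.

(** Take a proper subface Y of largest rank. If its rank were smaller by two or more, the functional
    exposing Y could be tilted until one more point of Z becomes zero, giving a larger proper
    subface. *)
Lemma facial_subfacet Z : facial V Z -> (0 < rk V Z)%N ->
  exists Y, [/\ facial V Y, Y \subset Z & (rk V Y).+1 = rk V Z].
Proof.
move=> Zf rZ.
pose Q := [pred Y : {set 'I_N} | `[< facial V Y >] && (Y \proper Z)].
have Q0 : Q set0.
  apply/andP; split; first by apply/asboolP/facial0.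
  by rewrite proper0; apply: contraTneq rZ => ->; rewrite /rk spn0 mxrank0.
have [Y /andP[/asboolP Yf YZ] Ymax] := @arg_maxnP _ _ Q (rk V) Q0.
have := facial_rk_lt Yf YZ; rewrite leq_eqVlt => /orP[/eqP rE|lt].
  by exists Y; split=> //; exact: proper_sub.
have [w [w0 YE]] := Yf.
have [YsZ [i0 i0Z i0Y]] := properP YZ.
have ui0 : (hom V *m w) i0 0 != 0 by move: i0Y; rewrite YE !inE negbK.
(* The gap of two in rank lets the tilting direction vanish at [i0] as well; [i0] then stays outside
   the new face, which is therefore proper. *)
have [w1 [w1Y w1Z]] := rk_sep (leq_ltn_trans (rkU1 Y i0) lt).
have [w' [w'Y [i iZ w'i]]] : exists w', (forall j, j \in i0 |: Y -> (hom V *m w') j 0 = 0) /\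
    exists2 i, i \in Z & (hom V *m w') i 0 < 0.
  have [i iZ wi] := w1Z; have [neg|pos] := ltP ((hom V *m w1) i 0) 0.
    by exists w1; split=> //; exists i.
  exists (- w1); split=> [j jY|]; first by rewrite mulmxN mxE w1Y // oppr0.
  by exists i => //; rewrite mulmxN mxE oppr_lt0 lt_neqAle eq_sym wi.
have [j|j||t [t0 tn [j [w'j uj tj]]]] := @perturb _ _ (spn V Z *m w) (spn V Z *m w').
- by rewrite mul_spn; case: ifP.
- rewrite !mul_spn; case: ifP => // jZ wj; rewrite w'Y // in_setU1 orbC YE !inE.
  by rewrite wj eqxx.
- by exists i; rewrite mul_spn iZ.
have jZ : j \in Z by move: w'j; rewrite mul_spn; case: ifP; rewrite ?ltxx.
have E k : k \in Z -> (hom V *m (w + t *: w')) k 0 =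
    (spn V Z *m w + t *: (spn V Z *m w')) k 0.
  move=> kZ; rewrite mulmxDr -scalemxAr [LHS]mxE [RHS]mxE [X in _ = X + _]mul_spn kZ.
  by congr (_ + _); rewrite [LHS]mxE [RHS]mxE mul_spn kZ.
pose Y' := [set k in Z | (hom V *m (w + t *: w')) k 0 == 0].
have Y'f : facial V Y' by apply: facial_in => // k kZ; rewrite E.
have i0Y' : i0 \notin Y'.
  rewrite inE i0Z /= mulmxDr -scalemxAr mxE [X in _ + X]mxE w'Y ?setU11 //.
  by rewrite mulr0 addr0.
have QY' : Q Y'.
  apply/andP; split; first exact/asboolP.
  apply/properP; split; last by exists i0.
  by apply/subsetP=> k; rewrite inE => /andP[].
have YY' : Y \proper Y'.
  apply/properP; split; last first.
    exists j; first by rewrite inE jZ E // tj eqxx.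
    by move: uj; rewrite YE mul_spn jZ !inE negbK.
  apply/subsetP=> k kY; rewrite inE (subsetP YsZ) //= mulmxDr -scalemxAr mxE.
  rewrite [X in _ + X]mxE w'Y ?in_setU1 ?kY ?orbT // mulr0 addr0.
  by move: kY; rewrite YE !inE negbK.
by have := leq_ltn_trans (Ymax _ QY') (facial_rk_lt Yf YY'); rewrite ltnn.
Qed.

Lemma rk_rowsub k (f : 'I_k -> 'I_N) (Z : {set 'I_k}) :
  rk (rowsub f V) Z = rk V (f @: Z).
Proof.
have rE i : row i (rowsub f V) = row (f i) V by apply/rowP=> j; rewrite !mxE.
rewrite /rk; suff -> : (spn (rowsub f V) Z :=: spn V (f @: Z))%MS by [].
apply/eqmxP/andP; split; apply/spn_subP=> i.
  by move=> iZ; rewrite rE row_sub_spn // imset_f.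
by case/imsetP=> j jZ ->; rewrite -rE row_sub_spn.
Qed.

Lemma hom_rowsub k (f : 'I_k -> 'I_N) w i :
  (hom (rowsub f V) *m w) i 0 = (hom V *m w) (f i) 0.
Proof. by rewrite !homE; congr ((hmg _ *m _) _ _); apply/rowP=> j; rewrite !mxE. Qed.

Lemma pyramid_sep i w : vertexial V -> (1 < N)%N -> (hom V *m w) i 0 != 0 ->
  (forall j, j != i -> (hom V *m w) j 0 = 0) -> pyramid (cvx V setT).
Proof.
move=> Vv N1 wi wj.
have wE x : (hmg x *m w) 0 0 = dotp x (usubmx w) - (- dsubmx w 0 0).
  by rewrite -{1}[w]vsubmxK hmg_dot opprK.
exists (row i V), (usubmx w), (- dsubmx w 0 0); split.
- exact: vertexial_vertex.
- apply/eqP=> c0; have [j ji] : exists j, j != i.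
    have : (0 < #|~: [set i]|)%N by rewrite cardsC1 card_ord; case: (N) N1 => [|[]].
    by case/card_gt0P=> j; rewrite !inE => ji; exists j.
  move: (wj j ji) wi; rewrite !homE !wE c0 /dotp !mulmx0 => ->.
  by rewrite eqxx.
- by move=> E; move: wi; rewrite homE wE E subrr eqxx.
move=> v /vertices_cvx[j ->] ji; apply/eqP; rewrite -subr_eq0 -wE -homE wj //.
by apply: contra_not_neq ji => ->.
Qed.

Lemma pyramid_sepP : vertexial V -> pyramid (cvx V setT) ->
  exists i w, (hom V *m w) i 0 != 0 /\ forall j, j != i -> (hom V *m w) j 0 = 0.
Proof.
move=> Vv [_ [c [b [/vertices_cvx[i ->] c0 ib jb]]]].
exists i, (col_mx c (- b)%:M).
have wE j : (hom V *m col_mx c (- b)%:M) j 0 = dotp (row j V) c - b.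
  by rewrite homE hmg_dot mxE eqxx mulr1n.
split=> [|j ji]; rewrite wE ?subr_eq0; first exact/eqP.
rewrite jb ?subrr //; first exact: vertexial_vertex.
by move/(vertexial_inj Vv)/eqP; apply/negP.
Qed.

(** Pair a dependence whose only possible positive coordinate is i with the functional exposing
    vertex i: all terms are nonpositive and sum to zero, so the other coordinates vanish, and then
    so does the one at i. If all dependences vanish at i, some functional is nonzero at i only,
    which makes i an apex. *)
Lemma gale_vertexial : vertexial V -> (1 < N)%N -> ~ pyramid (cvx V setT) ->
  gale (kermx (hom V)) setT.
Proof.
move=> Vv N1 nP; split=> [phi /sub_kermxP pV pn0|i _].
  rewrite ltnNge; apply/negP=> le1.
  have [i jP] := positives_le1 pn0 le1.
  have [w [w0 wE]] := Vv i.
  have wi : (hom V *m w) i 0 = 0.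
    by have := set11 i; rewrite wE !inE negbK => /eqP.
  have wj j : j != i -> (hom V *m w) j 0 != 0.
    by move=> ji; have := in_set1 j i; rewrite wE !inE (negPf ji) => /negbFE.
  have : (phi *m (hom V *m w)) 0 0 = 0 by rewrite mulmxA pV mul0mx mxE.
  rewrite mxE => /eqP; rewrite -oppr_eq0 -sumrN psumr_eq0 => [/allP h|j _]; last first.
    have [->|ji] := eqVneq j i; first by rewrite wi mulr0 oppr0.
    by rewrite oppr_ge0 mulr_le0_ge0 // jP.
  have pj j : j != i -> phi 0 j = 0.
    move=> ji; have := h j (mem_index_enum _).
    by rewrite /= oppr_eq0 mulf_eq0 (negPf (wj _ ji)) orbF => /eqP.
  case/eqP: pn0; apply/rowP=> j; rewrite mxE; have [->|/pj //] := eqVneq j i.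
  have : phi *m hom V = 0 by [].
  move/(congr1 (fun A : 'rV_(n + 1) => (A *m col_mx 0 1) 0 0)).
  rewrite mul0mx -mulmxA mxE (bigD1 i) //= big1 => [|k /pj ->]; last by rewrite mul0r.
  by rewrite homE hmg_dot /dotp mulmx0 !mxE add0r mulr1 addr0.
apply: contrapT => nphi; apply: nP.
have [|w wE] := (kermx_ortho (hom V) (delta_mx i 0)).1.
  apply/orthoP=> phi pL; apply/rowP=> k; rewrite -colE !mxE.
  by apply/eqP; apply: contraT => pj; case: nphi; exists phi.
apply: (@pyramid_sep i w) => // [|j ji]; rewrite -wE mxE ?eqxx ?oner_eq0 //.
by rewrite (negPf ji).
Qed.

(** If the face had codimension two or more, tilting its functional by one that also vanishes at a
    chosen i in C would give a smaller support that still contains i. *)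
Lemma circuit_facet C : circuit (kermx (hom V)) C -> ~: C \in facet_supps V.
Proof.
case/circuitP=> u [/kermx_ortho[w uE] u0 su un0 umin]; rewrite uE in su u0 un0.
have Cf : facial V (~: C) by exists w; rewrite su.
rewrite inE; apply/andP; split; first exact/asboolP.
have [i [j0]] := mx_neq0 un0; rewrite ord1 => ui.
have iC : i \in C by rewrite -su inE.
have lt : (rk V (~: C) < rk V setT)%N.
  apply: facial_rk_lt => //; rewrite properE subsetT /=; apply/subsetPn; exists i => //.
  by rewrite inE iC.
rewrite eqn_leq lt leqNgt; apply/negP=> lt2.
have [w1 [w1C [j _ w1j]]] := rk_sep (leq_ltn_trans (rkU1 (~: C) i) lt2).
have [w' [w'C [k w'k]]] : exists w', (forall j, j \in i |: ~: C -> (hom V *m w') j 0 = 0) /\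
    exists k, (hom V *m w') k 0 < 0.
  have [neg|pos] := ltP ((hom V *m w1) j 0) 0; first by exists w1; split=> //; exists j.
  exists (- w1); split=> [l lY|]; first by rewrite mulmxN mxE w1C // oppr0.
  by exists j => //; rewrite mulmxN mxE oppr_lt0 lt_neqAle eq_sym w1j.
have [//|l||t [t0 tn [l [_ ul tl]]]] := @perturb _ _ (hom V *m w) (hom V *m w').
- by move=> wl; rewrite w'C // in_setU1 orbC inE -su inE wl eqxx.
- by exists k.
have E : hom V *m (w + t *: w') = hom V *m w + t *: (hom V *m w').
  by rewrite mulmxDr -scalemxAr.
have sC : supp (hom V *m (w + t *: w')) = C.
  apply: umin.
  - by apply/kermx_ortho; eexists.
  - by rewrite E.
  - apply/eqP=> /colP/(_ i); rewrite E mxE [X in _ + X]mxE w'C ?setU11 // mulr0 addr0.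
    by rewrite [RHS]mxE => /eqP; apply/negP; move: iC; rewrite -su inE.
  - apply/subsetP=> m; rewrite inE E; apply: contraR => mC.
    rewrite mxE [X in _ + X]mxE w'C ?in_setU1 ?in_setC ?mC ?orbT // mulr0 addr0.
    by move: mC; rewrite -su inE negbK.
have : l \in C by rewrite -su inE.
by rewrite -sC inE E tl eqxx.
Qed.

Lemma card_circuits_facets :
  (#|circuits (kermx (hom V)) setT| <= #|facet_supps V|)%N.
Proof.
rewrite -(card_imset _ (@setC_inj _)).
apply/subset_leq_card/subsetP=> _ /imsetP[C + ->].
by rewrite inE => /andP[_]; exact: circuit_facet.
Qed.

End Rank.

Theorem nonpyramid_bounds (R : realType) (n d alpha beta : nat) (P : set 'rV[R]_n) :
  dpolytope d P -> (0 < d)%N -> ~ pyramid P ->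
  (vertices P #<= `I_(d + 1 + alpha)%N)%classic%card ->
  (facets P #<= `I_(d + 1 + beta)%N)%classic%card ->
  [/\ (0 < alpha)%N, (0 < beta)%N, (d + 2 <= beta + 3 * alpha)%N &
      (d + 2 <= alpha + 3 * beta)%N].
Proof.
move=> [/polytope_vertexial[N [V [Vv ->]]] /has_dim_cvx rd] d0 nP.
rewrite card_vertices // card_facets => cN cf.
have rV : \rank (hom V) = (d + 1)%N by move: rd; rewrite /rk spnT; lia.
have N1 : (1 < N)%N by have := rank_leq_row (hom V); lia.
have [|a [b [NE fE /andP[a0 b0] h1 h2]]] :=
    gale_bounds _ (gale_vertexial Vv N1 nP) (ltnW N1).
  exists (col_mx 0 1) => i.
  by rewrite homE hmg_dot /dotp mulmx0 !mxE add0r.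
have := card_circuits_facets V; rewrite fE rV in NE h1 h2 * => cf'.
by split; lia.
Qed.

(** * Joins and pyramids *)

Section CombEquiv.
Variables (R : realType) (n m N M : nat) (V : 'M[R]_(N, n)) (W : 'M[R]_(M, m)).

Lemma comb_equiv_supp : comb_equiv (cvx V setT) (cvx W setT) ->
  exists psi : {set 'I_N} -> {set 'I_M},
  [/\ forall Z, facial V Z -> facial W (psi Z),
      forall Z Y, facial V Z -> facial V Y -> (Z \subset Y) = (psi Z \subset psi Y) &
      forall Y, facial W Y -> exists2 Z, facial V Z & psi Z = Y].
Proof.
case=> phi [[phiF _ phiS] phiO].
pose psi Z : {set 'I_M} := [set i | `[< phi (cvx V Z) (row i W) >]].
have psiE Z Y : facial W Y -> phi (cvx V Z) = cvx W Y -> psi Z = Y.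
  move=> Yf E; apply/setP=> i; rewrite inE E.
  by apply/asboolP/idP => [/(facial_row _ Yf)|/(facial_row _ Yf)].
have psiP Z : facial V Z -> facial W (psi Z) /\ phi (cvx V Z) = cvx W (psi Z).
  move=> Zf; have /faceP[Y Yf E] := phiF _ (face_cvx Zf).
  by rewrite (psiE Z Y).
exists psi; split=> [Z /psiP[]//|Z Y Zf Yf|Y Yf].
  have [Zf' ZE] := psiP Z Zf; have [Yf' YE] := psiP Y Yf.
  apply/idP/idP => [/(facial_sub _ Yf)|/(facial_sub _ Yf')].
    by move/(phiO _ _ (face_cvx Zf) (face_cvx Yf)); rewrite ZE YE => /(facial_sub _ Yf').
  rewrite -ZE -YE => /(phiO _ _ (face_cvx Zf) (face_cvx Yf)).
  by move/(facial_sub _ Yf).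
have [F /faceP[Z Zf ->] E] := phiS _ (face_cvx Yf).
by exists Z => //; exact: psiE.
Qed.

(** A face heads a chain of faces whose ranks drop by one at a time. The image chain is strict, and
    ranks strictly increase along it. *)
Lemma comb_equiv_rk : comb_equiv (cvx V setT) (cvx W setT) ->
  (rk V setT <= rk W setT)%N.
Proof.
move=> /comb_equiv_supp[psi [psiF psiO _]].
suff H Z : facial V Z -> (rk V Z <= rk W (psi Z))%N.
  exact: leq_trans (H _ (facialT V)) (rkS W (subsetT _)).
have [r] := ubnP (rk V Z); elim: r Z => // r IH Z /ltnSE rZ Zf.
have [->//|] := posnP (rk V Z) => r0.
have [Y [Yf YZ rY]] := facial_subfacet Zf r0.
rewrite -rY; apply: leq_ltn_trans (IH Y _ Yf) _; first by rewrite rY.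
apply: facial_rk_lt; first exact: psiF.
rewrite properE -!psiO // YZ /=; apply/negP=> ZY.
by have := rkS V ZY; rewrite -rY ltnn.
Qed.

(** An apex is visible in the face lattice: it is an atom, and some face contains all the other
    atoms but not this one. *)
Lemma comb_equiv_apex a : facial W [set a] -> facial W (~: [set a]) ->
  vertexial V -> (1 < N)%N -> comb_equiv (cvx V setT) (cvx W setT) ->
  pyramid (cvx V setT).
Proof.
move=> af acf Vv N1 /comb_equiv_supp[psi [psiF psiO psiS]].
have [A Af AE] := psiS _ af; have [G Gf GE] := psiS _ acf.
have [E Ef EE] := psiS _ (facial0 W).
have psi_neq0 Z : facial V Z -> Z != set0 -> psi Z != set0.
  move=> Zf; apply: contra => /eqP Z0; rewrite -subset0.
  by rewrite (psiO _ _ Zf (facial0 V)) Z0 sub0set.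
have [i iA] : exists i, i \in A.
  apply/set0Pn; apply/negP => /eqP A0.
  have : A \subset E by rewrite A0 sub0set.
  by rewrite psiO // AE EE subset0 => /eqP/setP/(_ a); rewrite !inE eqxx.
have iE : psi [set i] = [set a].
  have : [set i] \subset A by rewrite sub1set.
  rewrite psiO // AE subset1 => /orP[/eqP//|].
  by rewrite (negPf (psi_neq0 _ (Vv i) _)) //; apply/set0Pn; exists i; rewrite inE.
have iG : i \notin G.
  rewrite -sub1set psiO // iE GE sub1set !inE eqxx.
  by [].
have jG j : j != i -> j \in G.
  move=> ji; rewrite -sub1set psiO // GE; apply/subsetP=> b bj; rewrite !inE.
  apply: contra ji => /eqP ba; rewrite -in_set1 -sub1set.
  have : [set i] \subset [set j] by rewrite psiO // iE sub1set -ba.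
  by rewrite !sub1set !inE eq_sym.
have [w [w0 wE]] := Gf.
apply: (@pyramid_sep _ _ _ V i w) => //.
  by move: iG; rewrite wE !inE negbK.
by move=> j /jG; rewrite wE !inE negbK => /eqP.
Qed.

End CombEquiv.

(** * Joins in coordinates, and the passage from joins to pyramids *)

Section Join.
Variable R : realType.

Definition join_mx k m p q (A : 'M[R]_(k, p)) (B : 'M[R]_(m, q)) :
  'M[R]_(k + m, p + q + 1) :=
  col_mx (row_mx (row_mx A 0) 0) (row_mx (row_mx 0 B) (const_mx 1)).

Lemma row_join_mxl k m p q (A : 'M[R]_(k, p)) (B : 'M[R]_(m, q)) i :
  row (lshift m i) (join_mx A B) = row_mx (row_mx (row i A) 0) 0.
Proof. by rewrite rowKu !row_row_mx !row0. Qed.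

Lemma row_join_mxr k m p q (A : 'M[R]_(k, p)) (B : 'M[R]_(m, q)) i :
  row (rshift k i) (join_mx A B) = row_mx (row_mx 0 (row i B)) (const_mx 1).
Proof. by rewrite rowKd !row_row_mx !row0 row_const. Qed.

Lemma cvx_col_mx k m p (A : 'M[R]_(k, p)) (B : 'M[R]_(m, p)) (C : set 'rV[R]_p) :
  convex_set C -> (forall i, C (row i A)) -> (forall i, C (row i B)) ->
  (cvx (col_mx A B) setT `<=` C)%classic.
Proof.
move=> cC CA CB.
rewrite -(@conv_hull_rows _ _ _ _ setT
  [set x | exists2 i, i \in setT & x = row i (col_mx A B)]%classic) //.
apply: smallest_sub => // x /= [i _ ->].
by case: (split_ordP i) => j ->; rewrite ?rowKu ?rowKd.
Qed.

Lemma join_cvx k m p q (A : 'M[R]_(k, p)) (B : 'M[R]_(m, q)) :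
  join (cvx A setT) (cvx B setT) = cvx (join_mx A B) setT.
Proof.
apply/seteqP; split.
  apply: smallest_sub; first exact: convex_cvx.
  move=> _ [[x [l [l0 _ /mul_homP[l1 lx]]] <-]|[y [l [l0 _ /mul_homP[l1 ly]]] <-]].
    exists (row_mx l 0); split=> [i|i|].
    - by rewrite mxE; case: split_ordP => j _; rewrite ?mxE.
    - by rewrite inE.
    apply/mul_homP; rewrite !big_split_ord /=; split.
      rewrite -[RHS]l1 [X in _ + X]big1 ?addr0 => [|i _]; last by rewrite row_mxEr mxE.
      by apply: eq_bigr => i _; rewrite row_mxEl.
    rewrite [X in _ + X]big1 ?addr0 => [|i _]; last by rewrite row_mxEr mxE scale0r.
    under eq_bigr => i _ do rewrite row_mxEl row_join_mxl.
    rewrite -lx -!mulmx_sum_row.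
    have -> : row_mx (row_mx (l *m A) 0) 0 = l *m row_mx (row_mx A 0) 0 :> 'rV_(p + q + 1).
      by rewrite !mul_mx_row !mulmx0.
    rewrite mulmx_sum_row; apply: eq_bigr => i _.
    by rewrite !row_row_mx !row0.
  exists (row_mx 0 l); split=> [i|i|].
  - by rewrite mxE; case: split_ordP => j _; rewrite ?mxE.
  - by rewrite inE.
  apply/mul_homP; rewrite !big_split_ord /=; split.
    rewrite -[RHS]l1 [X in X + _]big1 ?add0r => [|i _]; last by rewrite row_mxEl mxE.
    by apply: eq_bigr => i _; rewrite row_mxEr.
  rewrite [X in X + _]big1 ?add0r => [|i _]; last by rewrite row_mxEl mxE scale0r.
  under eq_bigr => i _ do rewrite row_mxEr row_join_mxr.
  rewrite -ly -!mulmx_sum_row.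
  have -> : row_mx (row_mx 0 (l *m B)) (const_mx 1) =
      l *m row_mx (row_mx 0 B) (const_mx 1) :> 'rV_(p + q + 1).
    rewrite !mul_mx_row !mulmx0; congr row_mx; apply/rowP=> j; rewrite !mxE -[LHS]l1.
    by apply: eq_bigr => i _; rewrite mxE mulr1.
  rewrite mulmx_sum_row; apply: eq_bigr => i _.
  by rewrite !row_row_mx !row0 row_const.
apply: cvx_col_mx => [|i|i].
- move=> x y t; rewrite !in_setE => Jx Jy C [cC XC].
  have := cC x y t; rewrite !in_setE; apply; [exact: Jx|exact: Jy].
- move=> C [cC XC]; apply: XC; left; exists (row i A); first by apply: cvx_row; rewrite inE.
  by rewrite !row_row_mx !row0.
- move=> C [cC XC]; apply: XC; right; exists (row i B); first by apply: cvx_row; rewrite inE.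
  by rewrite !row_row_mx !row0 row_const.
Qed.

Lemma free_rows k p (A : 'M[R]_(k, p)) :
  free [seq row i A | i <- enum 'I_k] = row_free A.
Proof.
pose X := [tuple of [seq row i A | i <- enum 'I_k]].
have sX : size [seq row i A | i <- enum 'I_k] = k by rewrite size_map size_enum_ord.
have XE (i : 'I_k) : [seq row i A | i <- enum 'I_k]`_i = row i A.
  by rewrite (nth_map i) ?size_enum_ord // nth_ord_enum.
have freeE (s : seq 'rV[R]_p) : size s = k -> (forall i : 'I_k, s`_i = row i A) ->
    free s <-> forall c : 'I_k -> R, \sum_(i < k) c i *: row i A = 0 -> forall i, c i = 0.
  move=> ss sE; have st : size s == k by rewrite ss.
  have -> : s = Tuple st by [].
  split=> [/freeP h c c0|h]; [apply: h|apply/freeP => c c0; apply: h].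
    by rewrite -[RHS]c0; apply: eq_bigr => i _; rewrite sE.
  by rewrite -[RHS]c0; apply: eq_bigr => i _; rewrite sE.
rewrite -kermx_eq0; apply/idP/rowV0P => [/(freeE _ sX XE) h v /sub_kermxP|h].
  by rewrite mulmx_sum_row => /h vE; apply/rowP=> i; rewrite vE mxE.
apply/(freeE _ sX XE) => c c0 i.
have /rowP/(_ i) : \row_j c j = 0.
  apply/h/sub_kermxP; rewrite mulmx_sum_row -[RHS]c0.
  by apply: eq_bigr => j _; rewrite mxE.
by rewrite !mxE.
Qed.

Lemma row_freeP0 k p (A : 'M[R]_(k, p)) :
  row_free A <-> forall l : 'rV[R]_k, l *m A = 0 -> l = 0.
Proof.
rewrite -kermx_eq0; split=> [/rowV0P h l lA|h]; first exact/h/sub_kermxP.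
by apply/rowV0P => v /sub_kermxP /h.
Qed.

Lemma affinely_independent_rows k p (A : 'M[R]_(k, p)) :
  affinely_independent [seq row i A | i <- enum 'I_k] = row_free (hom A).
Proof.
case: k A => [|k] A.
  have -> : [seq row i A | i <- enum 'I_0] = [::].
    by apply: size0nil; rewrite size_map size_enum_ord.
  by rewrite -kermx_eq0; apply/esym/eqP/matrixP=> -[].
rewrite enum_ordSl.
pose B := \matrix_i (row (lift ord0 i) A - row ord0 A) : 'M_(k, p).
transitivity (free [seq row i B | i <- enum 'I_k]).
  by rewrite /= -!map_comp; congr free; apply: eq_map => i /=; rewrite rowK.
rewrite free_rows.
have BE (l : 'I_k -> R) : \sum_i l i *: row i B =
    \sum_i l i *: row (lift ord0 i) A - (\sum_i l i) *: row ord0 A.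
  by rewrite scaler_suml -sumrB; apply: eq_bigr => i _; rewrite rowK scalerBr.
apply/idP/idP => /row_freeP0 h; apply/row_freeP0 => l.
  move=> lA; have [l0 lA0] : \sum_i l 0 i = 0 /\ \sum_i l 0 i *: row i A = 0.
    move: lA; rewrite mul_mx_row -[RHS]row_mx0 => /eq_row_mx[lA lc].
    split; last by rewrite -mulmx_sum_row.
    have /rowP/(_ 0) := lc; rewrite !mxE => E; rewrite -[RHS]E.
    by apply: eq_bigr => i _; rewrite mxE mulr1.
  rewrite !big_ord_recl /= in l0 lA0.
  have l0E : l 0 ord0 = - \sum_(i < k) l 0 (lift ord0 i) by apply/eqP; rewrite -addr_eq0 l0.
  have lB : \row_i l 0 (lift ord0 i) *m B = 0.
    rewrite mulmx_sum_row.
    under eq_bigr do rewrite mxE.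
    by rewrite (BE (fun i => l 0 (lift ord0 i))) -scaleNr -l0E addrC.
  have lE i : l 0 (lift ord0 i) = 0 by have /rowP/(_ i) := h _ lB; rewrite !mxE.
  apply/rowP=> i; rewrite mxE; case: (unliftP ord0 i) => [j ->|->]; first exact: lE.
  by rewrite l0E big1 ?oppr0.
rewrite mulmx_sum_row (BE (fun i => l 0 i)) => lB.
pose l' := \row_i (if unlift ord0 i is Some j then l 0 j else - \sum_j l 0 j) : 'rV_k.+1.
have l'0 : l' 0 ord0 = - \sum_j l 0 j by rewrite mxE unlift_none.
have l'S j : l' 0 (lift ord0 j) = l 0 j by rewrite mxE liftK.
have /h /rowP l'E : l' *m hom A = 0.
  rewrite mul_mx_row -[RHS]row_mx0; congr row_mx.
    rewrite mulmx_sum_row big_ord_recl l'0 scaleNr addrC.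
    by under eq_bigr do rewrite l'S.
  apply/rowP=> i; rewrite ord1 [LHS]mxE [RHS]mxE big_ord_recl l'0.
  rewrite [const_mx _ _ _]mxE mulr1.
  apply/eqP; rewrite addrC subr_eq0; apply/eqP/eq_bigr => j _.
  by rewrite l'S [const_mx _ _ _]mxE mulr1.
by apply/rowP=> j; rewrite -l'S l'E !mxE.
Qed.

Lemma seq_rows p (s : seq 'rV[R]_p) :
  [seq row i (\matrix_(i < size s) s`_i) | i <- enum 'I_(size s)] = s.
Proof.
apply: (@eq_from_nth _ 0) => [|i]; rewrite size_map size_enum_ord // => lt.
by rewrite (nth_map (Ordinal lt)) ?size_enum_ord // rowK (nth_ord_enum _ (Ordinal lt)).
Qed.

Lemma conv_hull_seq p (s : seq 'rV[R]_p) :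
  conv_hull [set` s]%classic = cvx (\matrix_(i < size s) s`_i) setT.
Proof.
apply: conv_hull_rows => x /=; rewrite -{1}[s]seq_rows.
split=> [/mapP[i _ ->]|[i _ ->]]; first by exists i; rewrite ?inE.
by apply/mapP; exists i; rewrite ?mem_enum.
Qed.

Lemma simplexP p (S : set 'rV[R]_p) : simplex S <->
  exists k (A : 'M[R]_(k, p)), row_free (hom A) /\ S = cvx A setT.
Proof.
split=> [[s [s_aff ->]]|[k [A [fA ->]]]].
  exists (size s), (\matrix_i s`_i).
  by rewrite -affinely_independent_rows seq_rows conv_hull_seq.
exists [seq row i A | i <- enum 'I_k]; rewrite affinely_independent_rows; split=> //.
apply/esym/conv_hull_rows => x /=.
split=> [/mapP[i _ ->]|[i _ ->]]; first by exists i; rewrite ?inE.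
by apply/mapP; exists i; rewrite ?mem_enum.
Qed.

Lemma join_mx_apex k m p q (A : 'M[R]_(k, p)) (B : 'M[R]_(m, q)) i :
  row_free (hom A) ->
  facial (join_mx A B) [set lshift m i] /\ facial (join_mx A B) (~: [set lshift m i]).
Proof.
move=> /row_freeP[A' AA'].
pose c := col i (A' : 'M_(p + 1, k)).
have cE j : (hom A *m c) j 0 = (j == i)%:R.
  by rewrite /c colE mulmxA AA' mul1mx mxE eqxx andbT.
pose c1 := usubmx c; pose b := dsubmx c 0 0.
(* [c] is 1 on row i of A and 0 on its other rows. Its constant term [b] is cancelled on the rows of
   B by the coefficient [- b] of the last coordinate, which is 1 there and 0 on the rows of A. *)
pose w := col_mx (col_mx (col_mx c1 0) (- b)%:M) b%:M : 'cV_(p + q + 1 + 1).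
have wE (x : 'rV_p) (y : 'rV_q) (t : R) :
    (hmg (row_mx (row_mx x y) t%:M) *m w) 0 0 = dotp x c1 + b - t * b.
  have sE (a : R) : (a%:M : 'M_1) 0 0 = a by rewrite mxE eqxx mulr1n.
  rewrite hmg_dot sE /dotp !mul_row_col mulmx0 addr0 -scalar_mxM mxE sE.
  by rewrite mulrN addrAC.
have hw j : (hom (join_mx A B) *m w) j 0 = (j == lshift m i)%:R.
  rewrite homE; case: (split_ordP j) => l ->.
    have z : 0 = 0%:M :> 'M[R]_1 by rewrite raddf0.
    rewrite row_join_mxl z wE mul0r subr0.
    rewrite (inj_eq (@lshift_inj _ _)) -cE homE -[c in RHS]vsubmxK hmg_dot.
    by [].
  rewrite row_join_mxr.
  have -> : const_mx 1 = 1%:M :> 'M[R]_1.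
    by apply/matrixP=> a a'; rewrite !mxE !ord1 eqxx.
  by rewrite wE mul1r addrK /dotp mul0mx mxE eq_rlshift.
split.
  exists (col_mx 0 1 - w).
  have E j : (hom (join_mx A B) *m (col_mx 0 1 - w)) j 0 = 1 - (j == lshift m i)%:R.
    by rewrite mulmxBr [LHS]mxE [X in _ + X]mxE hw homE hmg_dot /dotp mulmx0 !mxE add0r.
  split=> [j|]; first by rewrite E subr_ge0; case: (_ == _); rewrite ?ler01.
  apply/setP=> j; rewrite !inE E; case: (_ == _); rewrite ?subrr ?eqxx //.
  by rewrite subr0 oner_eq0.
exists w; split=> [j|]; first by rewrite hw ler0n.
by apply/setP=> j; rewrite !inE hw; case: (_ == _); rewrite ?oner_eq0 ?eqxx.
Qed.

(** A vertex of a nonempty simplex factor is an apex. If the simplex is empty, comparing ranks gives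
    d <= e <= D, against D < d. *)
Lemma join_bound_pyramid alpha beta D : join_bound R alpha beta D -> pyramid_bound R alpha beta D.
Proof.
move=> jb n d P Pd Dd.
have [cV|] := boolP ((vertices P #<= `I_(d + 1 + alpha)%N)%classic%card); last first.
  by move/negP=> h; apply: Or32.
have [cF|] := boolP ((facets P #<= `I_(d + 1 + beta)%N)%classic%card); last first.
  by move/negP=> h; apply: Or33.
apply: Or31; have [p [q [e [S [Q [/simplexP[k [A [fA ->]]] [Qp rQ] eD]]]]]] := jb _ _ _ Pd cV cF.
have [m [B QE]] := polytope_cvx Qp; rewrite QE in rQ *; rewrite join_cvx.
have [/polytope_vertexial[N [V [Vv PE]]] rP] := Pd; rewrite PE in rP *.
move: rP rQ => /has_dim_cvx rP /has_dim_cvx rQ PJ.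
have N1 : (1 < N)%N by have := rank_leq_row (hom V); move: rP; rewrite /rk spnT; lia.
case: k A fA PJ => [|k] A fA PJ; last first.
  have [af acf] := join_mx_apex B ord0 fA.
  exact: comb_equiv_apex af acf Vv N1 PJ.
have := comb_equiv_rk PJ.
suff : (rk (join_mx A B) setT <= rk B setT)%N by lia.
have -> : rk (join_mx A B) setT = \rank (hom (join_mx A B)) by rewrite /rk spnT.
have -> : rk B setT = \rank (hom B) by rewrite /rk spnT.
(* [T] sends (y, 1) to (0, y, 1, 1), so joining with the empty simplex does not raise the rank. *)
pose T : 'M[R]_(q + 1, p + q + 1 + 1) :=
  col_mx (row_mx (row_mx (row_mx 0 1%:M) 0) 0) (row_mx (row_mx 0 1%:M) 1%:M).
suff JE : (hom (join_mx A B) <= hom B *m T)%MS.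
  exact: leq_trans (mxrankS JE) (mxrankM_maxl _ _).
apply/row_subP=> i; rewrite row_hom.
case: (split_ordP i) => j ->; first by case: (j).
rewrite row_join_mxr (_ : hmg _ = hmg (row j B) *m T); last first.
  rewrite mul_row_col !mul_mx_row !mulmx0 !mulmx1 !add_row_mx !addr0 !add0r.
  rewrite /hmg; congr (row_mx (row_mx _ _) _).
  by apply/matrixP=> a a'; rewrite !mxE !ord1 eqxx.
by rewrite -row_hom; apply/submxMr/row_sub.
Qed.

End Join.

(** * Splitting off a simplex: from pyramids to joins *)

Section Decompose.
Variable R : realType.

Lemma rk_setU1_apex n N (V : 'M[R]_(N, n)) i (w : 'cV[R]_(n + 1)) (Z : {set 'I_N}) :
  (hom V *m w) i 0 != 0 -> (forall j, j != i -> (hom V *m w) j 0 = 0) ->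
  i \notin Z -> rk V (i |: Z) = (rk V Z).+1.
Proof.
move=> wi wj iZ; apply/eqP; rewrite eqn_leq rkU1.
apply: (rk_lt (subsetUr _ _) _ (setU11 _ _) wi) => j jZ.
by apply: wj; apply: contraNneq iZ => <-.
Qed.

(** The cones from the apex i over the facets of the base are facets, and the base is one more. *)
Lemma card_facets_base n N (V : 'M[R]_(N.+1, n)) i (w : 'cV[R]_(n + 1)) :
  (hom V *m w) i 0 != 0 -> (forall j, j != i -> (hom V *m w) j 0 = 0) ->
  (#|facet_supps (rowsub (lift i) V)| < #|facet_supps V|)%N.
Proof.
move=> wi wj; set V1 := rowsub _ V.
have liftT : lift i @: setT = ~: [set i].
  apply/setP=> j; rewrite !inE; apply/imsetP/idP => [[k _ ->]|ji].
    by rewrite eq_sym neq_lift.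
  by rewrite eq_sym in ji; have [k ->] := unlift_some ji; exists k.
have iZ (Z : {set 'I_N}) : i \notin lift i @: Z.
  by apply/imsetP => -[k _ /eqP]; apply/negP; exact: neq_lift.
have rT : rk V setT = (rk V1 setT).+1.
  rewrite rk_rowsub liftT -(rk_setU1_apex wi wj); first by rewrite setUC -setCD setDv setC0.
  by rewrite !inE eqxx.
pose g (Z : {set 'I_N}) := i |: lift i @: Z.
have gI : injective g.
  move=> Z Y ZY; apply: (imset_inj (@lift_inj _ i)).
  have K (X : {set 'I_N}) : g X :\ i = lift i @: X by rewrite setU1K.
  by rewrite -!K ZY.
have gF Z : Z \in facet_supps V1 -> g Z \in facet_supps V.
  rewrite !inE => /andP[/asboolP[w1 [w10 ZE]] /eqP rZ]; apply/andP; split; last first.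
    by rewrite (rk_setU1_apex wi wj) // rT -rZ rk_rowsub.
  apply/asboolP.
  (* A multiple of the apex functional corrects [w1] so that it vanishes at the apex, without
     changing it on the base. *)
  pose w2 := w1 - ((hom V *m w1) i 0 / (hom V *m w) i 0) *: w.
  have E j : (hom V *m w2) j 0 = (hom V *m w1) j 0 -
      (hom V *m w1) i 0 / (hom V *m w) i 0 * (hom V *m w) j 0.
    by rewrite mulmxBr -scalemxAr mxE [X in _ + X]mxE [X in - X]mxE.
  have Ei : (hom V *m w2) i 0 = 0 by rewrite E mulfVK ?subrr.
  have Ej k : (hom V *m w2) (lift i k) 0 = (hom V1 *m w1) k 0.
    have li : lift i k != i by rewrite eq_sym neq_lift.
    by rewrite E (wj _ li) mulr0 subr0 hom_rowsub.
  exists w2; split=> [j|].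
    by case: (unliftP i j) => [k ->|->]; rewrite ?Ei ?Ej.
  apply/setP=> j; rewrite in_setU1 in_setC inE negbK.
  case: (unliftP i j) => [k ->|->]; last by rewrite Ei !eqxx.
  rewrite Ej eq_sym (negPf (neq_lift i k)) /= mem_imset; last exact: lift_inj.
  by rewrite ZE !inE negbK.
have cF : ~: [set i] \in facet_supps V.
  rewrite inE rT rk_rowsub liftT eqxx andbT; apply/asboolP.
  have [s [s0 sp]] : exists s : R, s != 0 /\ 0 <= s * (hom V *m w) i 0.
    have [wp|wn] := leP 0 ((hom V *m w) i 0).
      by exists 1; rewrite oner_eq0 mul1r.
    by exists (-1); rewrite oppr_eq0 oner_eq0 mulN1r oppr_ge0 ltW.
  have E j : (hom V *m (s *: w)) j 0 = s * (hom V *m w) j 0.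
    by rewrite -scalemxAr mxE.
  exists (s *: w); split=> [j|].
    by rewrite E; have [->|ji] := eqVneq j i; rewrite // wj // mulr0.
  apply/setP=> j; rewrite !inE negbK E; have [->|ji] := eqVneq j i.
    by rewrite mulf_eq0 (negPf s0) (negPf wi).
  by rewrite wj // mulr0 eqxx.
rewrite -(card_imset _ gI).
have: ~: [set i] \notin g @: facet_supps V1.
  apply/imsetP=> -[Z _ /setP/(_ i)]; by rewrite !inE eqxx.
move=> nF; apply: (@leq_trans #|~: [set i] |: g @: facet_supps V1|).
  by rewrite cardsU1 nF.
apply/subset_leq_card/subsetP=> X /setU1P[->//|/imsetP[Z ZF ->]]; exact: gF.
Qed.

Lemma vertexial_rowsub n N k (V : 'M[R]_(N, n)) (f : 'I_k -> 'I_N) :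
  injective f -> vertexial V -> vertexial (rowsub f V).
Proof.
move=> fI Vv i; have [w [w0 E]] := Vv (f i); exists w; split=> [j|].
  by rewrite hom_rowsub.
apply/setP=> j; rewrite !inE hom_rowsub negbK -(inj_eq fI) -in_set1 E.
by rewrite !inE negbK.
Qed.

(** Peel off apexes until the rank is at most D + 1. Each apex lowers the rank and the number of
    vertices by one and the number of facets by at least one, so both hypotheses persist with the
    same [alpha] and [beta]. *)
Lemma pyramid_bound_base alpha beta D n N (V : 'M[R]_(N, n)) :
  pyramid_bound R alpha beta D -> vertexial V -> (0 < rk V setT)%N ->
  (N <= rk V setT + alpha)%N -> (#|facet_supps V| <= rk V setT + beta)%N ->
  exists B : {set 'I_N}, rk V setT = (#|~: B| + rk V B)%N /\ (0 < rk V B <= D.+1)%N.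
Proof.
move=> pb; elim: N V => [|N IH] V Vv r0 cN cF.
  move: r0; rewrite /rk spnT lt0n mxrank_eq0 => /eqP[].
  by apply/matrixP=> -[].
have [rD|rD] := leqP (rk V setT) D.+1.
  by exists setT; rewrite setCT cards0 r0.
pose d := (rk V setT).-1.
have dE : rk V setT = d.+1 by rewrite /d prednK.
have Pd : dpolytope d (cvx V setT).
  by split; [exact: cvx_polytope|apply/has_dim_cvx; rewrite dE -addn1 PoszD].
have [|||] := pb _ _ _ Pd; first by rewrite -ltnS -dE.
- move=> /(pyramid_sepP Vv)[i [w [wi wj]]].
  pose f : 'I_N -> 'I_N.+1 := lift i.
  have rT : rk V setT = (rk (rowsub f V) setT).+1.
    have := rk_setU1_apex wi wj (Z := ~: [set i]); rewrite !inE eqxx => /(_ isT).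
    rewrite setUC -setCD setDv setC0 => ->; congr (_.+1).
    rewrite rk_rowsub; congr (rk _ _); apply/esym/setP=> j; rewrite !inE.
    apply/imsetP/idP => [[k _ ->]|ji]; first by rewrite eq_sym neq_lift.
    by rewrite eq_sym in ji; have [k ->] := unlift_some ji; exists k.
  have cF1 : (#|facet_supps (rowsub f V)| < #|facet_supps V|)%N.
    exact: card_facets_base wi wj.
  have [||||B [rB Bb]] := IH (rowsub f V).
  + exact: vertexial_rowsub (@lift_inj _ _) Vv.
  + by lia.
  + by lia.
  + by lia.
  exists (f @: B); rewrite -rk_rowsub; split=> //.
  rewrite rT rB; have := cardsC B; have := cardsC (f @: B).
  rewrite card_imset ?card_ord; last exact: lift_inj.
  move=> c1 c2; rewrite -addSn; congr (_ + _)%N; apply/eqP.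
  by rewrite -(eqn_add2l #|B|) addnS c2 c1.
- by case; rewrite card_vertices // (leq_trans cN) // dE addn1.
- by case; rewrite card_facets (leq_trans cF) // dE addn1.
Qed.

(** The faces depend only on the column space of [hom V], which is the orthogonal complement of the
    affine dependences. *)
Lemma facial_ker n m N (V : 'M[R]_(N, n)) (W : 'M[R]_(N, m)) :
  (forall phi : 'rV_N, phi *m hom V = 0 <-> phi *m hom W = 0) ->
  forall Z, facial V Z <-> facial W Z.
Proof.
move=> VW.
have H k l (A : 'M[R]_(N, k)) (B : 'M[R]_(N, l)) :
    (forall phi : 'rV_N, phi *m hom A = 0 <-> phi *m hom B = 0) ->
    forall Z, facial A Z -> facial B Z.
  move=> AB Z [w [w0 ->]].
  have [|w' wE] := (kermx_ortho (hom B) (hom A *m w)).1.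
    apply/orthoP=> phi /sub_kermxP/AB pA.
    by rewrite mulmxA pA mul0mx.
  by exists w'; rewrite -wE.
by move=> Z; split; apply: H => // phi; split=> /VW.
Qed.

(** The rank condition says that the rows of [hom A] are independent and their span meets that of
    [hom B] trivially. A dependence of either configuration is then zero on A and a dependence of
    B. *)
Lemma join_mx_ker k m n (A : 'M[R]_(k, n)) (B : 'M[R]_(m, n)) (phi : 'rV[R]_(k + m)) :
  \rank (hom (col_mx A B)) = (k + \rank (hom B))%N ->
  phi *m hom (col_mx A B) = 0 <-> phi *m hom (join_mx A B) = 0.
Proof.
move=> rAB.
have homAB : hom (col_mx A B) = col_mx (hom A) (hom B).
  by rewrite /hom -col_mx_const -block_mxEh block_mxEv.
have [fA cap0] : row_free (hom A) /\ (hom A :&: hom B)%MS = 0.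
  have := mxrank_adds_leqif (hom A) (hom B); rewrite addsmxE -homAB rAB.
  have := rank_leq_row (hom A); rewrite /row_free => h [h1 h2].
  split; first by apply/eqP; lia.
  have rA : \rank (hom A) = k by lia.
  by move: h2; rewrite rA eqxx => /esym; rewrite submx0 => /eqP.
rewrite -[phi]hsubmxK; set l := lsubmx phi; set r := rsubmx phi.
transitivity (l = 0 /\ r *m hom B = 0).
  rewrite homAB mul_row_col; split=> [E|[-> ->]]; last by rewrite mul0mx addr0.
  have lA : l *m hom A = 0.
    apply/eqP; rewrite -submx0 -cap0 sub_capmx submxMl /=.
    by move/eqP: E; rewrite addr_eq0 => /eqP ->; rewrite -mulNmx submxMl.
  by split; [exact: (row_freeP0 _).1 fA _ lA|move: E; rewrite lA add0r].
have mulhom a p (M : 'M[R]_(a, p)) (x : 'rV_a) :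
    x *m hom M = 0 <-> x *m M = 0 /\ x *m const_mx 1 = 0 :> 'M_1.
  rewrite mul_mx_row -[RHS]row_mx0; split=> [/eq_row_mx[]//|[-> ->]//].
have cE : const_mx 1 = col_mx (const_mx 1) (const_mx 1) :> 'M[R]_(k + m, 1).
  by rewrite col_mx_const.
rewrite (mulhom _ _ (join_mx A B)) (mulhom _ _ B) cE mul_row_col mul_row_col !mul_mx_row !mulmx0 !add_row_mx.
rewrite !add0r addr0; split=> [[-> [-> ->]]|[E1 E2]].
  by rewrite !mul0mx addr0 !row_mx0.
move: E1; rewrite -[X in _ = X -> _]row_mx0 => /eq_row_mx[+ r1].
rewrite -[X in _ = X -> _]row_mx0 => /eq_row_mx[lA rB].
move: E2; rewrite r1 addr0 => l1; split=> //.
by apply: (row_freeP0 _).1 fA _ _; apply/mulhom.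
Qed.

Lemma pyramid_bound_join alpha beta D :
  pyramid_bound R alpha beta D -> join_bound R alpha beta D.
Proof.
move=> pb n d P [/polytope_vertexial[N [V [Vv ->]]] /has_dim_cvx rd].
rewrite card_vertices // card_facets => cN cF.
have rV : rk V setT = (d + 1)%N by lia.
have [|||B [rB /andP[B0 BD]]] := pyramid_bound_base pb Vv; rewrite ?rV ?addn1 //.
  by move: cN; rewrite addn1.
  by move: cF; rewrite addn1.
pose fA (i : 'I_#|~: B|) : 'I_N := enum_val i.
pose fB (i : 'I_#|B|) : 'I_N := enum_val i.
pose A' := rowsub fA V; pose B' := rowsub fB V.
have imA : fA @: setT = ~: B.
  apply/setP=> i; apply/imsetP/idP => [[j _ ->]|iB]; first exact: enum_valP.
  by exists (enum_rank_in iB i); rewrite // /fA enum_rankK_in.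
have imB : fB @: setT = B.
  apply/setP=> i; apply/imsetP/idP => [[j _ ->]|iB]; first exact: enum_valP.
  by exists (enum_rank_in iB i); rewrite // /fB enum_rankK_in.
have rowAB i : (exists j, row i V = row j (col_mx A' B')).
  have [iB|] := boolP (i \in B).
    exists (rshift _ (enum_rank_in iB i)); rewrite rowKd.
    by apply/rowP=> k; rewrite !mxE /fB enum_rankK_in.
  rewrite -in_setC => iB; exists (lshift _ (enum_rank_in iB i)); rewrite rowKu.
  by apply/rowP=> k; rewrite !mxE /fA enum_rankK_in.
have rowV j : exists i, row j (col_mx A' B') = row i V.
  case: (split_ordP j) => k ->; rewrite ?rowKu ?rowKd.
    by exists (fA k); apply/rowP=> l; rewrite !mxE.
  by exists (fB k); apply/rowP=> l; rewrite !mxE.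
have PE : cvx V setT = cvx (col_mx A' B') setT.
  rewrite -(@conv_hull_rows _ _ _ V setT [set x | exists2 i, i \in setT & x = row i V]%classic) //.
  apply: conv_hull_rows => x; split=> [[i _ ->]|[j _ ->]].
    by have [j ->] := rowAB i; exists j.
  by have [i ->] := rowV j; exists i.
have rB' : \rank (hom B') = rk V B by rewrite -spnT -[X in _ = rk V X]imB -rk_rowsub.
have rAB : \rank (hom (col_mx A' B')) = (#|~: B| + \rank (hom B'))%N.
  rewrite rB' -rB; suff -> : (hom (col_mx A' B') :=: spn V setT)%MS by [].
  apply/eqmxP/andP; split.
    apply/row_subP=> j; rewrite row_hom; have [i ->] := rowV j.
    by rewrite row_sub_spn.
  apply/spn_subP=> i _; have [j ->] := rowAB i.
  by rewrite -row_hom row_sub.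
exists n, n, (rk V B).-1, (cvx A' setT), (cvx B' setT); split.
- apply/simplexP; exists #|~: B|, A'; split=> //.
  have := mxrank_adds_leqif (hom A') (hom B').
  have homAB : hom (col_mx A' B') = col_mx (hom A') (hom B').
    by rewrite /hom -col_mx_const -block_mxEh block_mxEv.
  rewrite addsmxE -homAB rAB => -[+ _]; rewrite leq_add2r => h.
  by rewrite /row_free eqn_leq rank_leq_row.
- split; first exact: cvx_polytope.
  have rE : rk B' setT = rk V B by rewrite -rB' /rk spnT.
  by apply/has_dim_cvx; rewrite rE; lia.
- by lia.
rewrite PE join_cvx; apply: comb_equiv_facial; apply: facial_ker => phi.
exact: join_mx_ker.
Qed.

End Decompose.

(** * Joins of prisms *)

Section Examples.
Variable R : realType.

(* Up to positive scaling, the rows of [M] are the vertices of a polytope (first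
   clause) that is not a pyramid (last clause). *)
Definition rows_generic N f (M : 'M[R]_(N, f)) : Prop :=
  [/\ forall i i', i != i' -> exists j, M i j = 0 /\ M i' j != 0,
      forall i, exists j, M i j != 0 &
      forall i, exists phi : 'rV_N, phi *m M = 0 /\ phi 0 i != 0].

(* Self-dual form of: some (r - 1)-polytope that is not a pyramid has r + a
   vertices and r + b facets. *)
Definition slack_model (a b r : nat) : Prop :=
  exists N f (M : 'M[R]_(N, f)),
  [/\ N = (r + a)%N /\ f = (r + b)%N, forall i j, 0 <= M i j, generates M,
      rows_generic M /\ rows_generic M^T & \rank M = r].

Lemma slack_model_tr a b r : slack_model a b r -> slack_model b a r.
Proof.
case=> N [f [M [[Na fb] M0 gM [hM hMt] rM]]]; exists f, N, M^T.
split=> //; rewrite ?trmxK ?mxrank_tr //; last exact: generates_tr.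
by move=> i j; rewrite mxE.
Qed.

Lemma rows_generic_block N f N' f' (M : 'M[R]_(N, f)) (M' : 'M[R]_(N', f')) :
  rows_generic M -> rows_generic M' -> rows_generic (block_mx M 0 0 M').
Proof.
move=> [s z k] [s' z' k']; split.
- move=> i i'; case: (split_ordP i) => u ->; case: (split_ordP i') => u' ->.
  + rewrite (inj_eq (@lshift_inj _ _)) => /s[j [e ne]].
    by exists (lshift _ j); rewrite !block_mxEul.
  + move=> _; have [j ne] := z' u'; exists (rshift _ j).
    by rewrite block_mxEur block_mxEdr mxE.
  + move=> _; have [j ne] := z u'; exists (lshift _ j).
    by rewrite block_mxEul block_mxEdl mxE.
  + rewrite (inj_eq (@rshift_inj _ _)) => /s'[j [e ne]].
    by exists (rshift _ j); rewrite !block_mxEdr.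
- move=> i; case: (split_ordP i) => u ->.
    by have [j ne] := z u; exists (lshift _ j); rewrite block_mxEul.
  by have [j ne] := z' u; exists (rshift _ j); rewrite block_mxEdr.
- move=> i; case: (split_ordP i) => u ->.
    have [phi [e ne]] := k u; exists (row_mx phi 0); rewrite row_mxEl; split=> //.
    by rewrite mul_row_block e !mulmx0 !mul0mx !addr0 row_mx0.
  have [phi [e ne]] := k' u; exists (row_mx 0 phi); rewrite row_mxEr; split=> //.
  by rewrite mul_row_block e !mulmx0 !mul0mx !addr0 row_mx0.
Qed.

(** The slack matrix of a join is block diagonal: a facet of the join is a facet of one factor
    joined with the whole other factor. *)
Lemma slack_model_join a b r a' b' r' : slack_model a b r -> slack_model a' b' r' ->
  slack_model (a + a') (b + b') (r + r').
Proof.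
case=> N [f [M [[Na fb] M0 gM [hM hMt] rM]]].
case=> N' [f' [M' [[Na' fb'] M0' gM' [hM' hMt'] rM']]].
exists (N + N')%N, (f + f')%N, (block_mx M 0 0 M'); split.
- by split; lia.
- move=> i j; case: (split_ordP i) => u ->; case: (split_ordP j) => v ->.
  + by rewrite block_mxEul.
  + by rewrite block_mxEur mxE.
  + by rewrite block_mxEdl mxE.
  + by rewrite block_mxEdr.
- move=> z; rewrite -[z]vsubmxK mul_block_col !mul0mx addr0 add0r => zp.
  have [|z1 z10 ->] := gM (usubmx z).
    by move=> i; have := zp (lshift _ i); rewrite col_mxEu.
  have [|z2 z20 ->] := gM' (dsubmx z).
    by move=> i; have := zp (rshift _ i); rewrite col_mxEd.
  exists (col_mx z1 z2); last by rewrite mul_block_col !mul0mx addr0 add0r.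
  by move=> i; case: (split_ordP i) => u ->; rewrite ?col_mxEu ?col_mxEd.
- by split; rewrite ?tr_block_mx ?trmx0; exact: rows_generic_block.
- by rewrite rank_diag_block_mx rM rM'.
Qed.

Section Prism.
Variable a : nat.
Let k := a.+2.

Definition end_ord (b : bool) : 'I_2 := if b then ord_max else ord0.

Lemma end_ordP (y : 'I_2) : exists b, y = end_ord b.
Proof.
by case: y => [[|[|//]] lt]; [exists false|exists true]; apply/val_inj.
Qed.

Definition end_mx b : 'M[R]_(k, 2) := \matrix_(i, j) (j == end_ord b)%:R.

(** Slack matrix of the prism over the simplex with k vertices: vertex (x, b) misses the side facet
    opposite x and one of the two ends. *)
Definition prism_mx : 'M[R]_(k + k, k + 2) :=
  block_mx 1%:M (end_mx false) 1%:M (end_mx true).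

Definition prism_row (x : 'I_k) (b : bool) : 'I_(k + k) :=
  if b then rshift k x else lshift k x.

Lemma prism_rowP i : exists x b, i = prism_row x b.
Proof. by case: (split_ordP i) => x ->; [exists x, false|exists x, true]. Qed.

Lemma prism_mxl x b x' : prism_mx (prism_row x b) (lshift 2 x') = (x == x')%:R.
Proof. by case: b; rewrite ?block_mxEul ?block_mxEdl mxE. Qed.

Lemma prism_mxr x b y : prism_mx (prism_row x b) (rshift k y) = (y == end_ord b)%:R.
Proof. by case: b; rewrite ?block_mxEur ?block_mxEdr mxE. Qed.

Lemma prism_mul x b (z : 'cV[R]_(k + 2)) : (prism_mx *m z) (prism_row x b) 0 =
  z (lshift 2 x) 0 + z (rshift k (end_ord b)) 0.
Proof.
rewrite mxE big_split_ord /=; congr (_ + _).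
  rewrite (bigD1 x) //= prism_mxl eqxx mul1r big1 ?addr0 // => i ix.
  by rewrite prism_mxl eq_sym (negPf ix) mul0r.
rewrite (bigD1 (end_ord b)) //= prism_mxr eqxx mul1r big1 ?addr0 // => i ix.
by rewrite prism_mxr (negPf ix) mul0r.
Qed.

Lemma exists_neq (x : 'I_k) : exists x' : 'I_k, x' != x.
Proof. by exists (lift x ord0); rewrite eq_sym neq_lift. Qed.

Lemma end_mxB : end_mx true - end_mx false =
  const_mx 1 *m (\row_y (if y == ord0 then -1 else 1)) :> 'M_(k, 2).
Proof.
apply/matrixP=> i y; rewrite !mxE big_ord1 !mxE mul1r.
by have [[] ->] := end_ordP y; rewrite /= ?subr0 ?sub0r.
Qed.

Lemma rank_prism : \rank prism_mx = (k + 1)%N.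
Proof.
have -> : prism_mx = block_mx 1%:M 0 1%:M 1%:M *m
    (block_mx 1%:M 0 0 (end_mx true - end_mx false) *m block_mx 1%:M (end_mx false) 0 1%:M).
  rewrite !mulmx_block !mul1mx !mulmx1 !mul0mx !mulmx0 !addr0 !add0r.
  by rewrite addrC subrK.
have u1 : row_full (block_mx 1%:M 0 1%:M 1%:M : 'M[R]_(k + k)).
  by rewrite row_full_unit unitmxE det_lblock !det1 mulr1 unitr1.
have u2 : row_free (block_mx 1%:M (end_mx false) 0 1%:M : 'M[R]_(k + 2)).
  by rewrite row_free_unit unitmxE det_ublock !det1 mulr1 unitr1.
rewrite (eqmxMfull _ u1) mxrankMfree // rank_diag_block_mx mxrank1; congr (_ + _)%N.
apply/eqP; rewrite eqn_leq lt0n mxrank_eq0; apply/andP; split.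
  by rewrite end_mxB (leq_trans (mxrankM_maxl _ _)) // rank_leq_col.
apply/eqP=> /matrixP/(_ ord0 ord0); rewrite !mxE /= sub0r => /eqP.
by rewrite oppr_eq0 oner_eq0.
Qed.

Lemma slack_model_prism : slack_model a.+1 1 (k + 1).
Proof.
exists (k + k)%N, (k + 2)%N, prism_mx; split; last exact: rank_prism.
- by split; rewrite /k; lia.
- move=> i j; have [x [b ->]] := prism_rowP i; case: (split_ordP j) => y ->.
    by rewrite prism_mxl ler0n.
  by rewrite prism_mxr ler0n.
- move=> z zp.
  (* [prism_mx *m z] only sees sums of a side coordinate and an end coordinate, so the least side
     coordinate can be moved to both ends. *)
  have [x0 _ x0min] := @Order.TotalTheory.arg_minP _ _ _ (ord0 : 'I_k) xpredT
    (fun x => z (lshift 2 x) 0) isT.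
  pose c := z (lshift 2 x0) 0.
  pose z' : 'cV_(k + 2) := z + c *: col_mx (const_mx (-1)) (const_mx 1).
  have zl x : z' (lshift 2 x) 0 = z (lshift 2 x) 0 - c.
    by rewrite 2!mxE col_mxEu mxE mulrN1.
  have zr y : z' (rshift k y) 0 = z (rshift k y) 0 + c.
    by rewrite 2!mxE col_mxEd mxE mulr1.
  exists z'.
    move=> i; case: (split_ordP i) => x ->.
      by rewrite zl subr_ge0 x0min.
    have [b ->] := end_ordP x.
    by rewrite zr addrC; have := zp (prism_row x0 b); rewrite prism_mul.
  apply/colP=> i; have [x [b ->]] := prism_rowP i.
  by rewrite !prism_mul zl zr addrACA addNr addr0.
- split; split.
  + move=> i i'; have [x [b ->]] := prism_rowP i; have [x' [b' ->]] := prism_rowP i'.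
    have [->|xx] := eqVneq x x'.
      move=> bb; exists (rshift k (end_ord b')); rewrite !prism_mxr eqxx oner_eq0.
      by split=> //; move: bb; case: b; case: b'; rewrite ?eqxx.
    by exists (lshift 2 x'); rewrite !prism_mxl (negPf xx) eqxx oner_eq0.
  + move=> i; have [x [b ->]] := prism_rowP i; exists (lshift 2 x).
    by rewrite prism_mxl eqxx oner_eq0.
  + move=> i; have [x [b ->]] := prism_rowP i; have [x' xx] := exists_neq x.
    (* The dependence between the corners of the quadrilateral over x and x'. *)
    pose l : 'rV[R]_k := delta_mx 0 x - delta_mx 0 x'.
    exists (row_mx l (- l)); split.
      rewrite mul_row_block !mulmx1 subrr mulNmx -mulmxBr -opprB end_mxB.
      rewrite mulmxN mulmxA (_ : l *m const_mx 1 = 0) ?mul0mx ?oppr0 ?row_mx0 //.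
      apply/rowP=> y; rewrite mulmxBl -!rowE !mxE subrr //.
    have lx : l 0 x = 1 by rewrite !mxE !eqxx eq_sym (negPf xx) subr0.
    by case: b; rewrite ?row_mxEl ?row_mxEr ?[(- l) _ _]mxE lx ?oppr_eq0 oner_eq0.
  + move=> j j'; case: (split_ordP j) => y ->; case: (split_ordP j') => y' ->.
    * rewrite (inj_eq (@lshift_inj _ _)) => yy; exists (prism_row y' false).
      by rewrite ![prism_mx^T _ _]mxE !prism_mxl eqxx oner_eq0 eq_sym (negPf yy).
    * move=> _; have [x' xx] := exists_neq y; have [b ->] := end_ordP y'.
      exists (prism_row x' b).
      by rewrite ![prism_mx^T _ _]mxE prism_mxl prism_mxr eqxx oner_eq0 (negPf xx).
    * move=> _; have [b ->] := end_ordP y; exists (prism_row y' (~~ b)).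
      by rewrite ![prism_mx^T _ _]mxE prism_mxl prism_mxr eqxx oner_eq0; case: b.
    * rewrite (inj_eq (@rshift_inj _ _)) => yy; have [b' y'E] := end_ordP y'.
      exists (prism_row ord0 b').
      by rewrite ![prism_mx^T _ _]mxE !prism_mxr -y'E eqxx oner_eq0 (negPf yy).
  + move=> j; case: (split_ordP j) => y ->.
      by exists (prism_row y false); rewrite [prism_mx^T _ _]mxE prism_mxl eqxx oner_eq0.
    have [b ->] := end_ordP y.
    by exists (prism_row ord0 b); rewrite [prism_mx^T _ _]mxE prism_mxr eqxx oner_eq0.
  (* The side columns and the end columns have the same sum. *)
  + move=> j; exists (row_mx (const_mx 1) (const_mx (-1))); split.
      apply/trmx_inj; rewrite trmx_mul trmxK trmx0 tr_row_mx !trmx_const.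
      apply/colP=> i; have [x [b ->]] := prism_rowP i.
      by rewrite prism_mul col_mxEu col_mxEd !mxE subrr.
    case: (split_ordP j) => y ->; rewrite ?row_mxEl ?row_mxEr mxE ?oppr_eq0 oner_eq0 //.
Qed.

End Prism.

Lemma slack_model_exists a b : (0 < b <= a)%N -> slack_model a b (a + 2 * b).
Proof.
elim: b a => [//|b IH] [//|a] /andP[_ ba].
have [->|b0] := posnP b.
  have := slack_model_prism a; congr slack_model; lia.
case: a ba => [|a] ba; first by lia.
(* [slack_model_prism 0] is the square; it adds one to both excesses and three to the rank. *)
have := slack_model_join (IH a.+1 _) (slack_model_prism 0).
rewrite b0 -ltnS ba => /(_ isT); congr slack_model; lia.
Qed.

(** Scaling the rows to sum 1 puts them in a hyperplane off the origin, so affine functionals on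
    them are combinations of columns. By [generates] a functional defining a facet may be taken to
    be a nonnegative combination; the facet then lies in the zero set of a single column and equals
    it by rank. So there are at most f facets. *)
Lemma slack_model_polytope a b r : slack_model a b r -> (0 < r)%N ->
  exists n (P : set 'rV[R]_n), [/\ dpolytope r.-1 P, ~ pyramid P,
    (vertices P #<= `I_(r + a)%N)%classic%card & (facets P #<= `I_(r + b)%N)%classic%card].
Proof.
case=> N [f [M [[Na fb] M0 gM [[sM zM kM] _] rM]]] r0.
pose s i := \sum_j M i j.
have s_gt0 i : 0 < s i.
  have [j ne] := zM i; rewrite /s (bigD1 j) //= ltr_pwDl ?sumr_ge0 //.
  by rewrite lt_neqAle eq_sym ne M0.
have s_neq0 i : s i != 0 by rewrite gt_eqF.
pose V := \matrix_(i, j) (M i j / s i).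
have VE (z : 'cV[R]_f) i : (V *m z) i 0 = (M *m z) i 0 / s i.
  rewrite !mxE mulr_suml; apply: eq_bigr => j _.
  by rewrite mxE mulrAC.
have V1 : V *m const_mx 1 = const_mx 1 :> 'cV_N.
  apply/colP=> i; rewrite VE [RHS]mxE -[RHS](divff (s_neq0 i)).
  congr (_ / _); rewrite mxE; apply: eq_bigr => j _; by rewrite mxE mulr1.
have homV : hom V = V *m row_mx 1%:M (const_mx 1).
  by rewrite mul_mx_row mulmx1 V1.
have homVE (w : 'cV[R]_(f + 1)) : hom V *m w = V *m (usubmx w + const_mx 1 *m dsubmx w).
  by rewrite -{1}[w]vsubmxK mul_row_col mulmxDr mulmxA V1.
have homVl (z : 'cV[R]_f) : hom V *m col_mx z 0 = V *m z by rewrite mul_row_col mulmx0 addr0.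
have kV (phi : 'rV[R]_N) : phi *m M = 0 -> (\row_i (phi 0 i * s i)) *m hom V = 0 :> 'rV_(f + 1).
  move=> pM; have pV : (\row_i (phi 0 i * s i)) *m V = 0.
    apply/rowP=> j; have /rowP/(_ j) := pM; rewrite !mxE => E; rewrite -[RHS]E.
    by apply: eq_bigr => l _; rewrite !mxE mulrAC -mulrA mulfVK.
  by rewrite homV mulmxA pV mul0mx.
have Vv : vertexial V.
  (* The sum of the columns vanishing at i exposes vertex i. *)
  move=> i; exists (col_mx (\col_j (M i j == 0)%:R) 0); rewrite homVl.
  set z := \col_j _; have z0 : nonneg z by move=> j; rewrite mxE ler0n.
  have Vz0 : nonneg (V *m z).
    by move=> j; rewrite VE divr_ge0 ?mul_ge0 // ltW.
  split=> //; apply/setP=> i'; rewrite !inE negbK; have [->|ii] := eqVneq i' i.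
    apply/esym; rewrite VE mxE big1 ?mul0r ?eqxx // => j _; rewrite mxE.
    by case: eqP => [->|_]; rewrite ?mul0r ?mulr0.
  apply/esym; rewrite VE mulf_eq0 invr_eq0 (gt_eqF (s_gt0 _)) orbF mxE.
  have [j [e ne]] : exists j, M i j = 0 /\ M i' j != 0 by apply: sM; rewrite eq_sym.
  rewrite psumr_eq0 => [|l _]; last by rewrite mulr_ge0.
  apply/negbTE/allPn; exists j; rewrite ?mem_index_enum //= mxE e eqxx mulr1.
  by [].
have rV : \rank (hom V) = r.
  apply/eqP; rewrite eqn_leq; apply/andP; split.
    have -> : hom V = diag_mx (\row_i (s i)^-1) *m (M *m row_mx 1%:M (const_mx 1)).
      rewrite mulmxA (_ : diag_mx _ *m M = V).
        exact: homV.
      by apply/matrixP=> i j; rewrite mul_diag_mx !mxE mulrC.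
    by rewrite -rM (leq_trans (mxrankM_maxr _ _)) // mxrankM_maxl.
  rewrite -rM; have -> : M = diag_mx (\row_i s i) *m (hom V *m col_mx 1%:M 0).
    rewrite mul_row_col mulmx0 addr0 mulmx1.
    by apply/matrixP=> i j; rewrite mul_diag_mx !mxE mulrC mulfVK.
  by rewrite (leq_trans (mxrankM_maxr _ _)) // mxrankM_maxl.
exists f, (cvx V setT); split.
- by split; [exact: cvx_polytope|apply/has_dim_cvx; rewrite /rk spnT rV; lia].
- move=> /(pyramid_sepP Vv)[i [w [wi wj]]]; have [phi [pM pi]] := kM i.
  have := congr1 (fun A : 'rV_(f + 1) => (A *m w) 0 0) (kV phi pM).
  rewrite mul0mx -mulmxA mxE (bigD1 i) //= big1 => [|j ji]; last by rewrite wj ?mulr0.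
  rewrite addr0 mxE [RHS]mxE => /eqP.
  by rewrite !mulf_eq0 (negPf pi) (negPf wi) (gt_eqF (s_gt0 i)).
- by rewrite card_vertices // Na.
rewrite card_facets -fb -[f in (_ <= f)%N]card_ord -cardsT.
apply: leq_trans (leq_imset_card (fun j => ~: supp (col j V)) _).
apply/subset_leq_card/subsetP=> Z; rewrite inE => /andP[/asboolP Zf /eqP rZ].
have [w [w0 ZE]] := Zf.
have [i iZ] : exists i, i \notin Z.
  apply/existsP; apply: contraT => /existsPn h.
  have ZT : Z = setT by apply/setP=> i; rewrite in_setT; have := h i; rewrite negbK.
  by move: rZ; rewrite ZT => /eqP; rewrite eqn_leq ltnn.
have [z z0 zE] : exists2 z, nonneg z & hom V *m w = V *m z.
  have [|z z0 zE] := gM (usubmx w + const_mx 1 *m dsubmx w).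
    move=> j; have := w0 j; rewrite homVE VE => h.
    by rewrite -(mulfVK (s_neq0 j) (_ j 0)) mulr_ge0 // ltW.
  by exists z => //; rewrite homVE; apply/colP=> j; rewrite !VE zE.
have V0 l j : 0 <= V l j by rewrite mxE divr_ge0 // ltW.
have [j Vij] : exists j, V i j * z j 0 != 0.
  apply/existsP; apply: contraNT iZ => /existsPn h; rewrite ZE !inE negbK zE mxE.
  by rewrite big1 // => j _; apply/eqP; have := h j; rewrite negbK.
have cE : col j V = hom V *m col_mx (delta_mx j 0) 0 by rewrite homVl -colE.
have Zjf : facial V (~: supp (col j V)).
  by rewrite cE; eexists; split; last reflexivity; rewrite -cE => l; rewrite mxE.
have ZZj : Z \subset ~: supp (col j V).
  apply/subsetP=> l; rewrite ZE !inE !negbK zE [col j V _ _]mxE mxE.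
  rewrite psumr_eq0 => [/allP/(_ j (mem_index_enum _))|m _]; last exact: mulr_ge0.
  rewrite /= mulf_eq0 => /orP[//|/eqP zj]; by rewrite zj mulr0 eqxx in Vij.
have iZj : i \notin ~: supp (col j V).
  rewrite !inE negbK mxE; by apply: contraNneq Vij => ->; rewrite mul0r.
apply/imsetP; exists j; rewrite ?inE //; apply/eqP; rewrite eqEsubset ZZj /=.
apply: contraT => nZ.
have lt1 : (rk V Z < rk V (~: supp (col j V)))%N.
  by apply: facial_rk_lt => //; rewrite properE ZZj.
have lt2 : (rk V (~: supp (col j V)) < rk V setT)%N.
  apply: facial_rk_lt => //; rewrite properE subsetT /=.
  by apply/subsetPn; exists i; rewrite ?in_setT.
by move: lt2; rewrite -rZ ltnS leqNgt lt1.
Qed.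

End Examples.

(** * Comparison with the stated bounds *)

(** Both expressions equal 13 + y at x = 5, and beyond that the binomial grows faster. *)
Lemma linear_le_upper_fun x y : (0 < x)%N -> (0 < y)%N ->
  (3 * x + y - 2 <= upper_fun x y)%N.
Proof.
move=> x0 y0; rewrite /upper_fun !eqn0Ngt x0 y0 /=.
have [//|x5] := leqP x 5.
have := mul_bin_diag x 1; rewrite bin1; nia.
Qed.

Lemma pyramid_bound_upper (R : realType) alpha beta :
  pyramid_bound R alpha beta (minn (upper_fun alpha beta) (upper_fun beta alpha)).
Proof.
move=> n d P Pd dU.
have [pP|nP] := pselect (pyramid P); first by apply: Or31.
have [cV|] := boolP ((vertices P #<= `I_(d + 1 + alpha)%N)%classic%card); last first.
  by move/negP=> h; apply: Or32.
have [cF|] := boolP ((facets P #<= `I_(d + 1 + beta)%N)%classic%card); last first.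
  by move/negP=> h; apply: Or33.
have [a0 b0 h1 h2] := nonpyramid_bounds Pd (leq_ltn_trans (leq0n _) dU) nP cV cF.
have := linear_le_upper_fun a0 b0; have := linear_le_upper_fun b0 a0.
move: dU; rewrite gtn_min => /orP[]; lia.
Qed.

Lemma pyramid_bound_lower (R : realType) alpha beta D :
  pyramid_bound R alpha beta D -> (lower_fun alpha beta <= D)%N.
Proof.
move=> pb; rewrite leqNgt; apply/negP=> Dl.
have [r rE rM] : exists2 r, lower_fun alpha beta = r.-1 & slack_model R alpha beta r.
  move: Dl; rewrite /lower_fun; case: ifP => // /negbT; rewrite negb_or -!lt0n => /andP[a0 b0] _.
  have [ba|ab] := leqP beta alpha.
    exists (alpha + 2 * beta)%N; last by apply: slack_model_exists; rewrite b0.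
    (* When the smaller argument is 1, the general formula already gives the sum of the two, so one
       family of examples covers both cases. *)
    by case: ifP => [/orP[]/eqP|_]; lia.
  exists (beta + 2 * alpha)%N.
    by case: ifP => [/orP[]/eqP|_]; lia.
  by apply/slack_model_tr/slack_model_exists; rewrite a0 ltnW.
have r0 : (1 < r)%N by move: Dl; rewrite rE; case: (r) => [|[]].
have [n [P [Pd nP cV cF]]] := slack_model_polytope rM (ltnW r0).
have rS : (r.-1 + 1)%N = r by rewrite addn1 prednK // ltnW.
rewrite rE in Dl.
have [//||] := pb _ _ _ Pd Dl; by rewrite rS.
Qed.

Theorem theorem2 (R : realType) (alpha beta : nat) :
  (forall n : nat, join_bound R alpha beta n <-> pyramid_bound R alpha beta n)
  /\ exists D : nat,
       [/\ join_bound R alpha beta D,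
           (forall n : nat, join_bound R alpha beta n -> (D <= n)%N),
           (lower_fun alpha beta <= D)%N &
           (D <= minn (upper_fun alpha beta) (upper_fun beta alpha))%N].
Proof.
have jp n : join_bound R alpha beta n <-> pyramid_bound R alpha beta n.
  by split; [exact: join_bound_pyramid|exact: pyramid_bound_join].
split=> //.
have jU := (jp _).2 (@pyramid_bound_upper R alpha beta).
have [|D /asboolP jD Dmin] := @ex_minnP (fun n => `[< join_bound R alpha beta n >]).
  by eexists; apply/asboolP; exact: jU.
exists D; split=> // [n jn||].
- by apply: Dmin; apply/asboolP.
- by apply/pyramid_bound_lower/jp.
- by apply: Dmin; apply/asboolP.
Qed.
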